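(* Permutation Orbit Local Minimization (PLOM) is PLS-complete even when restricted to instances in which the given permutations are $\pi^{i_1},\pi^{i_2},\dots,\pi^{i_n}$, all powers of one single permutation $\pi$.
   Context: PLS (Polynomial Local Search) is the class of local optimization problems in which a starting feasible solution and the neighborhood of a solution are computable in polynomial time, feasibility is recognizable in polynomial time, and one must output a local optimum. PLS-completeness is with respect to PLS-reductions (polynomial-time maps $f$ on instances and $g$ mapping local optima of $f(I)$ back to local optima of $I$). PLOM: the input is a set of positions $V=\{1,\dots,N\}$, permutations $\pi_1,\dots,\pi_k\in S_V$, and a string $s:V\to\{0,1\}$. A solution is a permutation $\sigma$ in the group $\langle\pi_1,\dots,\pi_k\rangle$ (given explicitly as a permutation); it is a local minimum if the string $v=s\circ\sigma$ satisfies $v\circ\pi_i\ge_{\mathrm{lex}} v$ for all $i$, where strings are compared lexicographically with position $1$ most significant. The task is to output such a local minimum $\sigma$. *)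

(* Defs.v *)
From mathcomp Require Import all_boot all_order all_fingroup.

Set Implicit Arguments.
Unset Strict Implicit.
Unset Printing Implicit Defensive.

Definition word := seq bool.

(* Polynomial time is taken with respect to multi-stack machines: a finite
   program acting on finitely many stacks of bits, one stack operation per time
   unit.  A work tape is a pair of stacks and a stack is a one-sided tape, so
   multi-stack machines and multi-tape Turing machines simulate each other with
   constant-factor overhead. *)
Inductive instr :=
| Push (r : nat) (b : bool)
| Pop (r : nat) (on_empty on_false on_true : nat).

Definition program := seq instr.

Definition config := (nat * (nat -> word))%type.

Definition update (R : nat -> word) (r : nat) (w : word) : nat -> word :=
  fun r' => if r' == r then w else R r'.

(* A machine whose program counter leaves the program has halted. *)
Definition step (p : program) (c : config) : config :=
  let: (pc, R) := c in
  match onth p pc with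
  | None => c
  | Some (Push r b) => (pc.+1, update R r (b :: R r))
  | Some (Pop r e f t) =>
      match R r with
      | [::] => (e, R)
      | b :: w => (if b then t else f, update R r w)
      end
  end.

(* The arguments are initially on stacks 0, 1, ..., the other stacks are empty;
   the result is the final content of stack 0. *)
Definition computes_within (p : program) (args : seq word) (out : word)
    (time : nat) : Prop :=
  let c := iter time (step p) (0, nth [::] args) in
  size p <= c.1 /\ c.2 0 = out.

Definition polytime_on (D : seq word -> Prop) (f : seq word -> word) : Prop :=
  exists (p : program) (k : nat), forall args, D args ->
    computes_within p args (f args) (size (flatten args) ^ k + k).

Definition polytime1 (D : word -> Prop) (f : word -> word) : Prop :=
  polytime_on (fun a => exists2 x, D x & a = [:: x])
              (fun a => f (nth [::] a 0)).

Definition polytime2 (D : word -> word -> Prop) (f : word -> word -> word) :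
    Prop :=
  polytime_on (fun a => exists x y, D x y /\ a = [:: x; y])
              (fun a => f (nth [::] a 0) (nth [::] a 1)).

Definition word_code (w : word) : word :=
  flatten [seq [:: true; b] | b <- w] ++ [:: false].

Definition words_code (ws : seq word) : word := flatten (map word_code ws).

Definition binary_value (w : word) : nat :=
  foldl (fun n (b : bool) => n.*2 + b) 0 w.

(* Instances and solutions are binary words; the last three fields are only
   meaningful on instances.  [no_worse I x y] says that the solution x of I is
   at least as good as the solution y. *)
Record local_problem := LocalProblem {
  is_instance : word -> Prop;
  feasible : word -> word -> Prop;
  neighbor : word -> word -> word -> Prop;
  no_worse : word -> word -> word -> Prop
}.

Definition local_opt (L : local_problem) (I x : word) : Prop :=
  feasible L I x /\ forall y, neighbor L I x y -> no_worse L I x y.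

Definition restrict (L : local_problem) (D : word -> Prop) : local_problem :=
  {| is_instance I := is_instance L I /\ D I;
     feasible := feasible L;
     neighbor := neighbor L;
     no_worse := no_worse L |}.

Definition feasible_pair (L : local_problem) (I x : word) : Prop :=
  is_instance L I /\ feasible L I x.

Record in_PLS (L : local_problem) : Prop := InPLS {
  PLS_length : exists k, forall I x, feasible_pair L I x ->
    size x <= size I ^ k + k;
  PLS_feasible : exists chi : word -> word -> bool,
    polytime2 (fun I _ => is_instance L I) (fun I x => [:: chi I x]) /\
    forall I x, is_instance L I -> (chi I x <-> feasible L I x);
  PLS_start : exists start : word -> word,
    polytime1 (is_instance L) start /\
    forall I, is_instance L I -> feasible L I (start I);
  PLS_neighborhood : exists nbhd : word -> word -> seq word,
    polytime2 (feasible_pair L) (fun I x => words_code (nbhd I x)) /\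
    forall I x, feasible_pair L I x ->
      forall y, (y \in nbhd I x <-> neighbor L I x y) /\
                (neighbor L I x y -> feasible L I y);
  (* The objective value is a natural number computed in binary, to be
     minimized or maximized. *)
  PLS_cost : exists (maximize : bool) (cost : word -> word -> word),
    polytime2 (feasible_pair L) cost /\
    forall I x y, is_instance L I -> feasible L I x -> feasible L I y ->
      (no_worse L I x y <->
       if maximize then binary_value (cost I y) <= binary_value (cost I x)
       else binary_value (cost I x) <= binary_value (cost I y))
}.

Definition PLS_reducible (L M : local_problem) : Prop :=
  exists (f : word -> word) (g : word -> word -> word),
    [/\ polytime1 (is_instance L) f,
        polytime2 (fun I y => is_instance L I /\ feasible M (f I) y) g,
        forall I, is_instance L I -> is_instance M (f I)
      & forall I y, is_instance L I -> local_opt M (f I) y ->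
          local_opt L I (g I y)].

Definition PLS_complete (M : local_problem) : Prop :=
  in_PLS M /\ forall L, in_PLS L -> PLS_reducible L M.

(* The positions 1, ..., N are the elements 0, ..., N - 1 of 'I_N. *)
Record plom := Plom {
  npos : nat;
  gens : seq {perm 'I_npos};
  str : {ffun 'I_npos -> bool}
}.

(* A permutation is the list of its values, each in unary; as there are N
   values, all less than N, this is polynomially equivalent to a list of
   binary numbers. *)
Definition perm_code (N : nat) (sigma : {perm 'I_N}) : word :=
  flatten [seq rcons (nseq (sigma i) true) false | i <- enum 'I_N].

Definition plom_code (P : plom) : word :=
  words_code ([seq str P i | i <- enum 'I_(npos P)]
              :: [seq perm_code pi | pi <- gens P]).

Definition plom_group (P : plom) : {set {perm 'I_(npos P)}} :=
  <<[set pi in gens P]>>%g.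

(* The word s o sigma, position 1 first. *)
Definition view (P : plom) (sigma : {perm 'I_(npos P)}) : word :=
  [seq str P (sigma i) | i <- enum 'I_(npos P)].

Definition lex_le (v w : word) : bool :=
  ((v : seqlexi bool) <= w)%O.

(* As (pi * sigma)%g is the map sigma o pi, its view is v o pi for v the view
   of sigma. *)
Definition PLOM : local_problem :=
  {| is_instance I := exists P, I = plom_code P;
     feasible I x := exists P (sigma : {perm 'I_(npos P)}),
       [/\ I = plom_code P, x = perm_code sigma & sigma \in plom_group P];
     neighbor I x y := exists P (sigma pi : {perm 'I_(npos P)}),
       [/\ I = plom_code P, x = perm_code sigma, pi \in gens P
         & y = perm_code (pi * sigma)%g];
     no_worse I x y := exists P (sigma tau : {perm 'I_(npos P)}),
       [/\ I = plom_code P, x = perm_code sigma, y = perm_code tau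
         & lex_le (view sigma) (view tau)] |}.

Definition powers_of_one (P : plom) : Prop :=
  exists (pi : {perm 'I_(npos P)}) (exps : seq nat),
    gens P = [seq (pi ^+ i)%g | i <- exps].

Definition PLOM_powers : local_problem :=
  restrict PLOM (fun I => exists2 P, I = plom_code P & powers_of_one P).

Lemma prefix_code_inj (T : Type) (c : T -> word) :
  (forall x, c x <> [::]) ->
  (forall x y u v, c x ++ u = c y ++ v -> x = y /\ u = v) ->
  injective (fun l => flatten (map c l)).
Proof.
move=> c0 cP; elim=> [|x l IH] [|y m] //= E.
- by case: (c y) (c0 y) E.
- by case: (c x) (c0 x) E.
- by case/cP: E => -> /IH ->.
Qed.

Lemma words_code_inj : injective words_code.
Proof.
apply: prefix_code_inj => [[]//|].
elim=> [|b x IH] [|b' y] u v //=; first by case.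
by case=> -> /IH [-> ->].
Qed.

Lemma perm_code_inj N : injective (@perm_code N).
Proof.
move=> s t; rewrite /perm_code.
have codeE (r : {perm 'I_N}) :
    [seq rcons (nseq (r i) true) false | i <- enum 'I_N] =
    [seq rcons (nseq n true) false | n <- [seq val (r i) | i <- enum 'I_N]].
  by rewrite -map_comp.
rewrite !codeE => /(@prefix_code_inj _ (fun n => rcons (nseq n true) false)) E.
apply/permP => i; apply: val_inj.
apply: ((eq_in_map _ _ _).2 (E _ _) i); last by rewrite mem_enum.
- by case.
- elim=> [|n IH] [|m] u v //=; first by case.
  by case=> /IH [-> ->].
Qed.

Lemma plom_code_inj : injective plom_code.
Proof.
case=> N g s [M h t] /words_code_inj /= [].
move=> Es; have EN : N = M by rewrite -(size_enum_ord N) -(size_map s) Es size_map size_enum_ord.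
case: M / EN h t Es => h t Es /(inj_map (@perm_code_inj N)) ->.
congr Plom; apply/ffunP => i.
by apply: ((eq_in_map _ _ _).2 Es); rewrite mem_enum.
Qed.

Lemma PLOM_local_optP (P : plom) (sigma : {perm 'I_(npos P)}) :
  local_opt PLOM (plom_code P) (perm_code sigma) <->
  sigma \in plom_group P /\
  forall pi, pi \in gens P ->
    lex_le (view sigma) [seq str P (sigma (pi i)) | i <- enum 'I_(npos P)].
Proof.
have viewM pi : view (pi * sigma)%g
    = [seq str P (sigma (pi i)) | i <- enum 'I_(npos P)].
  by apply: eq_map => i; rewrite permM.
split=> [[[Q [tau [/plom_code_inj E]]]]|[sG loc]].
  case: Q / E tau => tau /perm_code_inj <- sG loc; split=> // pi pig.
  have /loc /= : neighbor PLOM (plom_code P) (perm_code sigma)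
      (perm_code (pi * sigma)%g) by exists P, sigma, pi.
  case=> Q [tau1 [tau2 [/plom_code_inj E]]].
  by case: Q / E tau1 tau2 => ? ? /perm_code_inj <- /perm_code_inj <-; rewrite viewM.
split; first by exists P, sigma.
move=> y [Q [tau [pi [/plom_code_inj E]]]].
case: Q / E tau pi => ? pi /perm_code_inj <- pig ->.
by exists P, sigma, (pi * sigma)%g; split=> //; rewrite viewM; exact: loc.
Qed.

(* Main.v *)
From mathcomp Require Import all_boot all_order all_fingroup zify.
From Stdlib Require Import FunctionalExtensionality.
Require Import Defs.

Set Implicit Arguments.
Unset Strict Implicit.
Unset Printing Implicit Defensive.

(** Membership in PLS is clear up to deciding membership in a permutation group,
    which is done by sifting: a table of group elements is completed until the
    products of any two of its elements sift to the identity.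

    For hardness, let [X] be a solution and let the function [improve] compute the
    cost of [X] together with a better neighbor if there is one.  Two copies of the
    tableau of a machine for [improve] are laid out side by side, and a clock tells
    which copy is being read and how many gates of the other copy have already been
    recomputed from the neighbor found by the first one.  The string to be minimized
    lists first the violated gates that are active at the current clock value, then
    the cost in the copy that is read, and then the clock.  In a local minimum no
    active gate is violated, the clock stands at the end of its run, and switching to
    the other copy does not lower the cost, so that the solution of the copy that is
    read is a local optimum.  Every clock value and gate value is a residue modulo its
    own prime; each bit of the string depends on at most six of them and is read off a
    product of six cycles.  By the Chinese remainder theorem all simultaneous
    translations are powers of the translation by one. *)

(** * Structured stack programs *)

(** The obstacle is that all generators commute and are fixed in advance: a move adds constants to
    residues and cannot look at the state. Assigning a value therefore means adding a difference,
    and all differences are offered as generators. Gates are recomputed one per step; but advancing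
    the clock activates a further gate, which might be violated, so one generator moves the clock
    and one variable together. The order of the blocks is a topological order of the active gates,
    so that repairing the first violated one disturbs only less significant bits. Six counts the
    clock, the variable of the gate and the four cells that determine the next cell of a tableau:
    the top cell, the cell itself and its two neighbors. As six is constant, the number of positions
    stays polynomial once enough distinct primes of polynomial size exist, which a Chebyshev bound
    by central binomial coefficients provides. Residues that encode nothing are harmless: gates
    overwrite them, inputs are read as zero or nonzero, and every word read there, feasible or not,
    has a cost and a successor. *)

(* [Case r ce cf ct] pops stack r and branches on the result; [While r c] pops
   stack r and runs c again as long as the popped bit is [true]. *)
Inductive cmd :=
| Skip
| Emit (r : nat) (b : bool)
| Seq (c1 c2 : cmd)
| Case (r : nat) (ce cf ct : cmd)
| While (r : nat) (c : cmd).

Fixpoint csize c :=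
  match c with
  | Skip => 0
  | Emit _ _ => 1
  | Seq c1 c2 => csize c1 + csize c2
  | Case _ ce cf ct => csize ce + csize cf + csize ct + 5
  | While _ c => csize c + 3
  end.

(* A push followed by a pop of the same stack is an unconditional jump. *)
Definition jump (r z : nat) : program := [:: Push r false; Pop r z z z].

Fixpoint compile (a : nat) (c : cmd) : program :=
  match c with
  | Skip => [::]
  | Emit r b => [:: Push r b]
  | Seq c1 c2 => compile a c1 ++ compile (a + csize c1) c2
  | Case r ce cf ct =>
      let z := a + csize c in
      Pop r a.+1 (a.+1 + csize ce + 2) (a.+1 + csize ce + 2 + csize cf + 2) ::
      compile a.+1 ce ++ jump r z ++ compile (a.+1 + csize ce + 2) cf ++
      jump r z ++ compile (a.+1 + csize ce + 2 + csize cf + 2) ct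
  | While r c' =>
      let z := a + csize c in
      Pop r z z a.+1 :: compile a.+1 c' ++ jump r a
  end.

Lemma size_compile c a : size (compile a c) = csize c.
Proof.
elim: c a => [|r b|c1 IH1 c2 IH2|r ce IHe cf IHf ct IHt|r c IH] a //=.
- by rewrite size_cat IH1 IH2.
- rewrite !size_cat /= IHe size_cat /= IHf IHt; lia.
- rewrite size_cat IH /=; lia.
Qed.

Definition code_at (p : program) (a : nat) (q : program) :=
  exists pre post, p = pre ++ q ++ post /\ size pre = a.

Lemma code_at_cat p a q1 q2 :
  code_at p a (q1 ++ q2) -> code_at p a q1 /\ code_at p (a + size q1) q2.
Proof.
case=> pre [post [-> <-]]; split.
  by exists pre, (q2 ++ post); rewrite -catA.
by exists (pre ++ q1), post; rewrite size_cat -!catA.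
Qed.

Lemma onth_size_cat T (s1 s2 : seq T) : onth (s1 ++ s2) (size s1) = onth s2 0.
Proof. by elim: s1. Qed.

Lemma code_at_cons p a i q :
  code_at p a (i :: q) -> onth p a = Some i /\ code_at p a.+1 q.
Proof.
case=> pre [post [-> <-]]; split; first by rewrite onth_size_cat.
by exists (rcons pre i), post; rewrite size_rcons cat_rcons.
Qed.

Lemma update_at R r w : update R r w r = w.
Proof. by rewrite /update eqxx. Qed.

Lemma update_same R r w w' : update (update R r w) r w' = update R r w'.
Proof. by apply: functional_extensionality => x; rewrite /update; case: eqP. Qed.

Lemma update_id R r : update R r (R r) = R.
Proof. by apply: functional_extensionality => x; rewrite /update; case: eqP => [->|]. Qed.

Arguments step : simpl never.

Lemma step_push p a R r b :
  onth p a = Some (Push r b) -> step p (a, R) = (a.+1, update R r (b :: R r)).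
Proof. by rewrite /step => ->. Qed.

Lemma step_pop p a R r e f t : onth p a = Some (Pop r e f t) ->
  step p (a, R) = if R r is b :: w then (if b then t else f, update R r w)
                  else (e, R).
Proof. by rewrite /step => ->; case: (R r). Qed.

Lemma jumpP p a r z R : code_at p a (jump r z) -> iter 2 (step p) (a, R) = (z, R).
Proof.
case/code_at_cons=> e1 /code_at_cons [e2 _].
by rewrite /= (step_push _ e1) (step_pop _ e2) update_at update_same update_id.
Qed.

(** Quantifying over the host program and the address makes the predicate compositional, because a
    subcommand is compiled at a shifted address. Time is an upper bound only, so estimates may be
    loosened freely. *)
Definition runs (c : cmd) (R : nat -> word) (n : nat) (R' : nat -> word) :=
  forall p a, code_at p a (compile a c) ->
    exists2 t, t <= n & iter t (step p) (a, R) = (a + csize c, R').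

Lemma runs_weaken c R n m R' : runs c R n R' -> n <= m -> runs c R m R'.
Proof. by move=> h le p a /h [t lt E]; exists t => //; apply: leq_trans le. Qed.

Lemma runs_skip R : runs Skip R 0 R.
Proof. by move=> p a _; exists 0; rewrite ?addn0. Qed.

Lemma runs_emit R r b : runs (Emit r b) R 1 (update R r (b :: R r)).
Proof. by move=> p a /code_at_cons[E _]; exists 1 => //=; rewrite (step_push _ E) addn1. Qed.

Lemma runs_emitE R r b R' : R' = update R r (b :: R r) -> runs (Emit r b) R 1 R'.
Proof. by move=> ->; exact: runs_emit. Qed.

Lemma runs_seq c1 c2 R n1 R1 n2 R2 :
  runs c1 R n1 R1 -> runs c2 R1 n2 R2 -> runs (Seq c1 c2) R (n1 + n2) R2.
Proof.
move=> h1 h2 p a /= /code_at_cat []; rewrite size_compile => /h1[t1 l1 E1].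
case/h2=> t2 l2 E2; exists (t2 + t1); first by rewrite addnC leq_add.
by rewrite iterD E1 E2 addnA.
Qed.

Lemma code_at_case p a r ce cf ct : code_at p a (compile a (Case r ce cf ct)) ->
  let z := a + csize (Case r ce cf ct) in
  let af := a.+1 + csize ce + 2 in let at_ := af + csize cf + 2 in
  [/\ onth p a = Some (Pop r a.+1 af at_),
      code_at p a.+1 (compile a.+1 ce) /\ code_at p (a.+1 + csize ce) (jump r z),
      code_at p af (compile af cf) /\ code_at p (af + csize cf) (jump r z)
    & code_at p at_ (compile at_ ct)].
Proof.
move=> /= /code_at_cons[E1] /code_at_cat[E2]; rewrite size_compile => H.
have [E3 {}H] := @code_at_cat p _ (jump r _) _ H.
have [E4] := code_at_cat H; rewrite size_compile => {}H.
have [E5 {}H] := @code_at_cat p _ (jump r _) _ H.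
by split.
Qed.

Lemma runs_case c R r ce cf ct n R' :
  c = Case r ce cf ct ->
  match R r with
  | [::] => runs ce R n R'
  | b :: w => runs (if b then ct else cf) (update R r w) n R'
  end -> runs c R (n + 3) R'.
Proof.
move=> -> H p a /code_at_case /= [E [E1 J1] [E2 J2] E3].
case Er: (R r) H => [|[] w] H.
- have [t lt Et] := H _ _ E1; exists (2 + (t + 1)); first lia.
  by rewrite iterD (iterD t) [iter 1 _ _]/= (step_pop _ E) Er Et; exact: jumpP J1.
- have [t lt Et] := H _ _ E3; exists (t + 1); first lia.
  rewrite iterD /= (step_pop _ E) Er Et; congr pair; lia.
- have [t lt Et] := H _ _ E2; exists (2 + (t + 1)); first lia.
  by rewrite iterD (iterD t) [iter 1 _ _]/= (step_pop _ E) Er Et; exact: jumpP J2.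
Qed.

Lemma code_at_while p a r c : code_at p a (compile a (While r c)) ->
  let z := a + csize (While r c) in
  [/\ onth p a = Some (Pop r z z a.+1), code_at p a.+1 (compile a.+1 c)
    & code_at p (a.+1 + csize c) (jump r a)].
Proof.
by move=> /= /code_at_cons[E1] /code_at_cat[E2]; rewrite size_compile => H.
Qed.

Lemma runs_while_stop R R' r c w : R r = false :: w -> R' = update R r w ->
  runs (While r c) R 1 R'.
Proof.
by move=> Er -> p a /code_at_while [E _ _]; exists 1 => //=; rewrite (step_pop _ E) Er.
Qed.

Lemma runs_while_step R r c w n1 R1 n2 R2 : R r = true :: w ->
  runs c (update R r w) n1 R1 -> runs (While r c) R1 n2 R2 ->
  runs (While r c) R (n2 + (n1 + 3)) R2.
Proof.
move=> Er h1 h2 p a H; have [E E1 J] := code_at_while H.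
have [t1 l1 Et1] := h1 _ _ E1; have [t2 l2 Et2] := h2 _ _ H.
exists (t2 + (2 + (t1 + 1))); first lia.
by rewrite iterD (iterD 2) (iterD t1) [iter 1 _ _]/= (step_pop _ E) Er Et1 (jumpP _ J).
Qed.

Lemma size_step p a R r : size ((step p (a, R)).2 r) <= (size (R r)).+1.
Proof.
rewrite /step; case: (onth p a) => [[r' b|r' e f t]|] //=.
  by rewrite /update; case: eqP => [->|].
case Er: (R r') => [|b w] //=; rewrite /update; case: eqP => [->|] //.
by rewrite Er /=; lia.
Qed.

Lemma size_iter_step p n c r : size ((iter n (step p) c).2 r) <= size (c.2 r) + n.
Proof.
elim: n => [|n IH] /=; first by rewrite addn0.
case E: (iter n (step p) c) IH => [a R] /= IH.
apply: leq_trans (size_step _ _ _ _) _; lia.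
Qed.

(** A step pushes at most one bit, so a time bound is also a bound on the growth of the result; this
    is what makes polynomial bounds compose. *)
Lemma runs_size c R n R' r : runs c R n R' -> size (R' r) <= size (R r) + n.
Proof.
move=> /(_ (compile 0 c) 0) []; first by exists [::], [::]; rewrite cats0.
move=> t lt Et; have := size_iter_step (compile 0 c) t (0, R) r.
by rewrite Et /=; lia.
Qed.

Lemma iter_halted p n a R : size p <= a -> iter n (step p) (a, R) = (a, R).
Proof.
move=> le; elim: n => //= n ->; rewrite /step.
have -> // : onth p a = None.
by elim: p a le => [|i p IH] [|a] //= /IH.
Qed.

Lemma runs_computes c args n R' :
  runs c (nth [::] args) n R' ->
  forall m, n <= m -> computes_within (compile 0 c) args (R' 0) m.
Proof.
move=> /(_ (compile 0 c) 0) []; first by exists [::], [::]; rewrite cats0.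
move=> t lt Et m le; have tm : t <= m by lia.
rewrite /computes_within -(subnK tm) iterD Et add0n iter_halted ?size_compile //.
Qed.

(** In the calculus on trees, stack 0 holds the data; 1 and 2 are buffers for moving subtrees, 3
    drives the loops over a tree, and 4 holds unary iteration counters. *)
Definition regs (w0 w1 w2 w3 w4 : word) : nat -> word :=
  nth [::] [:: w0; w1; w2; w3; w4].

Lemma update_regs0 a b c d e w : update (regs a b c d e) 0 w = regs w b c d e.
Proof. by apply: functional_extensionality => -[|[|[|[|[|r]]]]]. Qed.
Lemma update_regs1 a b c d e w : update (regs a b c d e) 1 w = regs a w c d e.
Proof. by apply: functional_extensionality => -[|[|[|[|[|r]]]]]. Qed.
Lemma update_regs2 a b c d e w : update (regs a b c d e) 2 w = regs a b w d e.
Proof. by apply: functional_extensionality => -[|[|[|[|[|r]]]]]. Qed.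
Lemma update_regs3 a b c d e w : update (regs a b c d e) 3 w = regs a b c w e.
Proof. by apply: functional_extensionality => -[|[|[|[|[|r]]]]]. Qed.
Lemma update_regs4 a b c d e w : update (regs a b c d e) 4 w = regs a b c d w.
Proof. by apply: functional_extensionality => -[|[|[|[|[|r]]]]]. Qed.
Definition update_regs :=
  (update_regs0, update_regs1, update_regs2, update_regs3, update_regs4).

(** * Trees and their prefix code *)

Inductive tree := Leaf | Node (a b : tree).

(** The code is self-delimiting, so several trees can lie on one stack without separators, and the
    topmost is consumed without knowing its length. *)
Fixpoint code (t : tree) : word :=
  match t with
  | Leaf => [:: false]
  | Node a b => true :: code a ++ code b
  end.

Definition pushes (r : nat) (w : word) : cmd :=
  foldr (fun b c => Seq c (Emit r b)) Skip w.

Lemma runs_pushes r w R : runs (pushes r w) R (size w) (update R r (w ++ R r)).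
Proof.
elim: w => [|b w IH] /=; first by rewrite update_id; exact: runs_skip.
have := runs_seq IH (@runs_emit _ r b).
by rewrite update_same addn1 /update eqxx.
Qed.

Lemma runs_pushesE r w R n R' : size w <= n -> R' = update R r (w ++ R r) ->
  runs (pushes r w) R n R'.
Proof. by move=> le ->; apply: runs_weaken le; exact: runs_pushes. Qed.

Arguments pushes : simpl never.

Section Eat.
Variables (emit : bool -> cmd) (e1 e2 : bool -> word -> word).
Hypothesis emitP : forall b w0 w1 w2 w3 w4,
  runs (emit b) (regs w0 w1 w2 w3 w4) 4 (regs w0 (e1 b w1) (e2 b w2) w3 w4).

(* Stack 3 counts, in unary, the subtrees that remain to be read. *)
Definition eat_body :=
  Case 0 Skip (emit false) (Seq (emit true) (pushes 3 [:: true; true])).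

Definition eat := Seq (pushes 3 [:: true; false]) (While 3 eat_body).

Let f1 := foldl (fun w b => e1 b w).
Let f2 := foldl (fun w b => e2 b w).

(** Continuation form: a run of the loop after the tree extends to one that reads the tree first. In
    the induction a node replaces its mark on stack 3 by two, one per child, and the hypothesis for
    the first child takes that for the second as its continuation. *)
Lemma eat_loop t u w1 w2 v w4 n R' :
  runs (While 3 eat_body) (regs u (f1 w1 (code t)) (f2 w2 (code t)) v w4) n R' ->
  runs (While 3 eat_body) (regs (code t ++ u) w1 w2 (true :: v) w4)
    (n + 12 * size (code t)) R'.
Proof.
elim: t u w1 w2 v n => [|a IHa b IHb] u w1 w2 v n H.
  eapply runs_weaken; first apply: (runs_while_step (w := v)).
  - by [].
  - rewrite update_regs; apply: runs_case => //=.
    by rewrite update_regs; exact: emitP.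
  - by exact: H.
  - by rewrite /=; lia.
eapply runs_weaken; first apply: (runs_while_step (w := v)).
- by [].
- rewrite update_regs; apply: runs_case => //=.
  rewrite update_regs; apply: runs_seq; first exact: emitP.
  exact: runs_pushes.
- rewrite update_regs -catA; apply: IHa; apply: IHb.
  by rewrite /f1 /f2 -!foldl_cat; exact: H.
- by rewrite /= size_cat; lia.
Qed.

Lemma runs_eat t u w1 w2 w3 w4 :
  runs eat (regs (code t ++ u) w1 w2 w3 w4) (12 * size (code t) + 3)
    (regs u (f1 w1 (code t)) (f2 w2 (code t)) w3 w4).
Proof.
eapply runs_weaken; first (apply: runs_seq; first exact: runs_pushes).
  by rewrite update_regs /=; apply: eat_loop; apply: runs_while_stop => //; rewrite update_regs.
by rewrite /=; lia.
Qed.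
End Eat.

(** [While] tests by popping, so each stored bit is preceded by a [true] that announces it, and a
    [false] underneath ends the buffer. The buffer is reversed, and [back] restores the order. *)
Definition marks (l w : word) : word := foldl (fun w b => true :: b :: w) w l.

Lemma marks_rcons l b w : marks (rcons l b) w = true :: b :: marks l w.
Proof. by rewrite /marks foldl_rcons. Qed.

Lemma foldl_keep (w l : word) : foldl (fun w _ => w) w l = w.
Proof. by elim: l. Qed.

Definition back (r : nat) := While r (Case r Skip (Emit 0 false) (Emit 0 true)).

Lemma runs_back1 l w0 v w2 w3 w4 :
  runs (back 1) (regs w0 (marks l (false :: v)) w2 w3 w4) (8 * size l + 1)
    (regs (l ++ w0) v w2 w3 w4).
Proof.
elim/last_ind: l w0 => [|l b IH] w0.
  by apply: runs_while_stop => //; rewrite update_regs.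
eapply runs_weaken; first apply: runs_while_step.
- by rewrite /= marks_rcons.
- rewrite update_regs; apply: runs_case => //=.
  have -> : (if b then Emit 0 true else Emit 0 false) = Emit 0 b by case: b.
  exact: runs_emit.
- rewrite !update_regs /= cat_rcons; exact: IH.
- by rewrite size_rcons; lia.
Qed.

Lemma runs_back2 l w0 w1 v w3 w4 :
  runs (back 2) (regs w0 w1 (marks l (false :: v)) w3 w4) (8 * size l + 1)
    (regs (l ++ w0) w1 v w3 w4).
Proof.
elim/last_ind: l w0 => [|l b IH] w0.
  by apply: runs_while_stop => //; rewrite update_regs.
eapply runs_weaken; first apply: runs_while_step.
- by rewrite /= marks_rcons.
- rewrite update_regs; apply: runs_case => //=.
  have -> : (if b then Emit 0 true else Emit 0 false) = Emit 0 b by case: b.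
  exact: runs_emit.
- rewrite !update_regs /= cat_rcons; exact: IH.
- by rewrite size_rcons; lia.
Qed.

Definition Drop := eat (fun _ => Skip).

Lemma runs_drop t u w1 w2 w3 w4 :
  runs Drop (regs (code t ++ u) w1 w2 w3 w4) (12 * size (code t) + 3)
    (regs u w1 w2 w3 w4).
Proof.
have H := @runs_eat (fun _ => Skip) (fun _ w => w) (fun _ w => w).
have /= := H _ t u w1 w2 w3 w4; rewrite !foldl_keep; apply => *.
exact: runs_weaken (@runs_skip _) _.
Qed.

Definition Out1 := Seq (pushes 1 [:: false]) (eat (fun b => pushes 1 [:: true; b])).
Definition Out2 := Seq (pushes 2 [:: false]) (eat (fun b => pushes 2 [:: true; b])).

Lemma runs_out1 t u w1 w2 w3 w4 :
  runs Out1 (regs (code t ++ u) w1 w2 w3 w4) (12 * size (code t) + 4)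
    (regs u (marks (code t) (false :: w1)) w2 w3 w4).
Proof.
eapply runs_weaken; first (apply: runs_seq; first exact: runs_pushes).
  rewrite update_regs.
  have H := @runs_eat _ (fun b w => true :: b :: w) (fun _ w => w).
  have := H _ _ t u (false :: w1) w2 w3 w4; rewrite !foldl_keep; apply => *.
  by apply: runs_pushesE => //; rewrite update_regs.
by rewrite /=; lia.
Qed.

Lemma runs_out2 t u w1 w2 w3 w4 :
  runs Out2 (regs (code t ++ u) w1 w2 w3 w4) (12 * size (code t) + 4)
    (regs u w1 (marks (code t) (false :: w2)) w3 w4).
Proof.
eapply runs_weaken; first (apply: runs_seq; first exact: runs_pushes).
  rewrite update_regs.
  have H := @runs_eat _ (fun _ w => w) (fun b w => true :: b :: w).
  have := H _ _ t u w1 (false :: w2) w3 w4; rewrite !foldl_keep; apply => *.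
  by apply: runs_pushesE => //; rewrite update_regs.
by rewrite /=; lia.
Qed.

Definition Swap := Seq Out1 (Seq Out2 (Seq (back 1) (back 2))).

Lemma runs_swap a b u w1 w2 w3 w4 :
  runs Swap (regs (code a ++ code b ++ u) w1 w2 w3 w4)
    (20 * (size (code a) + size (code b)) + 10)
    (regs (code b ++ code a ++ u) w1 w2 w3 w4).
Proof.
eapply runs_weaken.
  apply: runs_seq; first exact: runs_out1.
  apply: runs_seq; first exact: runs_out2.
  apply: runs_seq; first exact: runs_back1.
  exact: runs_back2.
lia.
Qed.

Definition Dup :=
  Seq (pushes 1 [:: false]) (Seq (pushes 2 [:: false])
  (Seq (eat (fun b => Seq (pushes 1 [:: true; b]) (pushes 2 [:: true; b])))
  (Seq (back 1) (back 2)))).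

Lemma runs_dup a u w1 w2 w3 w4 :
  runs Dup (regs (code a ++ u) w1 w2 w3 w4) (28 * size (code a) + 10)
    (regs (code a ++ code a ++ u) w1 w2 w3 w4).
Proof.
eapply runs_weaken.
  apply: runs_seq; first exact: runs_pushes.
  apply: runs_seq; first exact: runs_pushes.
  rewrite !update_regs; apply: runs_seq.
    apply: (@runs_eat _ (fun b w => true :: b :: w) (fun b w => true :: b :: w)) => *.
    apply: (@runs_seq _ _ _ 2 _ 2); first exact: runs_pushes.
    by apply: runs_pushesE; rewrite // !update_regs.
  apply: runs_seq; first exact: runs_back1.
  exact: runs_back2.
by rewrite /=; lia.
Qed.

(** * Polynomial-time functions on encoded data *)

(** Bounds are syntactic polynomials with natural coefficients: monotone and closed under
    substitution, hence under composition of programs. The form [n ^ k + k] is restored only at the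
    end. *)
Inductive pexp := PX | PC (n : nat) | PA (a b : pexp) | PM (a b : pexp).

Fixpoint peval (e : pexp) (n : nat) : nat :=
  match e with
  | PX => n
  | PC c => c
  | PA a b => peval a n + peval b n
  | PM a b => peval a n * peval b n
  end.

Fixpoint psubst (e d : pexp) : pexp :=
  match e with
  | PX => d
  | PC c => PC c
  | PA a b => PA (psubst a d) (psubst b d)
  | PM a b => PM (psubst a d) (psubst b d)
  end.

Lemma peval_subst e d n : peval (psubst e d) n = peval e (peval d n).
Proof. by elim: e => //= a -> b ->. Qed.

Lemma peval_mono e m n : m <= n -> peval e m <= peval e n.
Proof.
move=> le; elim: e => //= a IHa b IHb; first exact: leq_add.
exact: leq_mul.
Qed.

Fixpoint pexpn (k : nat) : pexp := if k is k'.+1 then PM PX (pexpn k') else PC 1.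

Lemma peval_expn k n : peval (pexpn k) n = n ^ k.
Proof. by elim: k => //= k ->; rewrite expnS. Qed.

(** For n at most 1 a larger exponent gains nothing, so the additive constant has to dominate; this
    is where [k1 * k2] in the product case comes from. For n at least 2 the surplus 2 in the
    exponent absorbs the constant factors. *)
Lemma peval_le_pow e : exists k, forall n, peval e n <= n ^ k + k.
Proof.
elim: e => [|c|a [k1 H1] b [k2 H2]|a [k1 H1] b [k2 H2]].
- by exists 1 => n /=; rewrite expn1; lia.
- by exists c => n /=; lia.
- exists (k1 + k2 + 2) => n /=.
  apply: leq_trans (leq_add (H1 n) (H2 n)) _.
  case: n {H1 H2} => [|[|n]].
  + have l1 : 0 ^ k1 <= 1 by case: k1 => // k1; rewrite exp0n.
    have l2 : 0 ^ k2 <= 1 by case: k2 => // k2; rewrite exp0n.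
    lia.
  + rewrite !exp1n; lia.
  + have h1 : n.+2 ^ k1 <= n.+2 ^ (k1 + k2) by rewrite leq_exp2l ?leq_addr.
    have h2 : n.+2 ^ k2 <= n.+2 ^ (k1 + k2) by rewrite leq_exp2l ?leq_addl.
    rewrite expnD -[n.+2 ^ 2]/(n.+2 * n.+2); nia.
- exists (k1 + k2 + 2 + k1 * k2) => n /=.
  apply: leq_trans (leq_mul (H1 n) (H2 n)) _.
  case: n {H1 H2} => [|[|n]].
  + have l1 : 0 ^ k1 <= 1 by case: k1 => // k1; rewrite exp0n.
    have l2 : 0 ^ k2 <= 1 by case: k2 => // k2; rewrite exp0n.
    nia.
  + rewrite !exp1n; nia.
  + have h1 : k1 <= n.+2 ^ k1 by apply: ltnW; exact: ltn_expl.
    have h2 : k2 <= n.+2 ^ k2 by apply: ltnW; exact: ltn_expl.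
    have h3 : n.+2 ^ (k1 + k2 + 2) <= n.+2 ^ (k1 + k2 + 2 + k1 * k2).
      by rewrite leq_exp2l ?leq_addr.
    have h4 : (n.+2 ^ k1 + k1) * (n.+2 ^ k2 + k2) <= n.+2 ^ (k1 + k2 + 2).
      rewrite !expnD -[n.+2 ^ 2]/(n.+2 * n.+2).
      apply: (@leq_trans (2 * n.+2 ^ k1 * (2 * n.+2 ^ k2))); last nia.
      by apply: leq_mul; lia.
    lia.
Qed.

Class data (A : Type) := enc : A -> tree.

Definition sz {A : Type} {dA : data A} (a : A) : nat := size (code (enc a)).

#[global] Instance data_unit : data unit := fun _ => Leaf.
#[global] Instance data_prod A B (dA : data A) (dB : data B) : data (A * B) :=
  fun p => Node (enc p.1) (enc p.2).
Fixpoint enc_seq A (dA : data A) (s : seq A) : tree :=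
  if s is x :: s' then Node (enc x) (enc_seq dA s') else Leaf.
#[global] Instance data_seq A (dA : data A) : data (seq A) := enc_seq dA.
(** Unary on purpose: every number in the reduction is polynomially bounded, and arithmetic becomes
    list processing. It also makes the code of a successor that of a pair. *)
#[global] Instance data_nat : data nat := fun n => enc (nseq n tt).
#[global] Instance data_bool : data bool := fun b => enc (nat_of_bool b).

Lemma sz_gt0 {A} {dA : data A} (a : A) : 0 < sz a.
Proof. by rewrite /sz; case: (enc a). Qed.

Lemma sz_pair {A B} {dA : data A} {dB : data B} (p : A * B) :
  sz p = (sz p.1 + sz p.2).+1.
Proof. by rewrite /sz /= size_cat. Qed.

Lemma sz_cons {A} {dA : data A} (x : A) s : sz (x :: s) = (sz x + sz s).+1.
Proof. by rewrite /sz /= size_cat. Qed.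

Lemma sz_nil {A} {dA : data A} : sz (@nil A) = 1.
Proof. by []. Qed.

Lemma sz_seq {A} {dA : data A} (s : seq A) :
  sz s = (\sum_(x <- s) (sz x).+1).+1.
Proof.
elim: s => [|x s IH]; first by rewrite big_nil.
by rewrite sz_cons big_cons IH; lia.
Qed.

Lemma sz_nat (n : nat) : sz n = 2 * n + 1.
Proof.
by rewrite -[sz n]/(sz (nseq n tt)) sz_seq big_nseq iter_addn_0 /sz /=; lia.
Qed.

Lemma sz_bool (b : bool) : sz b <= 3.
Proof. by case: b. Qed.

Lemma size_le_sz {A} {dA : data A} (s : seq A) : size s <= sz s.
Proof. by elim: s => //= x s IH; rewrite sz_cons; lia. Qed.

Lemma sz_cat {A} {dA : data A} (s1 s2 : seq A) : sz (s1 ++ s2) + 1 = sz s1 + sz s2.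
Proof. by elim: s1 => [|x s IH] /=; rewrite ?sz_cons ?sz_nil; lia. Qed.

(** The arbitrary [u] and [w1] to [w4] are a frame: the command rewrites the top tree of stack 0 and
    restores everything else, so it can run inside any other. [D] matters because functions coming
    from a search problem are computed only on legal arguments. *)
Definition PF {A B : Type} {dA : data A} {dB : data B}
    (D : A -> Prop) (f : A -> B) : Prop :=
  exists (c : cmd) (e : pexp), forall a, D a -> forall u w1 w2 w3 w4,
    runs c (regs (code (enc a) ++ u) w1 w2 w3 w4) (peval e (sz a))
      (regs (code (enc (f a)) ++ u) w1 w2 w3 w4).

Definition pbd {A} {dA : data A} (D : A -> Prop) (g : A -> nat) : Prop :=
  exists e, forall a, D a -> g a <= peval e (sz a).

Lemma PF_size {A B} {dA : data A} {dB : data B} D (f : A -> B) : PF D f -> pbd D (fun a => sz (f a)).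
Proof.
case=> c [e H]; exists (PA PX e) => a /H /(_ [::] [::] [::] [::] [::]).
by move/(runs_size 0) => /=; rewrite !cats0.
Qed.

Section Base.
Context {A B C : Type} {dA : data A} {dB : data B} {dC : data C}.
Implicit Types (D : A -> Prop).

Lemma PF_sub D D' (f : A -> B) : (forall a, D a -> D' a) -> PF D' f -> PF D f.
Proof. by move=> s [c [e H]]; exists c, e => a /s; exact: H. Qed.

Lemma PF_ext D (f g : A -> B) : (forall a, D a -> f a = g a) -> PF D f -> PF D g.
Proof. by move=> E [c [e H]]; exists c, e => a Da *; rewrite -E //; exact: H. Qed.

(** Different types share trees, for instance a nonempty list and the pair of its head and tail, so
    one program serves both. *)
Lemma PF_enc D (f : A -> B) (g : A -> C) :
  (forall a, enc (f a) = enc (g a)) -> PF D f -> PF D g.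
Proof. by move=> E [c [e H]]; exists c, e => a Da *; rewrite -E //; exact: H. Qed.

Lemma PF_same D (f : A -> B) : (forall a, enc (f a) = enc a) -> PF D f.
Proof.
move=> E; exists Skip, (PC 0) => a _ *; rewrite E; exact: runs_skip.
Qed.

Lemma PF_comp D (D' : B -> Prop) (f : A -> B) (g : B -> C) :
  PF D f -> PF D' g -> (forall a, D a -> D' (f a)) -> PF D (fun a => g (f a)).
Proof.
move=> Pf; have [s Hs] := PF_size Pf; case: Pf => [c [e H]] [c' [e' H']] DD.
exists (Seq c c'), (PA e (psubst e' s)) => a Da u w1 w2 w3 w4.
apply: runs_weaken; first by apply: runs_seq; [exact: H | exact: (H' _ (DD _ Da))].
by rewrite /= peval_subst leq_add2l peval_mono // Hs.
Qed.

Lemma PF_const D (b : B) : PF D (fun _ => b).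
Proof.
exists (Seq Drop (pushes 0 (code (enc b)))), (PA (PM (PC 12) PX) (PC (9 + size (code (enc b))))).
move=> a _ u w1 w2 w3 w4; apply: runs_weaken.
  apply: runs_seq; first exact: runs_drop.
  by apply: runs_pushesE => //; rewrite update_regs.
by rewrite /= /sz; lia.
Qed.

Lemma PF_pair D (f : A -> B) (g : A -> C) :
  PF D f -> PF D g -> PF D (fun a => (f a, g a)).
Proof.
move=> Pf Pg; have [s Hs] := PF_size Pf; have [s' Hs'] := PF_size Pg.
case: Pf Pg => [c [e H]] [c' [e' H']].
exists (Seq Dup (Seq c (Seq Swap (Seq c' (Seq Swap (Emit 0 true)))))).
exists (PA (PA (PM (PC 28) PX) (PC 10)) (PA e (PA (PA (PM (PC 20) (PA s PX)) (PC 10))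
  (PA e' (PA (PA (PM (PC 20) (PA s s')) (PC 10)) (PC 1)))))) => a Da u w1 w2 w3 w4.
apply: runs_weaken.
  apply: runs_seq; first exact: runs_dup.
  apply: runs_seq; first exact: H.
  apply: runs_seq; first exact: runs_swap.
  apply: runs_seq; first exact: H'.
  apply: runs_seq; first exact: runs_swap.
  by apply: runs_emitE; rewrite update_regs /= -catA.
have h := Hs _ Da; have h' := Hs' _ Da; rewrite /= -!/(sz _) in h h' *; lia.
Qed.

End Base.

Lemma PF_fst0 {A B} {dA : data A} {dB : data B} D : PF D (fun p : A * B => p.1).
Proof.
exists (Seq (Case 0 Skip Skip Skip) (Seq Swap Drop)), (PA (PM (PC 32) PX) (PC 16)).
move=> [a b] _ u w1 w2 w3 w4; apply: runs_weaken.
  apply: runs_seq.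
    apply: runs_case => //=; exact: runs_skip.
  rewrite update_regs -catA.
  apply: runs_seq; first exact: runs_swap.
  exact: runs_drop.
by rewrite /= sz_pair /sz /=; lia.
Qed.

Lemma PF_snd0 {A B} {dA : data A} {dB : data B} D : PF D (fun p : A * B => p.2).
Proof.
exists (Seq (Case 0 Skip Skip Skip) Drop), (PA (PM (PC 32) PX) (PC 16)).
move=> [a b] _ u w1 w2 w3 w4; apply: runs_weaken.
  apply: runs_seq.
    apply: runs_case => //=; exact: runs_skip.
  rewrite update_regs -catA.
  exact: runs_drop.
by rewrite /= sz_pair /sz /=; lia.
Qed.

Section Control.
Context {E X S B : Type} {dE : data E} {dX : data X} {dS : data S} {dB : data B}.
Implicit Types (D : E -> Prop).

Lemma PF_caseseq D (l : E -> seq X) (f : E -> B) (g : E * (X * seq X) -> B) :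
  PF D l -> PF (fun e => D e /\ l e = [::]) f ->
  PF (fun p => D p.1 /\ l p.1 = p.2.1 :: p.2.2) g ->
  PF D (fun e => if l e is x :: s then g (e, (x, s)) else f e).
Proof.
move=> Pl Pf Pg.
have [c [t H]] := PF_pair Pl (PF_same D (f := id) (fun _ => erefl)).
have [s Hs] := PF_size Pl.
case: Pf Pg => [c1 [e1 H1]] [c2 [e2 H2]].
(* Once the pair of [l e] and [e] is built, its tag is dropped and the first bit of the list is
   popped. A [false] was the whole empty list and leaves [e]; a [true] is put back, since the code
   of [x :: s] is that of the pair of [x] and [s], and a swap and a new tag give the argument of
   [g]. *)
exists (Seq c (Seq (Case 0 Skip Skip Skip) (Case 0 Skip c1
  (Seq (Emit 0 true) (Seq Swap (Seq (Emit 0 true) c2)))))).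
exists (PA t (PA (PC 30) (PA e1 (PA (PM (PC 20) (PA s PX)) (psubst e2 (PA (PC 1) (PA s PX))))))).
move=> e De u w1 w2 w3 w4.
case El: (l e) => [|x r].
  apply: runs_weaken.
    apply: runs_seq; first exact: H.
    apply: runs_seq.
      apply: runs_case => //=; exact: runs_skip.
    rewrite update_regs El; apply: runs_case => //=.
    rewrite update_regs; apply: H1; by split.
  by rewrite /=; lia.
apply: runs_weaken.
  apply: runs_seq; first exact: H.
  apply: runs_seq.
    apply: runs_case => //=; exact: runs_skip.
  rewrite update_regs El; apply: runs_case => //=.
  rewrite update_regs; apply: runs_seq; first exact: runs_emit.
  rewrite update_regs; apply: runs_seq.
    rewrite /= -[((_ ++ _) ++ _) ++ _]catA.
    exact: (@runs_swap (data_seq dX (x :: r)) (enc e)).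
  apply: runs_seq; first exact: runs_emit.
  rewrite update_regs.
  by have /= := H2 (e, (x, r)) (conj De El) u w1 w2 w3 w4; rewrite -!catA /= -!catA; exact.
have hs := Hs _ De; rewrite El in hs.
have -> : sz (e, (x, r)) = (sz e + sz (x :: r)).+1 by rewrite sz_pair.
rewrite -[size (code (data_seq _ _))]/(sz (x :: r)) -[size (code (enc e))]/(sz e).
move: (sz (x :: r)) (sz e) hs => n m hs; rewrite /= peval_subst /=.
have := @peval_mono e2 (m + n).+1 (1 + (peval s m + m)); lia.
Qed.

Definition Count :=
  Seq (Emit 4 false) (Seq (pushes 3 [:: true; false])
    (While 3 (Case 0 Skip Skip (Seq Drop (Seq (Emit 4 true) (Emit 3 true)))))).

Lemma runs_count (s : seq X) u w1 w2 w3 w4 :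
  runs Count (regs (code (enc s) ++ u) w1 w2 w3 w4) (20 * sz s + 20)
    (regs u w1 w2 w3 (nseq (size s) true ++ false :: w4)).
Proof.
apply: runs_weaken.
  apply: runs_seq; first exact: runs_emit.
  apply: runs_seq; first exact: runs_pushes.
  rewrite !update_regs /=.
  have L v : runs (While 3 (Case 0 Skip Skip (Seq Drop (Seq (Emit 4 true) (Emit 3 true)))))
    (regs (code (enc s) ++ u) w1 w2 [:: true, false & w3] v) (20 * sz s)
    (regs u w1 w2 w3 (nseq (size s) true ++ v)); last exact: L.
  elim: s v => [|x s IH] v /=.
    apply: runs_weaken; first (apply: runs_while_step => //).
    - rewrite update_regs; apply: runs_case => //=; exact: runs_skip.
    - apply: runs_while_stop => //=; by rewrite !update_regs.
    - by [].
  apply: runs_weaken; first (apply: runs_while_step => //).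
  - rewrite update_regs; apply: runs_case => //=.
    rewrite update_regs -catA.
    apply: runs_seq; first exact: runs_drop.
    apply: runs_seq; first exact: runs_emit.
    exact: runs_emit.
  - have -> : true :: nseq (size s) true ++ v = nseq (size s) true ++ true :: v.
      by elim: (size s) => //= n ->.
    rewrite !update_regs; exact: IH.
  - by rewrite sz_cons /sz; lia.
by rewrite /=; lia.
Qed.

(** Intermediate sizes need their own bound: repeated doubling is polynomial in every round but
    exponential in total. *)
Lemma PF_iter D (DS : S -> Prop) (l : E -> seq X) (i : E -> S) (f : S -> S) :
  PF D l -> PF D i -> PF DS f ->
  (forall e k, D e -> k < size (l e) -> DS (iter k f (i e))) ->
  (exists b, forall e k, D e -> k <= size (l e) -> sz (iter k f (i e)) <= peval b (sz e)) ->
  PF D (fun e => iter (size (l e)) f (i e)).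
Proof.
move=> Pl Pi [cf [ef Hf]] DDS [b Hb].
have [s Hs] := PF_size Pl.
have [c [t H]] := PF_pair Pl Pi.
exists (Seq c (Seq (Case 0 Skip Skip Skip) (Seq Count (While 4 cf)))).
exists (PA t (PA (PC 30) (PA (PM (PC 20) s) (PM s (PA (PC 3) (psubst ef b)))))).
move=> e De u w1 w2 w3 w4; apply: runs_weaken.
  apply: runs_seq; first exact: H.
  apply: runs_seq.
    apply: runs_case => //=; exact: runs_skip.
  rewrite update_regs -catA; apply: runs_seq; first exact: runs_count.
  set T := peval ef (peval b (sz e)) + 3.
  have L k : k <= size (l e) -> runs (While 4 cf)
      (regs (code (enc (iter (size (l e) - k) f (i e))) ++ u) w1 w2 w3 (nseq k true ++ false :: w4))
      (k * T + 1) (regs (code (enc (iter (size (l e)) f (i e))) ++ u) w1 w2 w3 w4).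
    elim: k => [|k IH] le.
      apply: runs_while_stop => //=; by rewrite !update_regs subn0.
    apply: runs_weaken; first (apply: runs_while_step => //).
    - rewrite update_regs; apply: Hf; apply: DDS => //; lia.
    - by rewrite -iterS -subSn //= subSS; apply: IH; lia.
    - have := @peval_mono ef _ _ (Hb e (size (l e) - k.+1) De ltac:(lia)).
      rewrite /T; lia.
  have := L _ (leqnn _); rewrite subnn; exact.
have hs := Hs _ De; pose proof (hl := size_le_sz (l e)); rewrite /= peval_subst.
have : size (l e) * (peval ef (peval b (sz e)) + 3) <= peval s (sz e) * (3 + peval ef (peval b (sz e))).
  by rewrite addnC leq_mul // (leq_trans hl).
lia.
Qed.

End Control.

(** * A library of polynomial-time functions *)

Lemma sz_drop {X} {dX : data X} k (s : seq X) : sz (drop k s) <= sz s.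
Proof.
have : sz (take k s ++ drop k s) + 1 = sz (take k s) + sz (drop k s) by exact: sz_cat.
have : 0 < sz (take k s) by exact: sz_gt0.
by rewrite cat_take_drop; lia.
Qed.

Section Env.
Context {E A B C X Y S : Type} {dE : data E} {dA : data A} {dB : data B} {dC : data C}
  {dX : data X} {dY : data Y} {dS : data S}.
Implicit Types (D : E -> Prop).

Lemma PF_id D : PF D (fun e => e).
Proof. exact: PF_same. Qed.

Lemma PF_fst D (f : E -> A * B) : PF D f -> PF D (fun e => (f e).1).
Proof. by move=> Pf; apply: (PF_comp Pf (PF_fst0 (fun _ => True))). Qed.

Lemma PF_snd D (f : E -> A * B) : PF D f -> PF D (fun e => (f e).2).
Proof. by move=> Pf; apply: (PF_comp Pf (PF_snd0 (fun _ => True))). Qed.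

Lemma PF_app D (h : A -> B) (f : E -> A) :
  (forall Q : A -> Prop, PF Q h) -> PF D f -> PF D (fun e => h (f e)).
Proof. by move=> Ph Pf; apply: (PF_comp Pf (Ph (fun _ => True))). Qed.

Lemma PF_app2 D (h : A -> B -> C) (f : E -> A) (g : E -> B) :
  (forall Q : A * B -> Prop, PF Q (fun p => h p.1 p.2)) ->
  PF D f -> PF D g -> PF D (fun e => h (f e) (g e)).
Proof.
move=> Ph Pf Pg.
exact: (PF_comp (PF_pair Pf Pg) (Ph (fun _ => True))).
Qed.

Lemma PF_cons D (f : E -> A) (g : E -> seq A) :
  PF D f -> PF D g -> PF D (fun e => f e :: g e).
Proof. by move=> Pf Pg; apply: PF_enc (PF_pair Pf Pg). Qed.

Lemma PF_S D (f : E -> nat) : PF D f -> PF D (fun e => (f e).+1).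
Proof. by move=> Pf; apply: PF_enc (PF_pair (PF_const D tt) Pf). Qed.

Lemma PF_seqcase D (l : E -> seq X) (f : E -> B) (g : E -> X -> seq X -> B) :
  PF D l -> PF D f -> PF (fun p => D p.1) (fun p : E * (X * seq X) => g p.1 p.2.1 p.2.2) ->
  PF D (fun e => if l e is x :: s then g e x s else f e).
Proof.
move=> Pl Pf Pg.
apply: (PF_caseseq (g := fun p : E * (X * seq X) => g p.1 p.2.1 p.2.2)) => //.
  by apply: PF_sub Pf => e [].
by apply: PF_sub Pg => e [].
Qed.

Lemma PF_unary D (f : E -> nat) : PF D f -> PF D (fun e => nseq (f e) tt).
Proof. exact: PF_enc. Qed.

Lemma enc_units (s : seq unit) : enc (size s) = enc s.
Proof. by elim: s => //= -[] s IH; exact: (congr1 (Node Leaf) IH). Qed.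

Lemma PF_usize D (f : E -> seq unit) : PF D f -> PF D (fun e => size (f e)).
Proof. by apply: PF_enc => e; rewrite enc_units. Qed.

Lemma PF_natOfbool D (f : E -> bool) : PF D f -> PF D (fun e => nat_of_bool (f e)).
Proof. exact: PF_enc. Qed.

End Env.

Section Env2.
Context {E A B C X Y S : Type} {dE : data E} {dA : data A} {dB : data B} {dC : data C}
  {dX : data X} {dY : data Y} {dS : data S}.
Implicit Types (D : E -> Prop).

Lemma PF_natcaseD D (n : E -> nat) (f : E -> B) (g : E -> nat -> B) :
  PF D n -> PF (fun e => D e /\ n e = 0) f ->
  PF (fun p => D p.1 /\ n p.1 = p.2.+1) (fun p : E * nat => g p.1 p.2) ->
  PF D (fun e => if n e is m.+1 then g e m else f e).
Proof.
move=> Pn Pf Pg.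
have P : PF D (fun e => if nseq (n e) tt is x :: s then
    (fun p : E * (unit * seq unit) => g p.1 (size p.2.2)) (e, (x, s)) else f e).
  apply: (PF_caseseq (l := fun e => nseq (n e) tt)
    (g := fun p : E * (unit * seq unit) => g p.1 (size p.2.2))); first exact: PF_unary.
    by apply: PF_sub Pf => e [De]; case: (n e).
  apply: (PF_comp (PF_pair (PF_fst0 _) (PF_usize (PF_snd (PF_snd0 _)))) Pg).
  move=> [e [x s]] /= [De En]; split=> //.
  by rewrite -(size_nseq (n e) tt) En.
by apply: PF_ext P => e _; case: (n e) => //= m; rewrite size_nseq.
Qed.

Lemma PF_natcase D (n : E -> nat) (f : E -> B) (g : E -> nat -> B) :
  PF D n -> PF D f -> PF (fun p => D p.1) (fun p : E * nat => g p.1 p.2) ->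
  PF D (fun e => if n e is m.+1 then g e m else f e).
Proof.
move=> Pn Pf Pg; apply: PF_natcaseD => //.
  by apply: PF_sub Pf => e [].
by apply: PF_sub Pg => e [].
Qed.

Lemma PF_ifD D (b : E -> bool) (f g : E -> B) :
  PF D b -> PF (fun e => D e /\ b e) f -> PF (fun e => D e /\ ~~ b e) g ->
  PF D (fun e => if b e then f e else g e).
Proof.
move=> Pb Pf Pg.
have P : PF D (fun e => if nat_of_bool (b e) is m.+1 then (fun e _ => f e) e m else g e).
  apply: PF_natcaseD; first exact: PF_natOfbool.
    by apply: PF_sub Pg => e [De]; case: (b e).
  apply: (PF_comp (PF_fst0 _) Pf) => -[e m] /= [De]; by case: (b e).
by apply: PF_ext P => e _; case: (b e).
Qed.

Lemma PF_if D (b : E -> bool) (f g : E -> B) :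
  PF D b -> PF D f -> PF D g -> PF D (fun e => if b e then f e else g e).
Proof.
move=> Pb Pf Pg; apply: PF_ifD => //; first by apply: PF_sub Pf => e [].
by apply: PF_sub Pg => e [].
Qed.

(** Reduces to [PF_iter] on triples of environment, remaining list and accumulator. The invariant is
    indexed by the number of elements consumed, so that the growth per round can be summed to a
    polynomial bound. *)
Lemma PF_foldl D (Inv : E -> nat -> S -> Prop) (l : E -> seq X) (i : E -> S)
    (f : E -> S -> X -> S) :
  PF D l -> PF D i ->
  PF (fun p => D p.1) (fun p : E * (S * X) => f p.1 p.2.1 p.2.2) ->
  (forall e, D e -> Inv e 0 (i e)) ->
  (forall e k s x, D e -> k < size (l e) -> sz x <= sz (l e) -> Inv e k s ->
     Inv e k.+1 (f e s x)) ->
  (exists b, forall e k s, D e -> k <= size (l e) -> Inv e k s -> sz s <= peval b (sz e)) ->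
  PF D (fun e => foldl (f e) (i e) (l e)).
Proof.
move=> Pl Pi Pf I0 IS [b Hb]; have [sl Hl] := PF_size Pl.
pose st (p : E * (seq X * S)) := if p.2.1 is x :: s then (p.1, (s, f p.1 p.2.2 x)) else p.
have itP e k : D e -> k <= size (l e) -> exists s,
    [/\ iter k st (e, (l e, i e)) = (e, (drop k (l e), s)), Inv e k s
      & foldl (f e) s (drop k (l e)) = foldl (f e) (i e) (l e)].
  move=> De; elim: k => [|k IH] le; first by exists (i e); rewrite drop0; split=> //; exact: I0.
  case: IH => [|s [Es Is Fs]]; first exact: ltnW.
  case Ed: (drop k (l e)) => [|x r].
    by have := size_drop k (l e); rewrite Ed /=; lia.
  have Er : drop k.+1 (l e) = r by rewrite -add1n -drop_drop Ed /= drop0.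
  exists (f e s x); split.
  - by rewrite iterS Es /st /= Ed Er.
  - apply: IS => //; have : sz (drop k (l e)) <= sz (l e) by exact: sz_drop.
    by rewrite Ed sz_cons; lia.
  - by rewrite -Fs Ed Er.
have P : PF D (fun e => iter (size (l e)) st (e, (l e, i e))).
  apply: (PF_iter (DS := fun p : E * (seq X * S) => D p.1)) => //.
  - by apply: PF_pair; [exact: PF_id | exact: PF_pair].
  - rewrite /st.
    apply: (PF_seqcase (l := fun p : E * (seq X * S) => p.2.1) (f := id)
      (g := fun p x s => (p.1, (s, f p.1 p.2.2 x)))).
    + exact: PF_fst (PF_snd (PF_id _)).
    + exact: PF_id.
    + apply: PF_pair; first exact: PF_fst (PF_fst (PF_id _)).
      apply: PF_pair; first exact: PF_snd (PF_snd (PF_id _)).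
      have Pt : PF (fun p : E * (seq X * S) * (X * seq X) => D p.1.1)
          (fun p => (p.1.1, (p.1.2.2, p.2.1))).
        apply: PF_pair; first exact: PF_fst (PF_fst (PF_id _)).
        apply: PF_pair; first exact: PF_snd (PF_snd (PF_fst (PF_id _))).
        exact: PF_fst (PF_snd (PF_id _)).
      exact: (PF_comp Pt Pf).
  - by move=> e k De lt; have [|s [-> _ _]] := itP e k De; [exact: ltnW | ].
  - exists (PA (PC 2) (PA PX (PA sl b))) => e k De le.
    have [s [-> Is _]] := itP e k De le; rewrite !sz_pair /=.
    have h1 : sz (drop k (l e)) <= sz (l e) by exact: sz_drop.
    by have := Hl e De; have := Hb e k s De le Is; lia.
have := PF_snd (PF_snd P); apply: PF_ext => e De.
by have [s [-> _ /=]] := itP e _ De (leqnn _); rewrite drop_size.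
Qed.

End Env2.

Lemma PF_rev {E X} {dE : data E} {dX : data X} D (l : E -> seq X) :
  PF D l -> PF D (fun e => rev (l e)).
Proof.
move=> Pl; have [b Hb] := PF_size Pl.
have P : PF D (fun e => foldl ((fun _ s x => x :: s) e) [::] (l e)).
  apply: (PF_foldl (Inv := fun e k (s : seq X) => sz s <= 1 + k * (sz (l e)).+1)) => //.
  - exact: PF_const.
  - by apply: PF_cons; [exact: PF_snd (PF_snd (PF_id _)) | exact: PF_fst (PF_snd (PF_id _))].
  - by move=> e k s x De lt lx h; rewrite sz_cons; lia.
  - exists (PA (PC 1) (PM b (PA (PC 1) b))) => e k s De le h /=.
    have := Hb e De; have : size (l e) <= sz (l e) by exact: size_le_sz.
    nia.
apply: PF_ext P => e _; rewrite -[RHS]/(catrev _ _); move: [::].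
by elim: (l e) => //= x r IH s; rewrite IH.
Qed.

Lemma PF_cat {E X} {dE : data E} {dX : data X} D (l r : E -> seq X) :
  PF D l -> PF D r -> PF D (fun e => l e ++ r e).
Proof.
move=> Pl Pr; have [b Hb] := PF_size (PF_rev Pl); have [b' Hb'] := PF_size Pr.
have P : PF D (fun e => foldl ((fun _ s x => x :: s) e) (r e) (rev (l e))).
  apply: (PF_foldl (Inv := fun e k (s : seq X) => sz s <= sz (r e) + k * (sz (rev (l e))).+1)).
  - exact: PF_rev.
  - exact: Pr.
  - by apply: PF_cons; [exact: PF_snd (PF_snd (PF_id _)) | exact: PF_fst (PF_snd (PF_id _))].
  - by move=> e De; lia.
  - by move=> e k s x De lt lx h; rewrite sz_cons; lia.
  - exists (PA b' (PM b (PA (PC 1) b))) => e k s De le h /=.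
    have := Hb e De; have := Hb' e De.
    have : size (rev (l e)) <= sz (rev (l e)) by exact: size_le_sz.
    nia.
apply: PF_ext P => e _; rewrite -{2}[l e]revK; move: (rev (l e)) (r e).
by elim=> [|x s IH] t //=; rewrite IH rev_cons cat_rcons.
Qed.

Lemma PF_map {E X Y} {dE : data E} {dX : data X} {dY : data Y} D (l : E -> seq X)
    (g : E -> X -> Y) :
  PF D l -> PF (fun p => D p.1) (fun p : E * X => g p.1 p.2) ->
  PF D (fun e => [seq g e x | x <- l e]).
Proof.
move=> Pl Pg; have [b Hb] := PF_size Pl; have [c Hc] := PF_size Pg.
pose B (e : E) := peval (psubst c (PA (PC 1) (PA PX b))) (@sz E dE e).
have P : PF D (fun e => foldl ((fun e s x => g e x :: s) e) [::] (l e)).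
  apply: (PF_foldl (Inv := fun e k (s : seq Y) => sz s <= 1 + k * (B e).+1) (f := fun e s x => g e x :: s)) => //.
  - exact: PF_const.
  - apply: PF_cons; last exact: PF_fst (PF_snd (PF_id _)).
    apply: (PF_comp (PF_pair (PF_fst0 _) (PF_snd (PF_snd0 _))) Pg) => //.
  - move=> e k s x De lt lx h; rewrite sz_cons.
    have h1 : sz (g e x) <= peval c (sz (e, x)) by exact: (Hc (e, x)).
    have h2 : peval c (sz (e, x)) <= B e.
      by rewrite /B peval_subst peval_mono //= sz_pair /=; have := Hb e De; lia.
    by rewrite mulSn; lia.
  - exists (PA (PC 1) (PM b (PA (PC 1) (psubst c (PA (PC 1) (PA PX b)))))) => e k s De le h /=.
    rewrite -/(B e); have := Hb e De; have : size (l e) <= sz (l e) by exact: size_le_sz.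
    nia.
apply: PF_ext (PF_rev P) => e _.
suff H s t : rev (foldl (fun s x => g e x :: s) t s) = rev t ++ [seq g e x | x <- s] by exact: H.
elim: s t => [|x s IH] t /=; first by rewrite cats0.
by rewrite IH rev_cons cat_rcons.
Qed.

Lemma PF_filter {E X} {dE : data E} {dX : data X} D (l : E -> seq X) (p : E -> X -> bool) :
  PF D l -> PF (fun q => D q.1) (fun q : E * X => p q.1 q.2) ->
  PF D (fun e => [seq x <- l e | p e x]).
Proof.
move=> Pl Pp; have [b Hb] := PF_size Pl.
have P : PF D (fun e => foldl ((fun e s x => if p e x then x :: s else s) e) [::] (l e)).
  apply: (PF_foldl (Inv := fun e k (s : seq X) => sz s <= 1 + k * (sz (l e)).+1)
    (f := fun e s x => if p e x then x :: s else s)) => //.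
  - exact: PF_const.
  - apply: PF_if; last exact: PF_fst (PF_snd (PF_id _)).
      by apply: (PF_comp (PF_pair (PF_fst0 _) (PF_snd (PF_snd0 _))) Pp).
    by apply: PF_cons; [exact: PF_snd (PF_snd (PF_id _)) | exact: PF_fst (PF_snd (PF_id _))].
  - by move=> e k s x De lt lx h; case: ifP => _; rewrite ?sz_cons; lia.
  - exists (PA (PC 1) (PM b (PA (PC 1) b))) => e k s De le h /=.
    have := Hb e De; have : size (l e) <= sz (l e) by exact: size_le_sz.
    nia.
apply: PF_ext (PF_rev P) => e _.
suff H s t : rev (foldl (fun s x => if p e x then x :: s else s) t s)
    = rev t ++ [seq x <- s | p e x] by exact: H.
elim: s t => [|x s IH] t /=; first by rewrite cats0.
by rewrite IH; case: (p e x); rewrite // rev_cons cat_rcons.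
Qed.

Lemma PF_all {E X} {dE : data E} {dX : data X} D (l : E -> seq X) (p : E -> X -> bool) :
  PF D l -> PF (fun q => D q.1) (fun q : E * X => p q.1 q.2) ->
  PF D (fun e => all (p e) (l e)).
Proof.
move=> Pl Pp.
have P : PF D (fun e => foldl ((fun e s x => if p e x then s else false) e) true (l e)).
  apply: (PF_foldl (Inv := fun _ _ _ => True) (f := fun e s x => if p e x then s else false)) => //.
  - exact: PF_const.
  - apply: PF_if; last exact: PF_const.
      by apply: (PF_comp (PF_pair (PF_fst0 _) (PF_snd (PF_snd0 _))) Pp).
    exact: PF_fst (PF_snd (PF_id _)).
  - by exists (PC 3) => e k s _ _ _; exact: sz_bool.
apply: PF_ext P => e _.
suff H s t : foldl (fun s x => if p e x then s else false) t s = t && all (p e) s by exact: H.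
elim: s t => [|x s IH] t /=; first by rewrite andbT.
by rewrite IH; case: (p e x); rewrite //= andbF.
Qed.

Lemma PF_size_seq {E X} {dE : data E} {dX : data X} D (l : E -> seq X) :
  PF D l -> PF D (fun e => size (l e)).
Proof.
move=> Pl; apply: PF_ext (PF_usize (PF_map (g := fun _ _ => tt) Pl (PF_const _ tt))) => e _.
exact: size_map.
Qed.

Lemma PF_flatten {E X} {dE : data E} {dX : data X} D (l : E -> seq (seq X)) :
  PF D l -> PF D (fun e => flatten (l e)).
Proof.
move=> Pl; have [b Hb] := PF_size Pl.
have P : PF D (fun e => foldl ((fun _ s x => s ++ x) e) [::] (l e)).
  apply: (PF_foldl (Inv := fun e k (s : seq X) => sz s <= 1 + k * (sz (l e)).+1)) => //.
  - exact: PF_const.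
  - by apply: PF_cat; [exact: PF_fst (PF_snd (PF_id _)) | exact: PF_snd (PF_snd (PF_id _))].
  - move=> e k s x De lt lx h; have : sz (s ++ x) + 1 = sz s + sz x by exact: sz_cat.
    by lia.
  - exists (PA (PC 1) (PM b (PA (PC 1) b))) => e k s De le h /=.
    have := Hb e De; have : size (l e) <= sz (l e) by exact: size_le_sz.
    nia.
apply: PF_ext P => e _.
suff H s t : foldl (fun s x => s ++ x) t s = t ++ flatten s :> seq X by exact: H.
elim: s t => [|x s IH] t /=; first by rewrite cats0.
by rewrite IH catA.
Qed.

Lemma PF_iota {E} {dE : data E} D (m n : E -> nat) :
  PF D m -> PF D n -> PF D (fun e => iota (m e) (n e)).
Proof.
move=> Pm Pn; have [b Hb] := PF_size Pm; have [c Hc] := PF_size Pn.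
have P : PF D (fun e => foldl ((fun _ (s : nat * seq nat) (_ : unit) => (s.1.+1, s.1 :: s.2)) e)
    (m e, [::]) (nseq (n e) tt)).
  apply: (PF_foldl (Inv := fun e k (s : nat * seq nat) => s.1 = m e + k /\ sz s.2 <= 1 + k * (2 * (m e + n e) + 2))) => //.
  - by apply: PF_pair; [exact: Pm | exact: PF_const].
  - apply: PF_pair; first exact: PF_S (PF_fst (PF_fst (PF_snd (PF_id _)))).
    apply: PF_cons; first exact: (PF_fst (PF_fst (PF_snd (PF_id _)))).
    exact: (PF_snd (PF_fst (PF_snd (PF_id _)))).
  - by move=> e _; rewrite addn0.
  - move=> e k [i s] x De; rewrite size_nseq => lt _ [/= -> h].
    by rewrite sz_cons sz_nat; split; lia.
  - exists (PA (PC 5) (PM (PA (PC 5) (PA b c)) (PA (PC 5) (PA b c)))) => e k [i s] De.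
    rewrite size_nseq sz_pair => le [/= -> h]; rewrite sz_nat.
    have := Hb e De; have := Hc e De; rewrite !sz_nat => h1 h2.
    set x := peval b _ in h2 *; set y := peval c _ in h1 *.
    have : k * (2 * (m e + n e) + 2) <= (5 + (x + y)) * (x + y + 2) by apply: leq_mul; lia.
    nia.
apply: PF_ext (PF_rev (PF_snd P)) => e _.
suff H k i t : rev (foldl (fun (s : nat * seq nat) (_ : unit) => (s.1.+1, s.1 :: s.2)) (i, t) (nseq k tt)).2
  = rev t ++ iota i k by exact: H.
elim: k i t => [|k IH] i t /=; first by rewrite cats0.
by rewrite IH rev_cons cat_rcons.
Qed.

Lemma PF_behead {E X} {dE : data E} {dX : data X} D (l : E -> seq X) :
  PF D l -> PF D (fun e => behead (l e)).
Proof.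
move=> Pl; have P : PF D (fun e => if l e is x :: s then (fun _ _ s => s) e x s else [::]).
  by apply: PF_seqcase => //; [exact: PF_const | exact: PF_snd (PF_snd (PF_id _))].
by apply: PF_ext P => e _; case: (l e).
Qed.

Lemma PF_head {E X} {dE : data E} {dX : data X} D (d : E -> X) (l : E -> seq X) :
  PF D d -> PF D l -> PF D (fun e => head (d e) (l e)).
Proof.
move=> Pd Pl; have P : PF D (fun e => if l e is x :: s then (fun _ x _ => x) e x s else d e).
  by apply: PF_seqcase => //; exact: PF_fst (PF_snd (PF_id _)).
by apply: PF_ext P => e _; case: (l e).
Qed.

Lemma PF_drop {E X} {dE : data E} {dX : data X} D (n : E -> nat) (l : E -> seq X) :
  PF D n -> PF D l -> PF D (fun e => drop (n e) (l e)).
Proof.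
move=> Pn Pl; have [b Hb] := PF_size Pl.
have it e k : iter k behead (l e) = drop k (l e).
  elim: k => [|k IH]; first by rewrite drop0.
  by rewrite iterS IH -add1n -drop_drop drop1.
have P : PF D (fun e => iter (size (nseq (n e) tt)) behead (l e)).
  apply: (PF_iter (DS := fun _ => True)) => //.
    exact: PF_behead (PF_id _).
  exists b => e k De _; rewrite it; apply: leq_trans (Hb e De); exact: sz_drop.
by apply: PF_ext P => e _; rewrite size_nseq it.
Qed.

Lemma PF_nth {E X} {dE : data E} {dX : data X} D (d : E -> X) (n : E -> nat) (l : E -> seq X) :
  PF D d -> PF D l -> PF D n -> PF D (fun e => nth (d e) (l e) (n e)).
Proof.
move=> Pd Pl Pn; apply: PF_ext (PF_head Pd (PF_drop Pn Pl)) => e _.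
by rewrite -nth0 nth_drop addn0.
Qed.

Section Arith.
Context {E : Type} {dE : data E}.
Implicit Types (D : E -> Prop) (a b : E -> nat) (p q : E -> bool).

Lemma PF_addn D a b : PF D a -> PF D b -> PF D (fun e => a e + b e).
Proof.
move=> Pa Pb; apply: PF_ext (PF_usize (PF_cat (PF_unary Pa) (PF_unary Pb))) => e _.
by rewrite size_cat !size_nseq.
Qed.

Lemma PF_subn D a b : PF D a -> PF D b -> PF D (fun e => a e - b e).
Proof.
move=> Pa Pb; apply: PF_ext (PF_usize (PF_drop Pb (PF_unary Pa))) => e _.
by rewrite size_drop !size_nseq.
Qed.

Lemma PF_lift {A B} {dA : data A} {dB : data B} D (f : E -> B) :
  PF D f -> PF (fun x : E * A => D x.1) (fun x : E * A => f x.1).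
Proof. by move=> Pf; apply: (PF_comp (PF_fst0 _) Pf). Qed.

Lemma PF_muln D a b : PF D a -> PF D b -> PF D (fun e => a e * b e).
Proof.
move=> Pa Pb.
have P := PF_usize (PF_flatten (PF_map (g := fun e _ => nseq (b e) tt) (PF_unary Pa)
  (PF_lift (PF_unary Pb)))).
apply: PF_ext P => e _; elim: (a e) => //= n IH.
by rewrite size_cat size_nseq IH mulSn.
Qed.

Lemma PF_not D p : PF D p -> PF D (fun e => ~~ p e).
Proof.
move=> Pp; apply: PF_ext (PF_if Pp (PF_const _ false) (PF_const _ true)) => e _.
by case: (p e).
Qed.

Lemma PF_and D p q : PF D p -> PF D q -> PF D (fun e => p e && q e).
Proof.
move=> Pp Pq; apply: PF_ext (PF_if Pp Pq (PF_const _ false)) => e _.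
by case: (p e).
Qed.

Lemma PF_or D p q : PF D p -> PF D q -> PF D (fun e => p e || q e).
Proof.
move=> Pp Pq; apply: PF_ext (PF_if Pp (PF_const _ true) Pq) => e _.
by case: (p e).
Qed.

Lemma PF_leq D a b : PF D a -> PF D b -> PF D (fun e => a e <= b e).
Proof.
move=> Pa Pb.
have P : PF D (fun e => if a e - b e is m.+1 then (fun _ _ => false) e m else true).
  by apply: PF_natcase; [exact: PF_subn | exact: PF_const | exact: PF_const].
by apply: PF_ext P => e _; rewrite /leq; case: (a e - b e).
Qed.

Lemma PF_eqn D a b : PF D a -> PF D b -> PF D (fun e => a e == b e).
Proof.
move=> Pa Pb; apply: PF_ext (PF_and (PF_leq Pa Pb) (PF_leq Pb Pa)) => e _.
by rewrite eqn_leq.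
Qed.

Lemma PF_predn D a : PF D a -> PF D (fun e => (a e).-1).
Proof.
move=> Pa; apply: PF_ext (PF_subn Pa (PF_const _ 1)) => e _.
by rewrite subn1.
Qed.

End Arith.

Section Arith2.
Context {E : Type} {dE : data E}.
Implicit Types (D : E -> Prop) (a b : E -> nat) (p q : E -> bool).

(** The quotient is counted as the number of positive k up to [a e] with [k * b e <= a e], which is
    affordable in unary. *)
Lemma PF_divn D a b : PF D a -> PF D b -> PF D (fun e => a e %/ b e).
Proof.
move=> Pa Pb.
have P : PF D (fun e => if b e == 0 then 0 else
    size [seq k <- iota 1 (a e) | (fun e k => k * b e <= a e) e k]).
  apply: PF_if; [exact: PF_eqn Pb (PF_const _ 0) | exact: PF_const |].
  apply: PF_size_seq; apply: PF_filter; first exact: PF_iota (PF_const _ 1) Pa.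
  by apply: PF_leq; [apply: PF_muln; [exact: PF_snd0 | exact: PF_lift] | exact: PF_lift].
apply: PF_ext P => e _; case: eqP => [->|/eqP b0]; first by rewrite divn0.
rewrite size_filter /=.
have le : a e %/ b e <= a e by exact: leq_div.
rewrite -{2}(subnKC le) iotaD count_cat.
rewrite (eq_in_count (a2 := xpredT)) ?count_predT ?size_iota; last first.
  move=> k; rewrite mem_iota => /andP[k1 k2] /=; rewrite -leq_divRL ?lt0n //; lia.
rewrite (eq_in_count (a2 := xpred0)) ?count_pred0 ?addn0 // => k.
rewrite mem_iota => /andP[k1 k2] /=; rewrite -leq_divRL ?lt0n //; lia.
Qed.

Lemma PF_modn D a b : PF D a -> PF D b -> PF D (fun e => a e %% b e).
Proof.
move=> Pa Pb; apply: PF_ext (PF_subn Pa (PF_muln (PF_divn Pa Pb) Pb)) => e _.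
by rewrite {1}(divn_eq (a e) (b e)) addKn.
Qed.

Lemma PF_expn D a k : PF D a -> PF D (fun e => a e ^ k).
Proof.
move=> Pa; elim: k => [|k IH]; first exact: PF_const.
by apply: PF_ext (PF_muln Pa IH) => e _; rewrite expnS.
Qed.

Lemma PF_peval D a x : PF D a -> PF D (fun e => peval x (a e)).
Proof.
move=> Pa; elim: x => [|n|x IHx y IHy|x IHx y IHy] //=; first exact: PF_const.
  exact: PF_addn.
exact: PF_muln.
Qed.

Lemma PF_nseq {X} {dX : data X} D a (x : E -> X) :
  PF D a -> PF D x -> PF D (fun e => nseq (a e) (x e)).
Proof.
move=> Pa Px; apply: PF_ext (PF_map (g := fun e _ => x e) (PF_unary Pa) (PF_lift Px)) => e _.
by elim: (a e) => //= n ->.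
Qed.

End Arith2.

Ltac pf_user := fail.
Ltac pf_step :=
  cbv beta;
  first
  [ assumption
  | lazymatch goal with
    | |- @PF _ _ _ _ _ (fun e => e) => apply: PF_id
    | |- @PF _ _ _ _ _ (fun _ => ?c) => apply: PF_const
    | |- @PF _ _ _ _ _ (fun e => fst (@?f e)) => apply: (PF_fst (f := f))
    | |- @PF _ _ _ _ _ (fun e => snd (@?f e)) => apply: (PF_snd (f := f))
    | |- @PF _ _ _ _ _ (fun e => pair (@?f e) (@?g e)) => apply: (PF_pair (f := f) (g := g))
    | |- @PF _ _ _ _ _ (fun e => cons (@?f e) (@?g e)) => apply: (PF_cons (f := f) (g := g))
    | |- @PF _ _ _ _ _ (fun e => leq (@?f e) (@?g e)) => apply: (PF_leq (a := f) (b := g))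
    | |- @PF _ _ _ _ _ (fun e => @eq_op Datatypes_nat__canonical__eqtype_Equality (@?f e) (@?g e)) =>
        apply: (PF_eqn (a := f) (b := g))
    | |- @PF _ _ _ _ _ (fun e => addn (@?f e) (@?g e)) => apply: (PF_addn (a := f) (b := g))
    | |- @PF _ _ _ _ _ (fun e => subn (@?f e) (@?g e)) => apply: (PF_subn (a := f) (b := g))
    | |- @PF _ _ _ _ _ (fun e => muln (@?f e) (@?g e)) => apply: (PF_muln (a := f) (b := g))
    | |- @PF _ _ _ _ _ (fun e => divn (@?f e) (@?g e)) => apply: (PF_divn (a := f) (b := g))
    | |- @PF _ _ _ _ _ (fun e => modn (@?f e) (@?g e)) => apply: (PF_modn (a := f) (b := g))
    | |- @PF _ _ _ _ _ (fun e => expn (@?f e) ?k) => apply: (PF_expn (a := f))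
    | |- @PF _ _ _ _ _ (fun e => peval ?x (@?f e)) => apply: (PF_peval (a := f))
    | |- @PF _ _ _ _ _ (fun e => negb (@?f e)) => apply: (PF_not (p := f))
    | |- @PF _ _ _ _ _ (fun e => andb (@?f e) (@?g e)) => apply: (PF_and (p := f) (q := g))
    | |- @PF _ _ _ _ _ (fun e => orb (@?f e) (@?g e)) => apply: (PF_or (p := f) (q := g))
    | |- @PF _ _ _ _ _ (fun e => size (@?f e)) => apply: (PF_size_seq (l := f))
    | |- @PF _ _ _ _ _ (fun e => cat (@?f e) (@?g e)) => apply: (PF_cat (l := f) (r := g))
    | |- @PF _ _ _ _ _ (fun e => rev (@?f e)) => apply: (PF_rev (l := f))
    | |- @PF _ _ _ _ _ (fun e => flatten (@?f e)) => apply: (PF_flatten (l := f))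
    | |- @PF _ _ _ _ _ (fun e => map (@?g e) (@?f e)) => apply: (PF_map (l := f) (g := g))
    | |- @PF _ _ _ _ _ (fun e => filter (@?g e) (@?f e)) => apply: (PF_filter (l := f) (p := g))
    | |- @PF _ _ _ _ _ (fun e => all (@?g e) (@?f e)) => apply: (PF_all (l := f) (p := g))
    | |- @PF _ _ _ _ _ (fun e => iota (@?f e) (@?g e)) => apply: (PF_iota (m := f) (n := g))
    | |- @PF _ _ _ _ _ (fun e => nseq (@?f e) (@?g e)) => apply: (PF_nseq (a := f) (x := g))
    | |- @PF _ _ _ _ _ (fun e => nth (@?d e) (@?f e) (@?g e)) =>
        apply: (PF_nth (d := d) (l := f) (n := g))
    | |- @PF _ _ _ _ _ (fun e => head (@?d e) (@?f e)) => apply: (PF_head (d := d) (l := f))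
    | |- @PF _ _ _ _ _ (fun e => behead (@?f e)) => apply: (PF_behead (l := f))
    | |- @PF _ _ _ _ _ (fun e => drop (@?f e) (@?g e)) => apply: (PF_drop (n := f) (l := g))
    | |- @PF _ _ _ _ _ (fun e => match @?b e with true => @?f e | false => @?g e end) =>
        apply: (PF_if (b := b) (f := f) (g := g))
    | |- @PF _ _ _ _ _ (fun e => S (@?f e)) => apply: (PF_S (f := f))
    | |- @PF _ _ _ _ _ (fun e => predn (@?f e)) => apply: (PF_predn (a := f))
    | |- @PF _ _ _ _ _ (fun e => nat_of_bool (@?f e)) => apply: (PF_natOfbool (f := f))
    | |- @PF _ _ _ _ _ (fun _ => _) => pf_user
    | |- @PF ?A ?B ?dA ?dB ?D ?f => change (@PF A B dA dB D (fun x => f x))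
    end ].
Ltac pf := repeat pf_step.

(** * Exchange with stack machines *)

(** Raw arguments have no end marker, so the loop stops on an empty stack: that branch pushes
    nothing on stack 3 and uncovers the initial [false]. The word is reversed on its way. *)
Definition Pump (r k : nat) (g : bool -> word) :=
  Seq (pushes 3 [:: true; false])
    (While 3 (Case r Skip (Seq (pushes k (g false)) (Emit 3 true))
                          (Seq (pushes k (g true)) (Emit 3 true)))).

Lemma runs_pump r k g R c : r != k -> r != 3 -> k != 3 -> (forall b, size (g b) <= c) ->
  runs (Pump r k g) R ((c + 7) * size (R r) + 10)
    (update (update R r [::]) k (foldl (fun v b => g b ++ v) (R k) (R r))).
Proof.
move=> rk r3 k3 gc; apply: runs_weaken.
  apply: runs_seq; first exact: runs_pushes.
  set L := While _ _.
  have H w v S : S 3 = [:: true, false & v] -> S r = w -> runs L S ((c + 7) * size w + 7)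
      (update (update (update S 3 v) r [::]) k (foldl (fun v b => g b ++ v) (S k) w)).
    elim: w S => [|b w IH] S S3 Sr.
      apply: runs_weaken; first apply: (runs_while_step S3).
      - apply: runs_case => //; rewrite /update (negPf r3) Sr; exact: runs_skip.
      - apply: (runs_while_stop (w := v)); first by rewrite /update eqxx.
        apply: functional_extensionality => x; rewrite /update /=.
        case: (eqVneq x k) => [->|_]; first by rewrite (negPf k3).
        by case: (eqVneq x r) => [->|_]; rewrite ?(negPf r3) ?Sr //; case: eqP.
      - by rewrite muln0.
    apply: runs_weaken; first apply: (runs_while_step S3).
    - apply: (runs_case (n := c + 1)) => //; rewrite {1}/update (negPf r3) Sr.
      have -> : (if b then Seq (pushes k (g true)) (Emit 3 true)
                 else Seq (pushes k (g false)) (Emit 3 true))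
               = Seq (pushes k (g b)) (Emit 3 true) by case: b {Sr}.
      apply: runs_seq; first exact: (runs_pushesE (gc b)).
      exact: runs_emit.
    - set S' := update _ 3 _; have := IH S'.
      have -> : S' 3 = [:: true, false & v].
        by rewrite /S' /update eqxx (eq_sym 3 k) (negPf k3) (eq_sym 3 r) (negPf r3).
      have -> : S' r = w by rewrite /S' /update (negPf r3) (negPf rk) eqxx.
      have -> : S' k = g b ++ S k.
        by rewrite /S' /update (negPf k3) eqxx (eq_sym k r) (negPf rk).
      move=> /(_ erefl erefl); set F := update _ k _; set G := update _ k _.
      suff -> : F = G by exact.
      apply: functional_extensionality => x; rewrite /F /G /S' /update /=.
      by case: (x == k); case: (x == r); case: (x == 3).
    - by rewrite /=; nia.
  have := H (R r) (R 3) (update R 3 ([:: true; false] ++ R 3)).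
  have -> : update R 3 ([:: true; false] ++ R 3) k = R k by rewrite /update (negPf k3).
  set F := update _ k _; set G := update _ k _.
  have -> : F = G; last first.
    by apply; rewrite /update ?eqxx // (negPf r3).
  apply: functional_extensionality => x; rewrite /F /G /update /=.
  by case: (x == k) => //; case: (x == r) => //; case: (eqVneq x 3) => [->|].
by rewrite /=; lia.
Qed.

Definition bitcode (b : bool) : word := true :: code (enc b).

Lemma pump_code (w : word) v :
  foldl (fun v b => bitcode b ++ v) (false :: v) (rev w) = code (enc w) ++ v.
Proof.
elim: w => [|b w IH] //=; rewrite rev_cons foldl_rcons IH.
by rewrite catA.
Qed.

Lemma pump_rev (w v : word) : foldl (fun v b => [:: b] ++ v) v w = rev w ++ v.
Proof. by elim: w v => //= b w IH v; rewrite IH rev_cons cat_rcons. Qed.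

(** Both words are first reversed into buffers, because pumping back reverses again; the second goes
    back first, so that the first ends on top. *)
Definition Load :=
  Seq (Pump 0 2 (fun b => [:: b])) (Seq (Pump 1 4 (fun b => [:: b]))
  (Seq (pushes 0 [:: false]) (Seq (Pump 4 0 bitcode)
  (Seq (pushes 0 [:: false]) (Seq (Pump 2 0 bitcode) (Emit 0 true)))))).

Lemma runs_load (x y : word) :
  runs Load (regs x y [::] [::] [::]) (19 * (size x + size y) + 43)
    (regs (code (enc (x, y))) [::] [::] [::] [::]).
Proof.
have c1 (b : bool) : size [:: b] <= 1 by [].
have c4 b : size (bitcode b) <= 4 by case: b.
apply: runs_weaken.
  apply: runs_seq; first exact: (runs_pump _ _ _ _ c1).
  rewrite !update_regs /= pump_rev cats0.
  apply: runs_seq; first exact: (runs_pump _ _ _ _ c1).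
  rewrite !update_regs /= pump_rev cats0.
  apply: runs_seq; first exact: runs_pushes.
  rewrite !update_regs /=.
  apply: runs_seq; first exact: (runs_pump _ _ _ _ c4).
  rewrite !update_regs /= (pump_code y [::]).
  apply: runs_seq; first exact: runs_pushes.
  rewrite !update_regs /=.
  apply: runs_seq; first exact: (runs_pump _ _ _ _ c4).
  rewrite !update_regs /= pump_code cats0.
  by apply: runs_emitE; rewrite update_regs.
by rewrite /regs /= !size_rev /=; lia.
Qed.

(** The bit [true] is coded as the number 1, that is by [true], [false], [false]; hence two further
    bits are discarded after its tag. *)
Definition Unload :=
  Seq (Seq (pushes 3 [:: true; false])
    (While 3 (Case 0 Skip Skip (Case 0 Skip (Seq (Emit 1 false) (Emit 3 true))
       (Seq (Case 0 Skip Skip Skip) (Seq (Case 0 Skip Skip Skip)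
         (Seq (Emit 1 true) (Emit 3 true))))))))
    (Pump 1 0 (fun b => [:: b])).

Lemma runs_unload (w : word) :
  runs Unload (regs (code (enc w)) [::] [::] [::] [::]) (40 * size w + 40)
    (regs w [::] [::] [::] [::]).
Proof.
have c1 (b : bool) : size [:: b] <= 1 by [].
apply: runs_weaken.
  apply: runs_seq.
    apply: runs_seq; first exact: runs_pushes.
    rewrite update_regs /=; set L := While _ _.
    have H v : runs L (regs (code (enc w)) v [::] [:: true; false] [::]) (30 * size w + 20)
        (regs [::] (rev w ++ v) [::] [::] [::]); last exact: H.
    elim: w v => [|b w IH] v.
      apply: runs_weaken; first apply: runs_while_step => //.
      - rewrite update_regs; apply: runs_case => //=; exact: runs_skip.
      - by apply: runs_while_stop => //=; rewrite !update_regs.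
      - by [].
    apply: runs_weaken; first apply: (runs_while_step (w := [:: false])
      (R1 := regs (code (enc w)) (b :: v) [::] [:: true; false] [::])) => //.
    - rewrite update_regs; apply: runs_case => //=; rewrite update_regs.
      apply: (runs_case (n := 8)) => //=; case: b => /=.
        rewrite update_regs.
        apply: (runs_seq (n1 := 3)); first by apply: (runs_case (n := 0)) => //=; exact: runs_skip.
        rewrite update_regs.
        apply: (runs_seq (n1 := 3)); first by apply: (runs_case (n := 0)) => //=; exact: runs_skip.
        rewrite update_regs.
        apply: (runs_seq (n1 := 1)); first exact: runs_emit.
        by apply: runs_emitE; rewrite !update_regs.
      rewrite update_regs; apply: (runs_seq (n1 := 1)); first exact: runs_emit.
      apply: (@runs_weaken _ _ 1) => //.
      by apply: runs_emitE; rewrite !update_regs.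
    - by have := IH (b :: v); rewrite rev_cons cat_rcons.
    - by rewrite /=; lia.
  rewrite cats0; have := @runs_pump 1 0 (fun b => [:: b]) (regs [::] (rev w) [::] [::] [::]) 1.
  rewrite !update_regs /= pump_rev revK cats0; exact.
by rewrite /regs /= size_rev; lia.
Qed.

Lemma sz_word (w : seq bool) : sz w <= 4 * size w + 1.
Proof. by elim: w => // b w IH; rewrite sz_cons /=; have := sz_bool b; lia. Qed.

Lemma PF_polytime2 (D : word -> word -> Prop) (f : word -> word -> word) :
  PF (fun p => D p.1 p.2) (fun p => f p.1 p.2) -> polytime2 D f.
Proof.
move=> Pf; have [s Hs] := PF_size Pf; case: Pf => [c [e H]].
pose S := PA (PM (PC 4) PX) (PC 3).
pose Q := PA (PA (PM (PC 19) PX) (PC 43)) (PA (psubst e S)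
  (PA (PM (PC 40) (psubst s S)) (PC 40))).
have [k Hk] := peval_le_pow Q.
exists (compile 0 (Seq Load (Seq c Unload))), k => _ [x [y [Dxy ->]]] /=.
suff R : runs (Seq Load (Seq c Unload)) (nth [::] [:: x; y])
    (peval Q (size (x ++ y ++ [::]))) (regs (f x y) [::] [::] [::] [::]).
  exact: (runs_computes R (Hk _)).
have -> : nth [::] [:: x; y] = regs x y [::] [::] [::].
  by apply: functional_extensionality => -[|[|[|[|[|r]]]]]; rewrite /regs /= ?nth_nil.
have szS : sz (x, y) <= peval S (size (x ++ y ++ [::])).
  have wx : sz x <= 4 * size x + 1 by exact: sz_word.
  have wy : sz y <= 4 * size y + 1 by exact: sz_word.
  by rewrite sz_pair /= !size_cat; lia.
apply: runs_weaken.
  apply: runs_seq; first exact: runs_load.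
  apply: runs_seq; first by rewrite -[code _]cats0; exact: (H (x, y) Dxy).
  rewrite cats0; exact: runs_unload.
rewrite /Q /= !peval_subst.
have h1 := peval_mono e szS; have h2 := peval_mono s szS.
have h3 : sz (f x y) <= _ := Hs (x, y) Dxy.
have h4 : size (f x y) <= sz (f x y) by exact: size_le_sz.
by rewrite /= in h3; move: h1 h2; rewrite !size_cat addn0; lia.
Qed.

Lemma PF_polytime1 (D : word -> Prop) (f : word -> word) :
  PF D f -> polytime1 D f.
Proof.
move=> Pf.
have P : PF (fun p : word * word => D p.1) (fun p => f p.1) by exact: PF_lift.
have [p [k H]] := @PF_polytime2 (fun x _ => D x) (fun x _ => f x) P.
exists p, k => _ [x Dx ->] /=; have := H _ (ex_intro _ x (ex_intro _ [::] (conj Dx erefl))).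
rewrite /computes_within /= cats0.
have -> // : nth [::] [:: x; [::]] = nth [::] [:: x].
by apply: functional_extensionality => -[|[|r]] //=; rewrite nth_nil.
Qed.

(** * Simulation of arbitrary stack machines on encoded data *)

Definition sim_act (i : option instr) (s : nat * seq (seq bool)) : nat * seq (seq bool) :=
  match i with
  | None => s
  | Some (Push r b) => (s.1.+1, set_nth [::] s.2 r (b :: nth [::] s.2 r))
  | Some (Pop r e f t) =>
      if nth [::] s.2 r is b :: w then (if b then t else f, set_nth [::] s.2 r w)
      else (e, s.2)
  end.

Definition sim_step (p : program) (s : nat * seq (seq bool)) := sim_act (onth p s.1) s.

Lemma sim_stepE p s : step p (s.1, nth [::] s.2) =
  ((sim_step p s).1, nth [::] (sim_step p s).2).
Proof.
have U st r w : nth [::] (set_nth [::] st r w) = update (nth [::] st) r w :> (nat -> word).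
  by apply: functional_extensionality => x; rewrite nth_set_nth.
rewrite /step /sim_step; case: (onth p s.1) => [[r b|r e f t]|] //=; first by rewrite U.
by case: (nth [::] s.2 r) => //= b w; rewrite U.
Qed.

Lemma sim_iterE p n s : iter n (step p) (s.1, nth [::] s.2) =
  ((iter n (sim_step p) s).1, nth [::] (iter n (sim_step p) s).2).
Proof. by elim: n => //= n ->; rewrite sim_stepE. Qed.

Lemma sz_set_nth (st : seq (seq bool)) r (y : seq bool) :
  sz (set_nth [::] st r y) + sz (nth [::] st r) <= sz st + sz y + 2 * r + 2.
Proof.
elim: r st => [|r IH] [|x st] //=; rewrite ?sz_cons ?sz_nil.
- lia.
- lia.
- have := IH [::]; rewrite set_nth_nil nth_nil !sz_nil; lia.
- have := IH st; lia.
Qed.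

(** A jump may enlarge the unary program counter up to its target, and a push on a stack beyond the
    end of the list creates the missing stacks before it; both costs are constants of the
    instruction. *)
Definition sim_cst (i : option instr) : nat :=
  match i with
  | None => 0
  | Some (Push r b) => 2 * r + 10
  | Some (Pop r e f t) => 2 * r + 10 + 2 * (e + f + t)
  end.

Lemma sz_sim_act i s : sz (sim_act i s) <= sz s + sim_cst i.
Proof.
case: i => [[r b|r e f t]|] /=; last by rewrite addn0.
  rewrite !sz_pair /= !sz_nat.
  by have := sz_set_nth s.2 r (b :: nth [::] s.2 r); rewrite sz_cons; have := sz_bool b; lia.
case E: (nth [::] s.2 r) => [|b w]; rewrite !sz_pair /= !sz_nat; first lia.
have := sz_set_nth s.2 r w; rewrite E sz_cons; case: b {E}; lia.
Qed.

Lemma sz_sim_step p : exists C, forall s, sz (sim_step p s) <= sz s + C.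
Proof.
suff [C H] : exists C, forall n, sim_cst (onth p n) <= C.
  by exists C => s; apply: leq_trans (sz_sim_act _ _) _; rewrite leq_add2l.
elim: p => [|i p [C IH]]; first by exists 0 => -[].
exists (sim_cst (Some i) + C) => -[|n] /=; first exact: leq_addr.
by apply: leq_trans (IH n) _; exact: leq_addl.
Qed.

Lemma PF_set_nth {E} {dE : data E} D (s : E -> seq (seq bool)) r (y : E -> seq bool) :
  PF D s -> PF D y -> PF D (fun e => set_nth [::] (s e) r (y e)).
Proof.
elim: r s => [|r IH] s Ps Py.
  by apply: PF_ext (PF_cons Py (PF_behead Ps)) => e _; case: (s e).
apply: PF_ext (PF_cons (PF_head (PF_const _ [::]) Ps) (IH _ (PF_behead Ps) Py)) => e _.
by case: (s e) => //=; rewrite set_nth_nil.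
Qed.

Lemma PF_sim_act D i : PF D (sim_act i).
Proof.
case: i => [[r b|r e f t]|]; rewrite /sim_act /=; last exact: PF_id.
  by pf; apply: PF_set_nth; pf.
apply: (PF_seqcase (l := fun s : nat * seq (seq bool) => nth [::] s.2 r)
  (g := fun s (b : bool) w => (if b then t else f, set_nth [::] s.2 r w))); pf.
by apply: PF_set_nth; pf.
Qed.

Lemma PF_sim_step D p : PF D (sim_step p).
Proof.
have P Q : PF Q (fun q : nat * (nat * seq (seq bool)) => sim_act (onth p q.1) q.2).
  elim: p Q => [|i p IH] Q.
    by apply: PF_ext (PF_snd0 _) => -[[|n] s].
  have P : PF Q (fun q : nat * (nat * seq (seq bool)) => if q.1 is m.+1 then
      (fun q m => sim_act (onth p m) q.2) q m else sim_act (Some i) q.2).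
    apply: PF_natcase; first exact: PF_fst0.
      by apply: PF_app (PF_snd0 _) => ?; exact: PF_sim_act.
    have Pt : PF (fun p => Q p.1) (fun q : nat * (nat * seq (seq bool)) * nat => (q.2, q.1.2)) by pf.
    by apply: (PF_comp Pt (IH (fun _ => True))).
  by apply: PF_ext P => -[[|n] s] _.
have Pt : PF D (fun s : nat * seq (seq bool) => (s.1, s)) by pf.
by apply: (PF_comp Pt (P (fun _ => True))).
Qed.

(** Membership in PLS provides arbitrary machines, while their combination is programmed in the
    calculus, so machines have to be imported. One simulated step adds at most a constant to the
    size and the number of steps is polynomial, which meets the bound that [PF_iter] asks for. *)
Lemma PF_machine {E} {dE : data E} (D : E -> Prop) (args : E -> seq (seq bool))
    (f : seq (seq bool) -> word) (D' : seq (seq bool) -> Prop) :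
  polytime_on D' f -> PF D args -> (forall e, D e -> D' (args e)) ->
  PF D (fun e => f (args e)).
Proof.
case=> p [k H] Pa DD; have [C HC] := sz_sim_step p.
pose T e := size (flatten (args e)) ^ k + k.
have PT : PF D T by rewrite /T; pf.
have [b Hb] := PF_size Pa; have [t Ht] := PF_size PT.
have P : PF D (fun e => iter (size (nseq (T e) tt)) (sim_step p) (0, args e)).
  apply: (PF_iter (DS := fun _ => True)) => //.
  - by apply: PF_pair; pf.
  - exact: PF_sim_step.
  exists (PA (PA (PC 2) b) (PM t (PC C))) => e n De; rewrite size_nseq => le.
  have : sz (iter n (sim_step p) (0, args e)) <= sz (0, args e) + n * C.
    elim: n {le} => [|n IH]; first by rewrite addn0.
    rewrite iterS; apply: leq_trans (HC _) _; lia.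
  have -> : sz (0, args e) = (1 + sz (args e)).+1 by rewrite sz_pair.
  move=> h3; have h2 := Hb e De; have h1 : sz (T e) <= _ := Ht e De.
  rewrite sz_nat in h1.
  have : n * C <= peval t (sz e) * C by rewrite leq_mul //; lia.
  by rewrite /=; lia.
have Q : PF D (fun e => nth [::] (iter (size (nseq (T e) tt)) (sim_step p) (0, args e)).2 0) by pf.
apply: PF_ext Q => e /DD /H [_]; rewrite size_nseq.
by rewrite -[(0, nth [::] (args e))]/((0, args e).1, nth [::] (0, args e).2) sim_iterE.
Qed.

Lemma PF_of_polytime1 D f : polytime1 D f -> PF D f.
Proof.
move=> Pf; have P := PF_machine (E := word) (D := D) (args := fun x => [:: x]) Pf.
by apply: P => [|x Dx]; [pf | exists x].
Qed.

Lemma PF_of_polytime2 D f : polytime2 D f ->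
  PF (fun p => D p.1 p.2) (fun p => f p.1 p.2).
Proof.
move=> Pf; have P := PF_machine (D := fun p => D p.1 p.2) (args := fun p : word * word => [:: p.1; p.2]) Pf.
by apply: P => [|[x y] Dxy]; [pf | exists x, y].
Qed.

(** * Codes of instances and solutions *)

Lemma PF_app3 {E A B C R} {dE : data E} {dA : data A} {dB : data B} {dC : data C}
    {dR : data R} D (h : A -> B -> C -> R) (f : E -> A) (g : E -> B) (k : E -> C) :
  (forall Q : A * B * C -> Prop, PF Q (fun p => h p.1.1 p.1.2 p.2)) ->
  PF D f -> PF D g -> PF D k -> PF D (fun e => h (f e) (g e) (k e)).
Proof.
move=> Ph Pf Pg Pk.
exact: (PF_comp (PF_pair (PF_pair Pf Pg) Pk) (Ph (fun _ => True))).
Qed.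

Lemma sz_rev {X} {dX : data X} (s : seq X) : sz (rev s) = sz s.
Proof.
elim: s => // x s IH; rewrite rev_cons -cats1.
have : sz (rev s ++ [:: x]) + 1 = sz (rev s) + sz [:: x] by exact: sz_cat.
by rewrite !sz_cons sz_nil IH; lia.
Qed.

Lemma sz_mem {X : eqType} {dX : data X} (x : X) s : x \in s -> sz x < sz s.
Proof.
elim: s => // y s IH; rewrite inE sz_cons => /orP[/eqP->|/IH h].
  by rewrite ltnS leq_addr.
by apply: leq_trans h _; apply: leq_trans (leq_addl _ _) (leqnSn _).
Qed.

Definition unary_code (l : seq nat) : seq bool :=
  flatten [seq rcons (nseq n true) false | n <- l].

Definition unary_step (s : nat * seq nat) (b : bool) : nat * seq nat :=
  if b then (s.1.+1, s.2) else (0, s.1 :: s.2).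

Definition unary_decode (w : seq bool) : seq nat :=
  rev (foldl unary_step (0, [::]) w).2.

Lemma unary_codeK : cancel unary_code unary_decode.
Proof.
move=> l; rewrite /unary_decode.
have step n k acc : foldl unary_step (k, acc) (rcons (nseq n true) false) = (0, n + k :: acc).
  elim: n k => //= n IH k; rewrite IH; congr (_, _ :: _); lia.
suff -> acc : foldl unary_step (0, acc) (unary_code l) = (0, rev l ++ acc).
  by rewrite cats0 revK.
rewrite /unary_code; elim: l acc => //= n l IH acc.
by rewrite foldl_cat step IH rev_cons cat_rcons addn0.
Qed.

(** The flag says that the next bit is payload; without it a [true] announces payload and a [false]
    closes the current word. *)
Definition words_step (s : bool * (seq bool * seq (seq bool))) (b : bool) :
    bool * (seq bool * seq (seq bool)) :=
  if s.1 then (false, (b :: s.2.1, s.2.2))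
  else if b then (true, s.2) else (false, ([::], rev s.2.1 :: s.2.2)).

Definition words_decode (w : seq bool) : seq (seq bool) :=
  rev (foldl words_step (false, ([::], [::])) w).2.2.

Lemma words_codeK : cancel words_code words_decode.
Proof.
move=> l; rewrite /words_decode.
have step w k acc : foldl words_step (false, (k, acc)) (word_code w)
    = (false, ([::], (rev k ++ w) :: acc)).
  rewrite /word_code; elim: w k => /= [|b w IH] k; first by rewrite cats0.
  by rewrite IH rev_cons cat_rcons.
suff -> acc : foldl words_step (false, ([::], acc)) (words_code l) = (false, ([::], rev l ++ acc)).
  by rewrite cats0 revK.
rewrite /words_code; elim: l acc => //= n l IH acc.
by rewrite foldl_cat step IH rev_cons cat_rcons.
Qed.

Lemma PF_rcons {E X} {dE : data E} {dX : data X} D (s : E -> seq X) (x : E -> X) :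
  PF D s -> PF D x -> PF D (fun e => rcons (s e) (x e)).
Proof.
move=> Ps Px; apply: PF_ext (PF_cat Ps (PF_cons Px (PF_const _ [::]))) => e _.
by rewrite cats1.
Qed.

Lemma PF_unary_code {E} {dE : data E} D (l : E -> seq nat) :
  PF D l -> PF D (fun e => unary_code (l e)).
Proof. by apply: PF_app => Q; rewrite /unary_code; pf; apply: PF_rcons; pf. Qed.

Lemma PF_word_code {E} {dE : data E} D (l : E -> seq bool) :
  PF D l -> PF D (fun e => word_code (l e) : seq bool).
Proof.
apply: (PF_app (h := fun l => word_code l : seq bool)) => Q.
by rewrite /word_code; pf.
Qed.

Lemma PF_words_code {E} {dE : data E} D (l : E -> seq (seq bool)) :
  PF D l -> PF D (fun e => words_code (l e) : seq bool).
Proof.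
apply: (PF_app (h := fun l => words_code l : seq bool)) => Q.
rewrite /words_code.
apply: (PF_ext (f := fun l : seq (seq bool) => flatten [seq (word_code w : seq bool) | w <- l])) => //.
by pf; apply: PF_word_code; pf.
Qed.

Lemma PF_unary_decode {E} {dE : data E} D (w : E -> seq bool) :
  PF D w -> PF D (fun e => unary_decode (w e)).
Proof.
apply: PF_app => Q; rewrite /unary_decode; pf.
apply: (PF_foldl (Inv := fun _ k (s : nat * seq nat) => sz s <= 5 + 5 * k)
  (f := fun _ => unary_step)); try by pf.
- by rewrite /unary_step; pf.
- by move=> e k [n s] [] _ _ _; rewrite /unary_step /= !sz_pair /= ?sz_cons !sz_nat; lia.
- exists (PA (PC 5) (PM (PC 5) PX)) => e k s _ le h /=.
  by have : size e <= sz e by [exact: size_le_sz]; lia.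
Qed.

Lemma PF_words_decode {E} {dE : data E} D (w : E -> seq bool) :
  PF D w -> PF D (fun e => words_decode (w e)).
Proof.
apply: PF_app => Q; rewrite /words_decode; pf.
apply: (PF_foldl (Inv := fun _ k (s : bool * (seq bool * seq (seq bool))) => sz s <= 10 + 8 * k)
  (f := fun _ => words_step)); try by pf.
- by rewrite /words_step; pf.
- move=> e k [m [c s]] b _ _ _; rewrite /words_step /=.
  have := sz_bool b; case: m; case: b => _; rewrite !sz_pair /= ?sz_cons ?sz_rev ?sz_nil.
  + by have -> : sz true = 3 by []; have -> : sz false = 1 by []; lia.
  + by have -> : sz true = 3 by []; have -> : sz false = 1 by []; lia.
  + by have -> : sz true = 3 by []; have -> : sz false = 1 by []; lia.
  + by have -> : sz false = 1 by []; lia.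
- exists (PA (PC 10) (PM (PC 8) PX)) => e k s _ le h /=.
  by have : size e <= sz e by [exact: size_le_sz]; lia.
Qed.

Lemma PF_eqw {E} {dE : data E} D (f g : E -> seq bool) :
  PF D f -> PF D g -> PF D (fun e => f e == g e).
Proof.
apply: (PF_app2 (h := fun v w : seq bool => v == w)) => Q.
have P : PF Q (fun p : seq bool * seq bool => (size p.1 == size p.2) &&
    all (fun i => nat_of_bool (nth false p.1 i) == nat_of_bool (nth false p.2 i)) (iota 0 (size p.1))).
  by pf.
apply: PF_ext P => -[v w] _ /=; apply/idP/eqP => [/andP[/eqP sE /allP H]|->].
  apply: (eq_from_nth (x0 := false)) => // i lt.
  by have /H : i \in iota 0 (size v); [rewrite mem_iota | case: nth; case: nth].
by rewrite eqxx; apply/allP.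
Qed.

Lemma PF_memn {E} {dE : data E} D (f : E -> nat) (g : E -> seq nat) :
  PF D f -> PF D g -> PF D (fun e => f e \in g e).
Proof.
apply: (PF_app2 (h := fun n (s : seq nat) => n \in s)) => Q.
have P : PF Q (fun p : nat * seq nat => ~~ all (fun y => ~~ (y == p.1)) p.2) by pf.
apply: PF_ext P => -[n s] _ /=; rewrite -has_predC -has_pred1.
by apply: eq_has => y /=; rewrite negbK.
Qed.

Lemma PF_index {E} {dE : data E} D (f : E -> nat) (g : E -> seq nat) :
  PF D f -> PF D g -> PF D (fun e => index (f e) (g e)).
Proof.
apply: (PF_app2 (h := fun n (s : seq nat) => index n s)) => Q.
have P : PF Q (fun p : nat * seq nat =>
    head (size p.2) [seq i <- iota 0 (size p.2) | nth 0 p.2 i == p.1]) by pf.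
apply: PF_ext P => -[n s] _ /=.
have H k : head (k + size s) [seq i <- iota k (size s) | nth 0 s (i - k) == n] = k + index n s.
  elim: s k => [|y s IH] k /=; first by rewrite addn0.
  rewrite subnn /=; case: (eqVneq y n) => [|_]; first by rewrite /= addn0.
  rewrite addnS -addSn -[in RHS]addSnnS -IH; congr head.
  apply: eq_in_filter => i; rewrite mem_iota => /andP[lt _].
  by rewrite -[i - k](@prednK _) ?subn_gt0 // -subnS.
by have := H 0; rewrite !add0n => <-; congr head; apply: eq_filter => i; rewrite subn0.
Qed.

(** * Membership in a permutation group *)

(** As maps this is [s] after [t], which is [t * s] in the group of permutations; hence the swapped
    factors in [pmul_plist]. *)
Definition pmul (s t : seq nat) : seq nat := [seq nth 0 s j | j <- t].
Definition pinv (s : seq nat) : seq nat := [seq index i s | i <- iota 0 (size s)].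
Definition fixes (i : nat) (t : seq nat) : bool := all (fun j => nth 0 t j == j) (iota 0 i).

Definition sift_cand (T : seq (seq nat)) (s : seq nat) (i : nat) : seq (seq nat) :=
  [seq t <- T | (nth 0 t i == nth 0 s i) && fixes i t].

(* The boolean records that sifting is stuck. *)
Definition sift_step (T : seq (seq nat)) (r : bool * seq nat) (i : nat) : bool * seq nat :=
  if r.1 || (nth 0 r.2 i == i) then r
  else if nilp (sift_cand T r.2 i) then (true, r.2)
  else (false, pmul (pinv (head [::] (sift_cand T r.2 i))) r.2).

Definition sift (N : nat) (T : seq (seq nat)) (s : seq nat) : bool * seq nat :=
  foldl (sift_step T) (false, s) (iota 0 N).

Definition stuck_residues (N : nat) (T : seq (seq nat)) : seq (bool * seq nat) :=
  [seq r <- flatten [seq [seq sift N T (pmul a b) | b <- T] | a <- T] | r.1].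

Definition close_step (N : nat) (T : seq (seq nat)) : seq (seq nat) :=
  if nilp (stuck_residues N T) then T else (head (true, [::]) (stuck_residues N T)).2 :: T.

(** Every round before closure covers a new pair of a point and an image ([covered]), and there are
    [N * N] pairs. A round adds at most one element, which keeps the table small. *)
Definition sgs (N : nat) (gs : seq (seq nat)) : seq (seq nat) :=
  foldl (fun T _ => close_step N T) gs (nseq (N * N + 1) tt).

Definition group_member (N : nat) (gs : seq (seq nat)) (s : seq nat) : bool :=
  ~~ (sift N (sgs N gs) s).1.

Lemma PF_nilp {E X} {dE : data E} {dX : data X} D (l : E -> seq X) :
  PF D l -> PF D (fun e => nilp (l e)).
Proof.
move=> Pl; have P : PF D (fun e => size (l e) == 0) by pf.
exact: PF_ext P.
Qed.

Lemma PF_pmul {E} {dE : data E} D (s t : E -> seq nat) :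
  PF D s -> PF D t -> PF D (fun e => pmul (s e) (t e)).
Proof. by apply: PF_app2 => Q; rewrite /pmul; pf. Qed.

Lemma PF_pinv {E} {dE : data E} D (s : E -> seq nat) :
  PF D s -> PF D (fun e => pinv (s e)).
Proof. by apply: PF_app => Q; rewrite /pinv; pf; apply: PF_index; pf. Qed.

Lemma PF_sift_cand {E} {dE : data E} D (T : E -> seq (seq nat)) (s : E -> seq nat) (i : E -> nat) :
  PF D T -> PF D s -> PF D i -> PF D (fun e => sift_cand (T e) (s e) (i e)).
Proof. by apply: PF_app3 => Q; rewrite /sift_cand /fixes; pf. Qed.

Ltac pf_user ::=
  lazymatch goal with
  | |- @PF _ _ _ _ _ (fun e => pmul (@?f e) (@?g e)) => apply: (PF_pmul (s := f) (t := g))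
  | |- @PF _ _ _ _ _ (fun e => pinv (@?f e)) => apply: (PF_pinv (s := f))
  | |- @PF _ _ _ _ _ (fun e => nilp (@?f e)) => apply: (PF_nilp (l := f))
  | |- @PF _ _ _ _ _ (fun e => sift_cand (@?f e) (@?g e) (@?h e)) =>
      apply: (PF_sift_cand (T := f) (s := g) (i := h))
  | |- @PF _ _ _ _ _ (fun e => unary_code (@?f e)) => apply: (PF_unary_code (l := f))
  | |- @PF _ _ _ _ _ (fun e => words_code (@?f e)) => apply: (PF_words_code (l := f))
  | |- @PF _ _ _ _ _ (fun e => unary_decode (@?f e)) => apply: (PF_unary_decode (w := f))
  | |- @PF _ _ _ _ _ (fun e => words_decode (@?f e)) => apply: (PF_words_decode (w := f))
  | |- @PF _ _ _ _ _ (fun e => index (@?f e) (@?g e)) => apply: (PF_index (f := f) (g := g))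
  end.

(** Products, inverses and sifting respect a common bound on length and entries even for lists that
    are no permutations, so the table stays polynomial on arbitrary inputs. *)
Definition small (X : nat) (s : seq nat) : bool := (size s <= X) && all (fun y => y <= X) s.

Lemma small_pmul X s t : small X s -> small X t -> small X (pmul s t).
Proof.
move=> /andP[_ /allP hs] /andP[st _]; rewrite /small size_map st; apply/allP => _ /mapP[j _ ->].
case: (ltnP j (size s)) => lt; first by apply: hs; exact: mem_nth.
by rewrite nth_default.
Qed.

Lemma small_pinv X s : small X s -> small X (pinv s).
Proof.
move=> /andP[ss _]; rewrite /small size_map size_iota ss; apply/allP => _ /mapP[j _ ->].
exact: leq_trans (index_size _ _) ss.
Qed.

Lemma small_sz X s : small X s -> sz s <= 1 + X * (2 * X + 2).
Proof.
case/andP; elim: s X => // y s IH [|X] //= lt /andP[yX H]; rewrite sz_cons sz_nat.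
have {}IH k : k <= X.+1 -> size s <= k -> sz s <= 1 + k * (2 * X.+1 + 2).
  move=> _; elim: s k H {IH lt} => [|z s IH] k; first by rewrite sz_nil.
  by move=> /= /andP[zX H]; case: k => // k lt; rewrite sz_cons sz_nat; have := IH k H lt; lia.
by have := IH X (leqnSn X) lt; lia.
Qed.

Lemma small_mem X (T : seq (seq nat)) (s : seq nat) : sz T <= X -> s \in T -> small X s.
Proof.
move=> TX sT; have lt : sz s < sz T by exact: sz_mem.
apply/andP; split; first by have : size s <= sz s by [exact: size_le_sz]; lia.
apply/allP => y ys; have : sz y < sz s by exact: sz_mem.
by rewrite sz_nat; lia.
Qed.

Lemma small_of_sz X (s : seq nat) : sz s <= X -> small X s.
Proof.
move=> le; apply/andP; split; first by have : size s <= sz s by [exact: size_le_sz]; lia.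
apply/allP => y ys; have : sz y < sz s by exact: sz_mem.
by rewrite sz_nat; lia.
Qed.

Lemma small_sift_step X T r i : all (small X) T -> small X r.2 ->
  small X (sift_step T r i).2.
Proof.
move=> /allP TX rX; rewrite /sift_step; case: ifP => // _.
case E: (sift_cand T r.2 i) => [|t c] //=; apply: small_pmul => //; apply: small_pinv; apply: TX.
have : t \in sift_cand T r.2 i by rewrite E inE eqxx.
by rewrite mem_filter => /andP[].
Qed.

Lemma small_sift X N T s : all (small X) T -> small X s -> small X (sift N T s).2.
Proof.
move=> TX sX; rewrite /sift.
suff H l r : small X r.2 -> small X (foldl (sift_step T) r l).2 by exact: H.
by elim: l r => //= i l IH r rX; apply: IH; exact: small_sift_step.
Qed.

Lemma small_close_step X N T : all (small X) T -> all (small X) (close_step N T).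
Proof.
move=> TX; rewrite /close_step; case E: (stuck_residues N T) => [|r c] //=; rewrite TX andbT.
have : r \in stuck_residues N T by rewrite E inE eqxx.
rewrite mem_filter => /andP[_ /flattenP[_ /mapP[a aT ->] /mapP[b bT ->]]].
by apply: small_sift => //; apply: small_pmul; exact: (allP TX).
Qed.

Lemma all_small_sz X (T : seq (seq nat)) :
  all (small X) T -> sz T <= 1 + size T * (2 + X * (2 * X + 2)).
Proof.
elim: T => // t T IH /= /andP[/small_sz tX /IH {}IH]; rewrite sz_cons; lia.
Qed.

Lemma PF_sift {E} {dE : data E} D (n : E -> nat) (T : E -> seq (seq nat)) (s : E -> seq nat) :
  PF D n -> PF D T -> PF D s -> PF D (fun e => sift (n e) (T e) (s e)).
Proof.
apply: PF_app3 => Q; rewrite /sift.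
apply: (PF_foldl (Inv := fun e _ r => small (sz e) r.2)
  (f := fun e => sift_step e.1.2)); try by pf.
- by rewrite /sift_step; pf.
- by move=> e _ /=; apply: small_of_sz; rewrite sz_pair; lia.
- move=> e k r x _ _ _ rX; apply: small_sift_step => //; apply/allP => t.
  by apply: small_mem; rewrite !sz_pair; lia.
- exists (PA (PC 5) (PM PX (PA (PM (PC 2) PX) (PC 2)))) => e k r _ _ /small_sz h.
  by rewrite sz_pair /=; have := sz_bool r.1; lia.
Qed.

Lemma PF_close_step {E} {dE : data E} D (n : E -> nat) (T : E -> seq (seq nat)) :
  PF D n -> PF D T -> PF D (fun e => close_step (n e) (T e)).
Proof.
apply: PF_app2 => Q; rewrite /close_step /stuck_residues; pf; by apply: PF_sift; pf.
Qed.

Lemma PF_sgs {E} {dE : data E} D (n : E -> nat) (g : E -> seq (seq nat)) :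
  PF D n -> PF D g -> PF D (fun e => sgs (n e) (g e)).
Proof.
apply: PF_app2 => Q; rewrite /sgs.
apply: (PF_foldl (Inv := fun e k T => all (small (sz e)) T /\ size T <= sz e + k)
  (f := fun e T (_ : unit) => close_step e.1 T)); try by pf.
- by apply: PF_close_step; pf.
- move=> e _; split.
    by apply/allP => t; apply: small_mem; rewrite sz_pair; lia.
  by rewrite addn0; have : size e.2 <= sz e.2 by [exact: size_le_sz]; rewrite sz_pair; lia.
- move=> e k T x _ _ _ [TX sT]; split; first exact: small_close_step.
  by rewrite /close_step; case: ifP => _ /=; lia.
- exists (PA (PC 1) (PM (PA PX (PA (PM PX PX) (PC 1))) (PA (PC 2) (PM PX (PA (PM (PC 2) PX) (PC 2))))))
    => e k T _; rewrite size_nseq => le [/all_small_sz h sT] /=.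
  apply: leq_trans h _; rewrite leq_add2l leq_mul //; apply: leq_trans sT _.
  have : e.1 <= sz e by rewrite sz_pair sz_nat; lia.
  by move=> h; have : e.1 * e.1 <= sz e * sz e by [exact: leq_mul]; lia.
Qed.

Lemma PF_group_member {E} {dE : data E} D (n : E -> nat) (g : E -> seq (seq nat)) (s : E -> seq nat) :
  PF D n -> PF D g -> PF D s -> PF D (fun e => group_member (n e) (g e) (s e)).
Proof.
apply: PF_app3 => Q; rewrite /group_member; pf; apply: PF_sift; pf.
by apply: PF_sgs; pf.
Qed.

(** * Correctness of sifting *)

Section Sims.
Variable N : nat.
Implicit Types (s t : {perm 'I_N}) (T : seq {perm 'I_N}).
Local Open Scope group_scope.

Definition plist s : seq nat := [seq val (s i) | i <- enum 'I_N].

Lemma size_plist s : size (plist s) = N.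
Proof. by rewrite size_map size_enum_ord. Qed.

Lemma nth_plist s (i : 'I_N) : nth 0 (plist s) i = s i.
Proof. by rewrite (nth_map i) ?size_enum_ord // nth_ord_enum. Qed.

Lemma pmul_plist s t : pmul (plist s) (plist t) = plist (t * s).
Proof. by rewrite /pmul -map_comp; apply: eq_map => i /=; rewrite nth_plist permM. Qed.

Lemma pinv_plist s : pinv (plist s) = plist s^-1.
Proof.
rewrite /pinv size_plist -val_enum_ord -map_comp; apply: eq_map => i /=.
rewrite -{1}(permKV s i) /plist (index_map (f := fun j => val (s j))) ?index_enum_ord //.
by move=> j k /val_inj /perm_inj.
Qed.

Lemma plist1 : plist 1 = iota 0 N.
Proof. by rewrite -val_enum_ord; apply: eq_map => i; rewrite perm1. Qed.

Definition fixp (k : nat) s := forall j : 'I_N, j < k -> s j = j.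

Lemma fixesP k s : k <= N -> reflect (fixp k s) (fixes k (plist s)).
Proof.
move=> kN; apply: (iffP allP) => [H j jk|H j].
  by apply: val_inj; have := H j; rewrite mem_iota nth_plist => /(_ jk)/eqP.
rewrite mem_iota /= => jk; have jN : j < N by exact: leq_trans kN.
by have := nth_plist s (Ordinal jN) => /= ->; rewrite H.
Qed.

(** The table elements from which the candidates at point k are taken; in a closed table they
    generate the stabilizer of all points below k ([fix_in_level]). *)
Definition level T (k : nat) : {set {perm 'I_N}} :=
  [set t | (t \in T) && [forall j : 'I_N, (j < k) ==> (t j == j)]].

Lemma levelP T k t : reflect (t \in T /\ fixp k t) (t \in level T k).
Proof.
rewrite inE; apply: (iffP andP) => -[tT].
  by move/forallP=> H; split=> // j jk; have /implyP/(_ jk)/eqP := H j.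
by move=> H; split=> //; apply/forallP => j; apply/implyP => /H ->.
Qed.

Lemma level_sub T k : level T k.+1 \subset level T k.
Proof. by apply/subsetP => t /levelP[tT F]; apply/levelP; split=> // j jk; apply: F; exact: ltnW. Qed.

Lemma level0 T : level T 0 = [set t in T].
Proof. by apply/setP => t; apply/levelP/idP; rewrite inE => //; case. Qed.

Lemma fixp_gen T k s : s \in <<level T k>> -> fixp k s.
Proof.
case/gen_prodgP=> n [c cT ->] j jk.
elim/big_ind: _ => [|x y Hx Hy|i _]; first by rewrite perm1.
  by rewrite permM Hx Hy.
by have /levelP[_] := cT i; apply.
Qed.

Lemma mul_level_sub T k : <<level T k.+1>> * (1 |: level T k) \subset <<level T k>>.
Proof.
apply/subsetP => _ /mulsgP[h t hH tT ->]; apply: groupM.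
  by move: hH; apply/subsetP; apply: genS; exact: level_sub.
by move: tT; rewrite !inE => /orP[/eqP->|tT]; [exact: group1 | apply: mem_gen; rewrite inE].
Qed.

Lemma foldl_stuck L l w : foldl (sift_step L) (true, w) l = (true, w).
Proof. by elim: l. Qed.

(** Sifting divides on the right by table elements, hence [s^-1 * t] stays in the group. On success
    the divisor used at point k, if any, is the last factor of [s], which gives the factorization
    over level k. On failure the residue sends its first moved point where no table element fixing
    the earlier points sends it. *)
Lemma siftP T n k s : (k + n = N)%N -> fixp k s -> exists b t,
  [/\ foldl (sift_step (map plist T)) (false, plist s) (iota k n) = (b, plist t),
      s^-1 * t \in <<level T 0>>
    & if b then exists i : 'I_N, [/\ fixp i t, t i != i
                & forall u, u \in T -> fixp i u -> u i != t i]
      else s \in <<level T k>> /\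
           (k < N -> s \in <<level T k.+1>> * (1 |: level T k))].
Proof.
elim: n k s => [|n IH] k s kn F.
  exists false, s; split; rewrite ?mulVg ?group1 //; split; last lia.
  suff -> : s = 1 by exact: group1.
  by apply/permP => j; rewrite perm1 F //; have := ltn_ord j; lia.
have kN : k < N by lia.
pose i := Ordinal kN; have nthk u : nth 0 (plist u) k = u i by rewrite -[k]/(val i) nth_plist.
rewrite /= {2}/sift_step /= nthk.
case: (eqVneq (s i) i) => [si|si].
  have -> : val (s i) == k by rewrite si.
  have F' : fixp k.+1 s.
    move=> j; rewrite ltnS leq_eqVlt => /orP[/eqP jk|]; last exact: F.
    by rewrite (_ : j = i) //; exact: val_inj.
  have [|b [t [E G H]]] := IH k.+1 s _ F'; first lia.
  exists b, t; split=> //; case: b E H => // _ [sH _]; split=> [|_].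
    by apply: (subsetP (mul_level_sub T k)); rewrite -[s]mulg1 mem_mulg // !inE eqxx.
  by rewrite -[s]mulg1 mem_mulg // !inE eqxx.
have -> : (val (s i) == k) = false by apply/negbTE; apply: contraNN si => /eqP E; apply/eqP/val_inj.
case E: (sift_cand _ _ _) => [|h c] /=.
  rewrite foldl_stuck; exists true, s; split; rewrite ?mulVg ?group1 //.
  exists i; split=> // u uT Fu; apply/eqP => ui.
  have : plist u \in sift_cand (map plist T) (plist s) k.
    by rewrite mem_filter !nthk ui eqxx map_f // andbT; apply/fixesP => //; exact: ltnW.
  by rewrite E.
have : h \in sift_cand (map plist T) (plist s) k by rewrite E inE eqxx.
rewrite mem_filter => /andP[/andP[e1 e2] /mapP[t tT ht]]; subst h.
move: e1; rewrite !nthk => /eqP/val_inj ti.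
have {e2} Ft : fixp k t by apply/fixesP => //; exact: ltnW.
have tl : t \in level T k by apply/levelP.
rewrite pinv_plist pmul_plist.
have F' : fixp k.+1 (s * t^-1).
  move=> j; rewrite ltnS leq_eqVlt permM => /orP[/eqP jk|jk].
    by rewrite (_ : j = i) -?ti ?permK //; exact: val_inj.
  by rewrite (F j jk) -{1}(Ft j jk) permK.
have [|b [u [E' G H]]] := IH k.+1 _ _ F'; first lia.
exists b, u; split=> //.
  have -> : s^-1 * u = t^-1 * ((s * t^-1)^-1 * u) by rewrite invMg invgK !mulgA mulVg mul1g.
  by rewrite groupM // groupV mem_gen // level0 inE.
case: b E' H => // _ [sH _].
have -> : s \in <<level T k.+1>> * (1 |: level T k).
  by rewrite -(mulgKV t s) mem_mulg // !inE; move: tl; rewrite inE => ->; rewrite orbT.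
split=> //; apply: (subsetP (mul_level_sub T k)).
by rewrite -(mulgKV t s) mem_mulg // !inE; move: tl; rewrite inE => ->; rewrite orbT.
Qed.

Definition closed_table T :=
  forall a b, a \in T -> b \in T -> (sift N (map plist T) (plist (a * b))).1 = false.

Lemma sift_skip L k s l : k <= N -> fixp k s -> {subset l <= iota 0 k} ->
  foldl (sift_step L) (false, plist s) l = (false, plist s).
Proof.
move=> kN /fixesP-/(_ kN)/allP F; elim: l => // i l IH S /=.
have -> : sift_step L (false, plist s) i = (false, plist s).
  by rewrite /sift_step /= F // S // inE eqxx.
by apply: IH => j jl; rewrite S // inE jl orbT.
Qed.

(* Right multiplication by level k preserves <<level (k+1)>> * (1 |: level k),
   because products of two elements of level k sift successfully. *)
Lemma level_factor T k : k < N -> closed_table T ->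
  <<level T k>> \subset <<level T k.+1>> * (1 |: level T k).
Proof.
move=> kN C; apply/subsetP => _ /gen_prodgP[n [c cT ->]].
elim: n c cT => [|n IH] c cT; first by rewrite big_ord0; apply/mulsgP; exists 1 1; rewrite ?group1 ?mulg1 // setU11.
rewrite big_ord_recr /=; have /mulsgP[h t hH + ->] := IH _ (fun i => cT (widen_ord (leqnSn n) i)).
move: (c ord_max) (cT ord_max) => u /levelP[uT Fu].
rewrite !inE => /orP[/eqP->|].
  rewrite mulg1 mem_mulg // !inE; apply/orP; right.
  by have /levelP : u \in T /\ fixp k u by []; rewrite inE.
have -> : (t \in T) && [forall j : 'I_N, (j < k) ==> (t j == j)] = (t \in level T k) by rewrite inE.
move=> /levelP[tT Ft]; rewrite -mulgA.
have Ftu : fixp k (t * u) by move=> j jk; rewrite permM Ft // Fu.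
have iN : iota 0 N = iota 0 k ++ iota k (N - k) by rewrite -iotaD subnKC // ltnW.
have := C t u tT uT; rewrite /sift iN foldl_cat.
rewrite (sift_skip _ (ltnW kN) Ftu) //.
have [|b [v [-> _]]] := @siftP T (N - k) k _ _ Ftu; first lia.
case: b => // -[_ /(_ kN)/mulsgP[h' t' h'H t'T ->]] _.
by rewrite mulgA mem_mulg // groupM.
Qed.

(** Write s as h followed by t, with h generated one level deeper. Both s and h fix point k, so t
    fixes it as well and belongs to the deeper level. *)
Lemma fix_in_level T k s : k <= N -> closed_table T -> s \in <<level T 0>> -> fixp k s ->
  s \in <<level T k>>.
Proof.
move=> + C sH; elim: k => // k IH kN F.
have /(subsetP (level_factor kN C)) : s \in <<level T k>>.
  by apply: IH; [exact: ltnW | move=> j jk; apply: F; exact: ltnW].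
case/mulsgP=> h t hH tT E; rewrite E groupM //.
move: tT; rewrite in_setU1 => /orP[/eqP->|/levelP[tT Ft]]; first exact: group1.
apply: mem_gen; apply/levelP; split=> // j; rewrite ltnS leq_eqVlt => /orP[/eqP jk|]; last exact: Ft.
have := F j; rewrite E permM (fixp_gen hH) ?jk //; exact.
Qed.

(** A stuck residue of a group element fixes the points below some i, so it factors as h followed by
    u with h fixing i and u trivial or in the table; then u agrees with the residue at i, against
    being stuck. *)
Lemma sift_member T s : closed_table T ->
  ~~ (sift N (map plist T) (plist s)).1 = (s \in <<level T 0>>).
Proof.
move=> C; rewrite /sift; have [//|//|b [t [-> G H]]] := @siftP T N 0 s.
case: b H => /= [[i [Fi ti Hi]]|[-> //]].
apply/esym/negbTE/negP => sH.
have tH : t \in <<level T 0>> by rewrite -(mulKVg s t) groupM.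
have /(subsetP (level_factor (ltn_ord i) C)) := fix_in_level (ltnW (ltn_ord i)) C tH Fi.
case/mulsgP=> h u hH uT E; have Et : t i = u i by rewrite E permM (fixp_gen hH).
move: uT; rewrite in_setU1 => /orP[/eqP u1|/levelP[uT Fu]].
  by move: ti; rewrite Et u1 perm1 eqxx.
by have := Hi u uT Fu; rewrite Et eqxx.
Qed.

Definition covered T : {set 'I_N * 'I_N} :=
  [set q : 'I_N * 'I_N | has (fun t => (t \in level T q.1) && (t q.1 == q.2)) T].

Lemma close_stepP T :
  (close_step N (map plist T) = map plist T /\ closed_table T) \/
  exists t, [/\ close_step N (map plist T) = map plist (t :: T), t \in <<level T 0>>
              & #|covered T| < #|covered (t :: T)|].
Proof.
rewrite /close_step; case E: (stuck_residues N (map plist T)) => [|r c] /=.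
  left; split=> // a b aT bT; apply/negbTE/negP => st.
  suff : sift N (map plist T) (plist (a * b)) \in stuck_residues N (map plist T) by rewrite E.
  rewrite mem_filter st -pmul_plist; apply/flattenP.
  exists [seq sift N (map plist T) (pmul (plist b) x) | x <- map plist T].
    by apply/mapP; exists (plist b) => //; exact: map_f.
  by apply/mapP; exists (plist a) => //; exact: map_f.
right; have : r \in stuck_residues N (map plist T) by rewrite E inE eqxx.
rewrite mem_filter => /andP[st /flattenP[_ /mapP[_ /mapP[a aT ->] ->] /mapP[_ /mapP[b bT ->] rE]]].
move: rE st; rewrite pmul_plist /sift.
have [//|//|d [t [-> G H]]] := @siftP T N 0 (b * a).
move=> -> /= dT; rewrite dT in H; case: H => i [Fi ti Hi].
exists t; split=> //.
  by rewrite -(mulKVg (b * a) t) groupM // groupM // mem_gen // level0 inE.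
apply: proper_card; apply/properP; split.
  apply/subsetP => q; rewrite !inE => /hasP[u uT /andP[/levelP[_ Fu] uq]].
  apply/hasP; exists u; first by rewrite inE uT orbT.
  by rewrite uq andbT; apply/levelP; rewrite inE uT orbT.
exists (i, t i).
  by rewrite inE; apply/hasP; exists t; rewrite ?inE ?eqxx // andbT; apply/forallP => j; apply/implyP => /Fi ->.
rewrite inE; apply/hasPn => u uT; apply/negP => /andP[/levelP[_ Fu] /eqP ut].
by have := Hi u uT Fu; rewrite ut eqxx.
Qed.

Lemma sgsP gs : exists T, [/\ sgs N (map plist gs) = map plist T,
  <<level T 0>> = <<level gs 0>> & closed_table T].
Proof.
have iterP n : exists T, [/\ foldl (fun L (_ : unit) => close_step N L) (map plist gs) (nseq n tt) = map plist T,
    {subset gs <= T}, {subset T <= <<level gs 0>>}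
    & (close_step N (map plist T) = map plist T /\ closed_table T) \/ n <= #|covered T|].
  elim: n => [|n [T [ET gT TG H]]].
    by exists gs; split=> //; [move=> t tg; rewrite mem_gen // level0 inE | right].
  rewrite -addn1 nseqD foldl_cat ET /=.
  case: H => [[E C]|H]; first by exists T; rewrite E; split=> //; left.
  case: (close_stepP T) => [[E C]|[t [-> tT lt]]]; first by exists T; rewrite E; split=> //; left.
  exists (t :: T); split=> //.
  - by move=> u /gT uT; rewrite inE uT orbT.
  - move=> u; rewrite inE => /orP[/eqP->|]; last exact: TG.
    move: tT; apply/subsetP; rewrite gen_subG; apply/subsetP => v; rewrite level0 inE; exact: TG.
  - right; rewrite addn1; exact: leq_ltn_trans lt.
have [T [ET gT TG H]] := iterP (N * N + 1)%N; exists T; split=> //.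
  apply/eqP; rewrite eqEsubset !gen_subG; apply/andP; split; apply/subsetP => t; rewrite level0 inE.
    exact: TG.
  by move/gT=> tT; rewrite mem_gen // level0 inE.
case: H => [[]//|H]; have := max_card (mem (covered T)); rewrite card_prod card_ord => H'.
by move: (leq_trans H H'); rewrite addn1 ltnn.
Qed.

Lemma group_memberP gs s :
  group_member N (map plist gs) (plist s) = (s \in <<[set t in gs]>>).
Proof.
have [T [E1 E2 C]] := sgsP gs.
by rewrite /group_member E1 sift_member // E2 level0.
Qed.

Definition is_plist (w : seq nat) : bool := (size w == N) && all (fun j => j \in w) (iota 0 N).

Lemma is_plistP w : reflect (exists s, w = plist s) (is_plist w).
Proof.
apply: (iffP andP) => [[/eqP sw /allP H]|[s ->]]; last first.
  split; first by rewrite size_plist.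
  apply/allP => j; rewrite mem_iota /= => jN; apply/mapP.
  by exists (s^-1 (Ordinal jN)); rewrite ?mem_enum // permKV.
have sub : {subset iota 0 N <= w} by move=> j /H.
have [_ memw] : (N = size w) * (iota 0 N =i w).
  by have := uniq_min_size (iota_uniq 0 N) sub; rewrite size_iota sw leqnn => /(_ isT).
have uw : uniq w by apply: (leq_size_uniq (iota_uniq 0 N) sub); rewrite size_iota sw.
have lt (i : 'I_N) : nth 0 w i < N.
  by have : nth 0 w i \in iota 0 N; [rewrite memw mem_nth // sw | rewrite mem_iota].
have inj : injective (fun i : 'I_N => Ordinal (lt i)).
  by move=> i j [] /eqP; rewrite nth_uniq ?sw // => /eqP/val_inj.
exists (perm inj); apply: (eq_from_nth (x0 := 0)); rewrite ?size_plist // sw => i iN.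
by rewrite -[i]/(val (Ordinal iN)) nth_plist permE.
Qed.

End Sims.

(** * PLOM is in PLS *)

Lemma perm_codeE N (s : {perm 'I_N}) : perm_code s = unary_code (plist s).
Proof. by rewrite /unary_code -map_comp. Qed.

Lemma lex_le_cons a b v w :
  lex_le (a :: v) (b :: w) = if a == b then lex_le v w else b.
Proof. by rewrite /lex_le Order.SeqLexiOrder.lexi_cons; case: a; case: b. Qed.

Lemma lex_le_refl v : lex_le v v.
Proof. by elim: v => // b v IH; rewrite lex_le_cons eqxx. Qed.

Lemma binary_value_cons (b : bool) w :
  binary_value (b :: w) = b * 2 ^ size w + binary_value w.
Proof.
rewrite /binary_value /= add0n.
suff H n : foldl (fun n (c : bool) => n.*2 + c) n w
    = n * 2 ^ size w + foldl (fun n (c : bool) => n.*2 + c) 0 w by exact: H.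
elim: w n => [|c w IH] n /=; first by rewrite muln1 addn0.
by rewrite IH [in RHS]IH expnS; lia.
Qed.

Lemma binary_value_lt w : binary_value w < 2 ^ size w.
Proof. by elim: w => // b w IH; rewrite binary_value_cons /= expnS; case: b; lia. Qed.

Lemma lex_le_binary v w : size v = size w ->
  lex_le v w = (binary_value v <= binary_value w).
Proof.
elim: v w => [|a v IH] [|b w] //= [sE]; rewrite lex_le_cons !binary_value_cons sE.
have := binary_value_lt v; have := binary_value_lt w; rewrite sE.
by case: a; case: b => /= h1 h2; rewrite ?(IH _ sE); lia.
Qed.

Definition istr (I : seq bool) : seq bool := head [::] (words_decode I).
Definition igens (I : seq bool) : seq (seq nat) :=
  [seq unary_decode w | w <- behead (words_decode I)].

Lemma istrE P : istr (plom_code P) = [seq str P i | i <- enum 'I_(npos P)].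
Proof. by rewrite /istr words_codeK. Qed.

Lemma size_istr P : size (istr (plom_code P)) = npos P.
Proof. by rewrite istrE size_map size_enum_ord. Qed.

Lemma igensE P : igens (plom_code P) = map (@plist _) (gens P).
Proof.
rewrite /igens words_codeK /= -map_comp; apply: eq_map => s /=.
by rewrite perm_codeE unary_codeK.
Qed.

Lemma plom_feasibleP P x : feasible PLOM (plom_code P) x <->
  exists2 s : {perm 'I_(npos P)}, x = perm_code s & s \in plom_group P.
Proof.
split=> [[Q [s [/plom_code_inj E]]]|[s -> sG]]; last by exists P, s.
by case: Q / E s => s -> sG; exists s.
Qed.

(** Decoding is total and ignores a trailing block without its closing [false]; re-encoding excludes
    such words. *)
Definition plom_check (I x : seq bool) : bool :=
  [&& unary_code (unary_decode x) == x, is_plist (size (istr I)) (unary_decode x)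
    & group_member (size (istr I)) (igens I) (unary_decode x)].

Lemma plom_checkP P x : plom_check (plom_code P) x <-> feasible PLOM (plom_code P) x.
Proof.
rewrite plom_feasibleP /plom_check size_istr igensE; split.
  case/and3P=> /eqP xE /is_plistP[s sE]; rewrite sE group_memberP => sG.
  by exists s; rewrite // perm_codeE -sE xE.
case=> s -> sG; rewrite perm_codeE unary_codeK eqxx group_memberP; apply/and3P; split=> //.
by apply/is_plistP; exists s.
Qed.

Definition plom_start (I : seq bool) : seq bool := unary_code (iota 0 (size (istr I))).
Definition plom_nbhd (I x : seq bool) : seq (seq bool) :=
  [seq unary_code (pmul (unary_decode x) g) | g <- igens I].
Definition plom_cost (I x : seq bool) : seq bool :=
  [seq nth false (istr I) j | j <- unary_decode x].

Lemma plom_costE P (s : {perm 'I_(npos P)}) : plom_cost (plom_code P) (perm_code s) = view s.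
Proof.
rewrite /plom_cost perm_codeE unary_codeK istrE -map_comp; apply: eq_map => i /=.
by rewrite (nth_map (s i)) ?size_enum_ord // nth_ord_enum.
Qed.

Lemma PF_istr {E} {dE : data E} D (w : E -> seq bool) : PF D w -> PF D (fun e => istr (w e)).
Proof. by apply: PF_app => Q; rewrite /istr; pf. Qed.

Lemma PF_igens {E} {dE : data E} D (w : E -> seq bool) : PF D w -> PF D (fun e => igens (w e)).
Proof. by apply: PF_app => Q; rewrite /igens; pf. Qed.

Lemma PF_plom_check D : PF D (fun p : seq bool * seq bool => [:: plom_check p.1 p.2]).
Proof.
have PI : PF D (fun p : seq bool * seq bool => size (istr p.1)).
  exact: PF_size_seq (PF_istr (PF_fst0 _)).
have PU : PF D (fun p : seq bool * seq bool => unary_decode p.2) by pf.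
apply: PF_cons; last exact: PF_const.
apply: PF_and; first by apply: PF_eqw; pf.
apply: PF_and; last by apply: PF_group_member => //; exact: PF_igens (PF_fst0 _).
apply: PF_and; first by pf.
apply: PF_all; first by pf.
by apply: PF_memn; [exact: PF_snd0 | exact: PF_lift PU].
Qed.

Lemma PLOM_length : exists k, forall I x, feasible_pair PLOM I x -> size x <= size I ^ k + k.
Proof.
(* N values below N take at most N squared bits in unary, and N is at most the size of the instance,
   which contains the string. *)
exists 2 => _ x [[P ->] /plom_feasibleP[s -> _]].
have h1 : npos P <= size (plom_code P).
  rewrite /plom_code /words_code /= size_cat /word_code size_cat.
  rewrite -[X in X <= _](size_enum_ord (npos P)) -(size_map (str P)).
  set l := map _ _; set m := size (flatten (map word_code _)); clearbody l m.
  have : size l <= size (flatten [seq [:: true; b] | b <- l]) by elim: l => //= b l; lia.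
  by rewrite /=; lia.
rewrite perm_codeE.
have H l : all (fun j => j < npos P) l -> size (unary_code l) <= size l * npos P.
  rewrite /unary_code; elim: l => //= j l IH /andP[jl /IH {}IH].
  by rewrite size_cat size_rcons size_nseq mulSn leq_add.
have : all (fun j => j < npos P) (plist s) by apply/allP => _ /mapP[i _ ->]; exact: ltn_ord.
by move/H; rewrite size_plist; nia.
Qed.

Theorem PLOM_in_PLS : in_PLS PLOM.
Proof.
split; first exact: PLOM_length.
- exists plom_check; split; last by move=> _ x [P ->]; exact: plom_checkP.
  apply: (PF_polytime2 (f := fun I x => [:: plom_check I x])); exact: PF_plom_check.
- exists plom_start; split.
    apply: PF_polytime1; apply: (PF_app (h := plom_start) _ (PF_id _)) => Q.
    by rewrite /plom_start; pf; exact: PF_istr (PF_id _).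
  move=> _ [P ->]; apply/plom_feasibleP; exists 1%g; last exact: group1.
  by rewrite perm_codeE plist1 /plom_start size_istr.
- exists plom_nbhd; split.
    apply: PF_polytime2.
    have P Q : PF Q (fun p : seq bool * seq bool => words_code (plom_nbhd p.1 p.2) : seq bool).
      by rewrite /plom_nbhd; pf; apply: PF_igens; pf.
    exact: P.
  move=> _ x [[P ->] /plom_feasibleP[s -> sG]] y.
  have nE : plom_nbhd (plom_code P) (perm_code s) = [seq perm_code (pi * s)%g | pi <- gens P].
    rewrite /plom_nbhd igensE -map_comp; apply: eq_map => pi /=.
    by rewrite perm_codeE unary_codeK pmul_plist -perm_codeE.
  split; last first.
    case=> Q [t [pi [/plom_code_inj EQ]]]; case: Q / EQ t pi => t pi /perm_code_inj <- pig ->.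
    apply/plom_feasibleP; exists (pi * s)%g => //.
    by rewrite groupM // mem_gen // inE.
  rewrite nE; split=> [/mapP[pi pig ->]|]; first by exists P, s, pi.
  case=> Q [t [pi [/plom_code_inj EQ]]]; case: Q / EQ t pi => t pi /perm_code_inj <- pig ->.
  exact: map_f.
exists false, plom_cost; split.
  apply: PF_polytime2.
  have P Q : PF Q (fun p : seq bool * seq bool => plom_cost p.1 p.2).
    by rewrite /plom_cost; pf; apply: PF_istr; pf.
  exact: P.
move=> _ x y [P ->] /plom_feasibleP[s -> sG] /plom_feasibleP[t -> tG].
rewrite !plom_costE -lex_le_binary; last by rewrite !size_map.
split=> [[Q [s' [t' [/plom_code_inj EQ]]]]|H]; last by exists P, s, t.
by case: Q / EQ s' t' => s' t' /perm_code_inj <- /perm_code_inj <-.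
Qed.

Lemma in_PLS_restrict L D : in_PLS L -> in_PLS (restrict L D).
Proof.
case=> [[k Hk]] [chi [Pchi Hchi]] [st [Pst Hst]] [nb [Pnb Hnb]] [mx [co [Pco Hco]]].
have sub1 (D1 D2 : word -> Prop) f : (forall x, D1 x -> D2 x) -> polytime1 D2 f -> polytime1 D1 f.
  by move=> s [p [j H]]; exists p, j => _ [x Dx ->]; apply: H; exists x => //; exact: s.
have sub2 (D1 D2 : word -> word -> Prop) f : (forall x y, D1 x y -> D2 x y) ->
    polytime2 D2 f -> polytime2 D1 f.
  by move=> s [p [j H]]; exists p, j => _ [x [y [Dx ->]]]; apply: H; exists x, y; split=> //; exact: s.
split.
- by exists k => I x [[iI _] fx]; exact: Hk.
- exists chi; split; first by apply: sub2 Pchi => I x [].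
  by move=> I x [iI _]; exact: Hchi.
- exists st; split; first by apply: sub1 Pst => I [].
  by move=> I [iI _]; exact: Hst.
- exists nb; split; first by apply: sub2 Pnb => I x [[iI _] fx].
  by move=> I x [[iI _] fx] y; exact: Hnb.
- exists mx, co; split; first by apply: sub2 Pco => I x [[iI _] fx].
  by move=> I x y [iI _]; exact: Hco.
Qed.

(** * Many small primes *)

Lemma central_bin_ge n : 2 ^ n <= 'C(2 * n, n).
Proof.
elim: n => // n IH; rewrite expnS (_ : 2 * n.+1 = (2 * n).+2); last lia.
have h1 : 'C(2 * n, n) <= 'C((2 * n).+1, n.+1) by rewrite binS leq_addl.
have h2 : 'C(2 * n, n) <= 'C((2 * n).+1, n).
  by case: n {IH h1} => [|n]; rewrite ?bin0 // [X in _ <= X]binS leq_addr.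
by rewrite binS; lia.
Qed.

(** Legendre's formula: the exponent of p is the sum over k of the differences between the quotient
    of 2n by [p ^ k] and twice that of n. Each difference is at most 1, and it vanishes once [p ^ k]
    exceeds 2n. *)
Lemma prime_power_central_bin p n : prime p -> 0 < n ->
  p ^ logn p 'C(2 * n, n) <= 2 * n.
Proof.
move=> pr n0; have le : n <= 2 * n by lia.
have p1 := prime_gt1 pr; set T := trunc_log p (2 * n).
suff H : logn p 'C(2 * n, n) <= T.
  by apply: leq_trans (trunc_logP p1 _); rewrite ?leq_exp2l //; lia.
have := bin_fact le; rewrite (_ : 2 * n - n = n); last lia.
move/(congr1 (logn p)); rewrite !lognM ?fact_gt0 ?bin_gt0 ?muln_gt0 ?fact_gt0 // !logn_fact //.
have -> : \sum_(1 <= k < n.+1) n %/ p ^ k = \sum_(1 <= k < (2 * n).+1) n %/ p ^ k.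
  have l2 : n.+1 <= (2 * n).+1 by lia.
  rewrite [RHS](big_cat_nat _ l2) //=.
  rewrite [X in _ = _ + X]big_nat [X in _ = _ + X]big1 ?addn0 // => k /andP[kn _].
  by apply: divn_small; apply: leq_trans kn _; apply: ltnW; exact: ltn_expl.
move=> E.
have H : \sum_(1 <= k < (2 * n).+1) (2 * n) %/ p ^ k <=
    \sum_(1 <= k < (2 * n).+1) (n %/ p ^ k + n %/ p ^ k + (k <= T)).
  rewrite big_nat [X in _ <= X]big_nat; apply: leq_sum => k /andP[k0 _].
  have q0 : 0 < p ^ k by rewrite expn_gt0; lia.
  case: (leqP k T) => kT.
    rewrite addn1 -ltnS ltn_divLR //.
    move: (divn_eq n (p ^ k)) (ltn_pmod n q0); rewrite !mulSn mulnDl.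
    by move: (n %/ _ * _) (n %% _) => d r; lia.
  rewrite divn_small //.
  by apply: leq_trans (trunc_log_ltn (2 * n) p1) _; rewrite leq_exp2l.
have S : \sum_(1 <= k < (2 * n).+1) (k <= T : nat) <= T.
  rewrite -big_mkcond /= sum1_count /index_iota.
  rewrite -size_filter -[X in _ <= X](size_iota 1); apply: uniq_leq_size.
    by rewrite filter_uniq // iota_uniq.
  by move=> k; rewrite mem_filter !mem_iota => /andP[kT /andP[k0 _]]; lia.
by move: H; rewrite !big_split /=; lia.
Qed.

Definition primes_upto (n : nat) := [seq p <- iota 0 n.+1 | prime p].

(** Chebyshev's argument. With n = 4 m^2, [2 ^ n] is at most the central binomial coefficient, a
    product of prime powers that are at most 2n, one for each prime dividing it. Fewer than m primes
    would give [2 ^ n <= (2 * n) ^ m < 2 ^ (4 * m * m)], but the outer terms are equal. *)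
Lemma size_primes_upto m : 0 < m -> m <= size (primes_upto (8 * (m * m))).
Proof.
move=> m0; set n := 4 * (m * m); have n0 : 0 < n by rewrite /n; nia.
have -> : 8 * (m * m) = 2 * n by rewrite /n; lia.
rewrite leqNgt; apply/negP => lt.
have C0 : 0 < 'C(2 * n, n) by rewrite bin_gt0; lia.
have sub : size (primes 'C(2 * n, n)) <= size (primes_upto (2 * n)).
  apply: uniq_leq_size (primes_uniq _) _ => p pC.
  have := pC; rewrite mem_primes => /and3P[pr _ _].
  rewrite mem_filter pr mem_iota /= add0n ltnS.
  apply: leq_trans (prime_power_central_bin pr n0).
  by rewrite -{1}(expn1 p) leq_exp2l ?prime_gt1 // logn_gt0.
have H : 2 ^ n <= (2 * n) ^ size (primes_upto (2 * n)).
  apply: leq_trans (central_bin_ge n) _.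
  apply: (@leq_trans ((2 * n) ^ size (primes 'C(2 * n, n)))); last by rewrite leq_pexp2l //; lia.
  rewrite {1}(prod_prime_decomp C0) prime_decompE big_map /=.
  have : all prime (primes 'C(2 * n, n)) by apply/allP => p; rewrite mem_primes => /and3P[].
  elim: (primes _) => [|p ps IH]; first by rewrite big_nil.
  move=> /= /andP[pr /IH {}IH]; rewrite big_cons expnS leq_mul //.
  exact: prime_power_central_bin.
have m4 k : 0 < k -> 4 * k <= 4 ^ k by elim: k => // -[|k] // IH _; rewrite expnS; have := IH isT; lia.
have H2 : 2 * n < 2 ^ (4 * m).
  have -> : 2 ^ (4 * m) = 4 ^ m * 4 ^ m by rewrite -expnMn expnM.
  by have := leq_mul (m4 m m0) (m4 m m0); rewrite /n; nia.
have : (2 * n) ^ size (primes_upto (2 * n)) <= (2 * n) ^ m by rewrite leq_pexp2l //; lia.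
have : (2 * n) ^ m < (2 ^ (4 * m)) ^ m by rewrite ltn_exp2r.
rewrite -expnM (_ : 4 * m * m = n); last by rewrite /n; lia.
by lia.
Qed.

Lemma chinese_seq (ps : seq nat) (v : nat -> nat) : uniq ps -> all prime ps ->
  exists e, forall p, p \in ps -> e = v p %[mod p].
Proof.
move=> ups pps.
suff [e [He _]] : exists e, (forall p, p \in ps -> e = v p %[mod p]) /\ True by exists e.
have cop (qs : seq nat) p : prime p -> all prime qs -> p \notin qs -> coprime p (\prod_(q <- qs) q).
  move=> pp; elim: qs => [|q qs IH] /=; first by rewrite big_nil coprimen1.
  rewrite inE negb_or => /andP[pq pqs] /andP[npq nqs].
  by rewrite big_cons coprimeMr IH // andbT prime_coprime // dvdn_prime2.
elim: ps ups pps => [|p ps IH] /=; first by exists 0.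
move=> /andP[np ups] /andP[pp pps]; have [e [He _]] := IH ups pps.
have C := cop _ _ pp pps np.
exists (chinese p (\prod_(q <- ps) q) (v p) e); split=> // q; rewrite inE => /orP[/eqP->|qps].
  exact: chinese_modl.
rewrite -He //; have dv : q %| \prod_(q <- ps) q by rewrite (big_rem q) //= dvdn_mulr.
by rewrite -(modn_dvdm _ dv) chinese_modr // modn_dvdm.
Qed.

(** * Lexicographic local search over residues as an instance of PLOM *)

Section Digits.
Variable M : nat.

Definition dig (o k : nat) : nat := (o %/ M ^ k) %% M.

Fixpoint undig (a : nat) (g : nat -> nat) : nat :=
  if a is a'.+1 then g 0 + M * undig a' (fun k => g k.+1) else 0.

Lemma eq_undig a g g' : (forall k, k < a -> g k = g' k) -> undig a g = undig a g'.
Proof.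
elim: a g g' => //= a IH g g' E; rewrite E // (IH _ (fun k => g' k.+1)) // => k ka.
exact: E.
Qed.

Hypothesis M0 : 0 < M.

Lemma undig_lt a g : (forall k, k < a -> g k < M) -> undig a g < M ^ a.
Proof.
elim: a g => //= a IH g H; have h0 := H 0 isT; have := IH _ (fun k ka => H k.+1 ka).
by rewrite expnS; nia.
Qed.

Lemma dig_undig a g k : (forall j, j < a -> g j < M) -> k < a -> dig (undig a g) k = g k.
Proof.
elim: a g k => // a IH g [|k] H ka; rewrite /dig /=.
  by rewrite expn0 divn1 addnC mulnC modnMDl modn_small // H.
rewrite expnS divnMA addnC mulnC divnMDl // [g 0 %/ M]divn_small ?addn0 ?H //.
by apply: (IH (fun k => g k.+1)) => // j ja; exact: H.
Qed.

Lemma undig_dig a o : o < M ^ a -> undig a (dig o) = o.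
Proof.
elim: a o => [|a IH] o; first by case: o.
rewrite expnS => lt /=; rewrite {1}/dig expn0 divn1.
rewrite (@eq_undig a _ (dig (o %/ M))); last by move=> k _; rewrite /dig expnS divnMA.
rewrite IH; last by rewrite ltn_divLR // mulnC.
by rewrite addnC mulnC -divn_eq.
Qed.

Lemma dig_lt o k : dig o k < M.
Proof. exact: ltn_pmod. Qed.

Lemma dig0 k : dig 0 k = 0.
Proof. by rewrite /dig div0n mod0n. Qed.

End Digits.

(* Block [r] has [a] variables [vars r 0, ..., vars r (a - 1)].  A position is
   [o * B + r] where the base-[M] digits of [o] are values of the variables of
   block [r]; the position of value 0 is thus [r] itself. *)
Section Residues.
Variables (M B a : nat) (pr : nat -> nat) (vars : nat -> nat -> nat)
  (Fn : nat -> seq nat -> bool).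

(** One base M serves digits with different moduli; a digit not below its modulus encodes no value
    and stays fixed, which keeps the map bijective. *)
Definition shd (u : nat -> nat) (v d : nat) : nat :=
  if d < pr v then (d + u v) %% pr v else d.

Definition shift (u : nat -> nat) (i : nat) : nat :=
  undig M a (fun k => shd u (vars (i %% B) k) (dig M (i %/ B) k)) * B + i %% B.

Definition bits (x : nat -> nat) : seq bool :=
  [seq Fn r [seq x (vars r k) | k <- iota 0 a] | r <- iota 0 B].

Definition pos_bit (i : nat) : bool := Fn (i %% B) [seq dig M (i %/ B) k | k <- iota 0 a].

Hypotheses (M0 : 0 < M) (prM : forall v, 0 < pr v <= M).

Lemma shd_lt u v d : d < M -> shd u v d < M.
Proof.
rewrite /shd; have /andP[p0 pM] := prM v; case: ifP => // _ _.
exact: leq_trans (ltn_pmod _ p0) pM.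
Qed.

Notation N := (M ^ a * B).

Lemma shift_lt u i : i < N -> shift u i < N.
Proof.
case: (posnP B) => [->|B0] lt; first by rewrite muln0 in lt.
have h : undig M a (fun k => shd u (vars (i %% B) k) (dig M (i %/ B) k)) < M ^ a.
  by apply: undig_lt => // k _; apply: shd_lt; exact: dig_lt.
have := ltn_pmod i B0; rewrite /shift; nia.
Qed.

Lemma shift_comp u v i : i < N -> shift u (shift v i) = shift (fun x => v x + u x) i.
Proof.
case: (posnP B) => [->|B0] lt; first by rewrite muln0 in lt.
have m : shift v i %% B = i %% B by rewrite /shift modnMDl modn_mod.
rewrite [LHS]/shift m /shift; congr (_ * B + _); rewrite divnMDl // [(i %% B) %/ B]divn_small ?ltn_pmod // addn0.
apply: eq_undig => k ka; rewrite dig_undig //; last by move=> j _; apply: shd_lt; exact: dig_lt.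
have /andP[p0 _] := prM (vars (i %% B) k).
rewrite /shd; case: (boolP (dig M (i %/ B) k < pr (vars (i %% B) k))) => [_|/negPf->] //.
by rewrite ltn_pmod // modnDml addnA.
Qed.

Lemma shift_ext u v i : (forall x, u x = v x %[mod pr x]) -> shift u i = shift v i.
Proof.
move=> E; rewrite /shift; congr (_ * B + _); apply: eq_undig => k _.
by rewrite /shd; case: ifP => // _; rewrite -modnDmr E modnDmr.
Qed.

Lemma shift0 u i : i < N -> (forall x, u x = 0 %[mod pr x]) -> shift u i = i.
Proof.
move=> lt E; rewrite (shift_ext _ (v := fun _ => 0)) // /shift.
rewrite (@eq_undig _ _ _ (dig M (i %/ B))); last first.
  by move=> k _; rewrite /shd; case: ifP => // h; rewrite addn0 modn_small.
by rewrite undig_dig // ?ltn_divLR -?divn_eq //; case: (posnP B) lt => // ->; rewrite muln0.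
Qed.

Definition oshift u (i : 'I_N) : 'I_N := Ordinal (shift_lt u (ltn_ord i)).

Lemma oshift_inj u : injective (oshift u).
Proof.
(* The inverse translation within the natural numbers: [pr x * u x - u x] is congruent to the
   negative of [u x]. *)
apply: (can_inj (g := oshift (fun x => pr x * u x - u x))) => i.
apply: val_inj; rewrite /= shift_comp // shift0 // => x.
have /andP[p0 _] := prM x.
rewrite subnKC; last by rewrite leq_pmull.
by rewrite modnMr mod0n.
Qed.

Definition pshift u : {perm 'I_N} := perm (@oshift_inj u).

Lemma pshiftE u (i : 'I_N) : val (pshift u i) = shift u i.
Proof. by rewrite permE. Qed.

Lemma plist_pshift u : plist (pshift u) = [seq shift u i | i <- iota 0 N].
Proof. by rewrite -val_enum_ord -map_comp; apply: eq_map => i /=; rewrite pshiftE. Qed.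

Lemma pshiftM u v : (pshift u * pshift v)%g = pshift (fun x => u x + v x).
Proof. by apply/permP => i; apply: val_inj; rewrite permM !pshiftE shift_comp. Qed.

Lemma pshift_ext u v : (forall x, u x = v x %[mod pr x]) -> pshift u = pshift v.
Proof. by move=> E; apply/permP => i; apply: val_inj; rewrite !pshiftE; exact: shift_ext. Qed.

Lemma pshiftX e : (pshift (fun _ => 1%N) ^+ e)%g = pshift (fun _ => e).
Proof.
elim: e => [|e IH]; last by rewrite expgS IH pshiftM.
by apply/permP => i; apply: val_inj; rewrite perm1 pshiftE shift0.
Qed.

Variables (U : Type) (sh : U -> nat -> nat) (us : seq U).

Definition residue_plom : plom :=
  @Plom N [seq pshift (sh u) | u <- us] [ffun i : 'I_N => pos_bit i].

Hypothesis CRT : forall u : nat -> nat, exists e, forall v, e = u v %[mod pr v].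

Lemma residue_powers : powers_of_one residue_plom.
Proof.
exists (pshift (fun _ => 1%N)).
have H u : exists e, pshift u = (pshift (fun _ => 1%N) ^+ e)%g.
  by have [e He] := CRT u; exists e; rewrite pshiftX; apply: pshift_ext => v; rewrite -He.
rewrite /=; elim: us => [|u l [es E]]; first by exists [::].
by have [e He] := H (sh u); exists (e :: es); rewrite /= He E.
Qed.

(** A solution is thus described by one number e, and the state it encodes is the family of residues
    of e. *)
Lemma residue_group s : s \in plom_group residue_plom -> exists e, s = pshift (fun _ => e).
Proof.
have [pi [es E]] := residue_powers.
move=> sG; have : s \in <[pshift (fun _ => 1%N)]>%g.
  move: s sG; apply/subsetP; rewrite gen_subG; apply/subsetP => t; rewrite inE /=.
  suff : {subset [seq pshift (sh u) | u <- us] <= <[pshift (fun _ => 1%N)]>%g} by apply.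
  elim: us => // u l IH s; rewrite inE => /orP[/eqP->|/IH //].
  have [e He] := CRT (sh u).
  have -> : pshift (sh u) = (pshift (fun _ => 1%N) ^+ e)%g.
    by rewrite pshiftX; apply: pshift_ext => v; rewrite He.
  exact: mem_cycle.
by case/cycleP=> e ->; exists e; rewrite pshiftX.
Qed.

Lemma dig_shift w r k : r < B -> k < a ->
  dig M (shift w r %/ B) k = w (vars r k) %% pr (vars r k).
Proof.
move=> rB ka; have B0 : 0 < B by exact: leq_ltn_trans rB.
rewrite /shift modn_small // divnMDl // !divn_small // addn0.
rewrite dig_undig //; last by move=> j _; apply: shd_lt; exact: dig_lt.
by rewrite /shd dig0 add0n; have /andP[-> _] := prM (vars r k).
Qed.

(** The first B positions have all digits 0, so a translation takes them to the positions that
    encode its own residues. *)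
Lemma take_view w : 0 < a -> take B (@view residue_plom (pshift w)) = bits (fun v => w v %% pr v).
Proof.
move=> a0; have B_N : B <= N by rewrite leq_pmull // expn_gt0 M0.
have -> : @view residue_plom (pshift w) = [seq pos_bit (shift w i) | i <- iota 0 N].
  by rewrite /view -val_enum_ord -map_comp; apply: eq_map => i /=; rewrite ffunE pshiftE.
rewrite -map_take take_iota (minn_idPl B_N).
apply/eq_in_map => r; rewrite mem_iota add0n => /andP[_ rB].
rewrite /pos_bit {1}/shift modnMDl modn_mod modn_small //.
congr Fn; apply/eq_in_map => k; rewrite mem_iota add0n => /andP[_ ka].
exact: dig_shift.
Qed.

Lemma lex_le_take n v w : lex_le v w -> lex_le (take n v) (take n w).
Proof.
elim: v w n => [|x v IH] [|y w] [|n] //; rewrite ?take0 //= ?lex_le_cons //.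
by case: eqP => // _; exact: IH.
Qed.

(** Only the first B bits are kept, as the lexicographic order passes to prefixes. The generator is
    given by a splitting of [us] because [U] carries no equality test. *)
Lemma residue_local_opt y : 0 < a -> local_opt PLOM (plom_code residue_plom) y ->
  exists e, y = perm_code (pshift (fun _ => e)) /\
    forall (u : U) (us' us'' : seq U), us = us' ++ u :: us'' ->
      lex_le (bits (fun v => e %% pr v)) (bits (fun v => (sh u v + e) %% pr v)).
Proof.
move=> a0 H; have [/plom_feasibleP[s ys sG] _] := H.
have [e se] := residue_group sG; subst s; exists e; split=> // u us' us'' E.
rewrite ys in H; have [_ /(_ (pshift (sh u)))] := (@PLOM_local_optP residue_plom _).1 H.
have -> : pshift (sh u) \in gens residue_plom by rewrite /= E map_cat mem_cat inE eqxx orbT.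
move=> /(_ isT) /(lex_le_take B); rewrite (take_view (fun _ => e) a0).
have -> : [seq str residue_plom (pshift (fun _ => e) (pshift (sh u) i)) | i <- enum 'I_(npos residue_plom)]
    = @view residue_plom (pshift (fun v => sh u v + e)).
  by rewrite -pshiftM; apply: eq_map => i; rewrite permM.
by rewrite take_view.
Qed.

End Residues.

(** * Two alternating clocked circuits *)

Lemma lex_le_cat p v w : lex_le (p ++ v) (p ++ w) = lex_le v w.
Proof. by elim: p => //= b p IH; rewrite lex_le_cons eqxx. Qed.

Lemma lex_le_map_drop (f g : nat -> bool) n r : r < n -> (forall q, q < r -> f q = g q) ->
  f r -> ~~ g r -> lex_le (map f (iota 0 n)) (map g (iota 0 n)) = false.
Proof.
move=> rn E fr gr; rewrite -(subnKC rn) iotaD -addn1 iotaD !map_cat -!catA add0n.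
have -> : map f (iota 0 r) = map g (iota 0 r).
  by apply/eq_in_map => q; rewrite mem_iota add0n => /andP[_ /E].
by rewrite lex_le_cat /= lex_le_cons fr (negPf gr).
Qed.

(* Variable 0 is the clock; its value encodes the half [h] (the side whose cost is
   read) and the time [t <= G] (the number of gates of the other side that are
   already recomputed).  Gates [i < W] are the inputs of a side, copied from the
   gates [oin i] of the other side. *)
Section Clocked.
Variables (G W c K : nat) (gin : nat -> nat -> nat) (oin cout : nat -> nat)
  (gf : nat -> seq nat -> nat) (cbit : nat -> bool).

Definition wvar (s : bool) (i : nat) : nat := 1 + s * G + i.
Definition src (s : bool) (i k : nat) : nat :=
  if i < W then wvar (~~ s) (oin i) else wvar s (gin i k).
Definition half (x : nat) : bool := odd (x %/ G.+1).
Definition time (x : nat) : nat := x %% G.+1.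

(** Each half owns 2G gate blocks, those of the side that is read before those of the other, both in
    gate order. Within a half every active gate thus comes after the gates it depends on. *)
Definition bhalf (r : nat) : bool := odd (r %/ (2 * G)).
Definition bside (r : nat) : bool := bhalf r (+) (G <= r %% (2 * G)).
Definition bgate (r : nat) : nat := r %% (2 * G) %% G.

(** Slots of a gate block: the clock, the gate itself, its four inputs. A cost block has the clock
    and the same output of both sides, between which the clock selects. *)
Definition cvars (r k : nat) : nat :=
  if r < 4 * G then
    if k == 0 then 0 else if k == 1 then wvar (bside r) (bgate r)
    else src (bside r) (bgate r) (k - 2)
  else if r < 4 * G + c then
    if k == 1 then wvar false (cout (r - 4 * G))
    else if k == 2 then wvar true (cout (r - 4 * G)) else 0
  else 0.

(** On the side that is read the inputs are free, for they hold the current solution; on the other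
    side a gate counts once the clock has passed it. The last G bits are the time in unary, falling
    lexicographically as time grows. *)
Definition cfn (r : nat) (vs : seq nat) : bool :=
  if r < 4 * G then
    (half (nth 0 vs 0) == bhalf r) &&
    ((if bside r == bhalf r then W <= bgate r else bgate r < time (nth 0 vs 0)) &&
     ~~ (nth 0 vs 1 == gf (bgate r) (drop 2 vs)))
  else if r < 4 * G + c then cbit (nth 0 vs (half (nth 0 vs 0)).+1)
  else time (nth 0 vs 0) <= r - (4 * G + c).

Definition inputs s i (x : nat -> nat) : seq nat := [seq x (src s i k) | k <- iota 0 4].

Definition viol (x : nat -> nat) (h s : bool) (i : nat) : bool :=
  (half (x 0) == h) && ((if s == h then W <= i else i < time (x 0)) &&
    ~~ (x (wvar s i) == gf i (inputs s i x))).

Definition nblocks := 4 * G + (c + G).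
Notation bitsx := (bits nblocks 6 cvars cfn).
Definition bit (x : nat -> nat) (r : nat) : bool := cfn r [seq x (cvars r k) | k <- iota 0 6].

Lemma bit_viol x r : r < 4 * G -> bit x r = viol x (bhalf r) (bside r) (bgate r).
Proof. by move=> lt; rewrite /bit /cfn /cvars lt. Qed.

Lemma bit_cost x j : j < c -> bit x (4 * G + j) = cbit (x (wvar (half (x 0)) (cout j))).
Proof.
move=> lt; rewrite /bit /cfn /cvars (ltnNge _ (4 * G)) leq_addr /= ltn_add2l lt addKn.
by case: (half _).
Qed.

Lemma bit_time x j : bit x (4 * G + c + j) = (time (x 0) <= j).
Proof.
rewrite /bit /cfn /cvars (ltnNge _ (4 * G)) -addnA leq_addr /= addnA.
by rewrite (ltnNge _ (4 * G + c)) leq_addr /= addKn.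
Qed.

Hypotheses (G0 : 0 < G)
  (gin_lt : forall i k, W <= i -> i < G -> gin i k < i)
  (oin_lt : forall i, oin i < G) (cout_lt : forall j, cout j < G)
  (gf_lt : forall i vs, gf i vs < K).

Lemma bgate_lt r : bgate r < G.
Proof. exact: ltn_pmod. Qed.

Lemma eq_wvar s i s' i' : i < G -> i' < G -> (wvar s i == wvar s' i') = (s == s') && (i == i').
Proof. by rewrite /wvar => h h'; apply/eqP/andP => [|[/eqP-> /eqP->]] //; case: s; case: s' => /=; lia. Qed.

Lemma block_index h s i : i < G ->
  exists2 r, r < 4 * G & [/\ bhalf r = h, bside r = s & bgate r = i].
Proof.
move=> iG; exists (h * (2 * G) + ((s (+) h) * G + i)).
  by case: h; case: s => /=; lia.
have lt : (s (+) h) * G + i < 2 * G by case: (s (+) h); lia.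
have E1 : bhalf (h * (2 * G) + ((s (+) h) * G + i)) = h.
  by rewrite /bhalf divnMDl ?(divn_small lt); [rewrite addn0; case: (h) | lia].
split=> //; last by rewrite /bgate modnMDl (modn_small lt) modnMDl modn_small.
rewrite /bside E1 modnMDl modn_small //.
have -> : (G <= (s (+) h) * G + i) = s (+) h by case: (s (+) h) => /=; lia.
by case: h {E1 lt}; case: s.
Qed.

Lemma block_order q r : q < r -> r < 4 * G -> bhalf q = bhalf r ->
  (bside q = bside r /\ bgate q < bgate r) \/ (bside q = bhalf r /\ bside r = ~~ bhalf r).
Proof.
move=> qr r4 E.
have G2 : 0 < 2 * G by lia.
have d2 x : x < 4 * G -> x %/ (2 * G) < 2 by move=> lt; rewrite ltn_divLR //; lia.
have dE : q %/ (2 * G) = r %/ (2 * G).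
  move: E (d2 q (ltn_trans qr r4)) (d2 r r4); rewrite /bhalf.
  by move: (q %/ _) (r %/ _) => [|[|a]] [|[|b]].
have lt : q %% (2 * G) < r %% (2 * G).
  by move: qr; rewrite {1}(divn_eq q (2 * G)) {1}(divn_eq r (2 * G)) dE ltn_add2l.
have mq := ltn_pmod q G2; have mr := ltn_pmod r G2.
rewrite /bside /bgate E; move: (q %% _) (r %% _) lt mq mr => a b lt mq mr.
have modG x : G <= x -> x < 2 * G -> x %% G = x - G.
  by move=> le lx; rewrite -{1}(subnK le) modnDr modn_small //; lia.
case: (leqP G a) => ga; case: (leqP G b) => gb; rewrite ?addbT ?addbF.
- by left; rewrite !modG //; lia.
- lia.
- by right.
- by left; rewrite !modn_small.
Qed.

Definition upd (x : nat -> nat) (a v b : nat) : nat -> nat :=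
  fun u => if u == 0 then a else if u == v then b else x u.

Lemma upd_wvar x a s i b s' i' : i < G -> i' < G ->
  upd x a (wvar s i) b (wvar s' i') = if (s' == s) && (i' == i) then b else x (wvar s' i').
Proof. by move=> h h'; rewrite /upd eq_wvar. Qed.

(** An input gate reads the opposite side, any other gate reads earlier gates of its own side; the
    condition ensures that the changed gate is not among those read. *)
Lemma upd_src x a s i b s' i' k : i < G -> i' < G ->
  (if i' < W then s' != ~~ s else (s' == s) ==> (i' <= i)) ->
  upd x a (wvar s i) b (src s' i' k) = x (src s' i' k).
Proof.
move=> iG iG'; rewrite /src; case: ltnP => iW H.
  rewrite upd_wvar //; case: eqP => //= E; by move: H; rewrite -E negbK eqxx.
have gk := gin_lt k iW iG'; have gG := ltn_trans gk iG'.
rewrite upd_wvar //; case: (s' == s) H => //= H.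
by case: eqP => // E; move: H; lia.
Qed.

Lemma viol_upd x x' h s i : half (x' 0) = half (x 0) ->
  x' (wvar s i) = x (wvar s i) -> (forall k, x' (src s i k) = x (src s i k)) ->
  (half (x 0) = h -> s != h -> (i < time (x' 0)) = (i < time (x 0))) ->
  viol x' h s i = viol x h s i.
Proof.
move=> E1 E2 E3 E4; rewrite /viol E1 E2; case: eqP => //= hE.
have -> : inputs s i x' = inputs s i x by apply/eq_map.
by case: eqP => // /eqP ne; rewrite E4.
Qed.

Definition clk (h : bool) (t : nat) : nat := h * G.+1 + t.

Lemma half_clk h t : t <= G -> half (clk h t) = h.
Proof. by move=> le; rewrite /half /clk divnMDl // divn_small // addn0; case: h. Qed.

Lemma time_clk h t : t <= G -> time (clk h t) = t.
Proof. by move=> le; rewrite /time /clk modnMDl modn_small. Qed.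

Lemma clk_lt h t : t <= G -> clk h t < 2 * G.+1.
Proof. by rewrite /clk; case: h => /=; lia. Qed.

Lemma time_le x : time x <= G.
Proof. by rewrite -ltnS ltn_pmod. Qed.

Variable x : nat -> nat.
Hypothesis xmin : forall a v b, a < 2 * G.+1 -> 0 < v <= 2 * G -> b < K ->
  lex_le (bitsx x) (bitsx (upd x a v b)).

Let h := half (x 0).
Let t := time (x 0).

Lemma wvar_range s i : i < G -> 0 < wvar s i <= 2 * G.
Proof. by rewrite /wvar; case: s => /=; lia. Qed.

Lemma no_drop a s i b r : a < 2 * G.+1 -> i < G -> b < K -> r < nblocks ->
  (forall q, q < r -> bit x q = bit (upd x a (wvar s i) b) q) ->
  bit x r -> ~~ bit (upd x a (wvar s i) b) r -> False.
Proof.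
move=> aG iG bK rn E xr xr'.
have := xmin aG (wvar_range s iG) bK.
by rewrite /bits (lex_le_map_drop rn E xr xr').
Qed.

(** Repair the first violated block and set the clock to the canonical value with the same half and
    time. Earlier active blocks do not involve the repaired gate, so the first changed bit falls
    from 1 to 0; gates violated by the repair are less significant. *)
Lemma all_valid r : r < 4 * G -> bit x r = false.
Proof.
move=> r4; apply/negbTE/negP => xr.
have ex : exists r, (r < 4 * G) && bit x r by exists r; rewrite r4.
case: (ex_minnP ex) => {r4 xr} r /andP[r4 xr] rmin.
have := xr; rewrite bit_viol // => /and3P[/eqP hr act ne].
have iG := bgate_lt r; set s := bside r in act ne *; set i := bgate r in iG act ne *.
have E0 : upd x (clk h t) (wvar s i) (gf i (inputs s i x)) 0 = clk h t by [].
set x' := upd _ _ _ _ in E0; have hE : half (x' 0) = half (x 0) by rewrite E0 half_clk ?time_le.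
have tE : time (x' 0) = time (x 0) by rewrite E0 time_clk ?time_le.
have act' : if i < W then s != h else true.
  by rewrite -hr -/h in act; case: ltnP => // iW; apply: contraTN act => ->; rewrite -ltnNge.
have srcE k : x' (src s i k) = x (src s i k).
  apply: upd_src => //; case: ifP => _; last by rewrite eqxx leqnn.
  by case: (s).
apply: (@no_drop (clk h t) s i (gf i (inputs s i x)) r) => //.
- by apply: clk_lt; exact: time_le.
- by rewrite /nblocks; lia.
- move=> q qr; have q4 := ltn_trans qr r4.
  have xq : bit x q = false.
    by apply/negbTE/negP => xq; have := rmin q; rewrite q4 xq => /(_ isT); lia.
  rewrite xq; rewrite bit_viol // in xq; rewrite bit_viol //; apply/esym.
  have jG := bgate_lt q.
  case: (eqVneq (bhalf q) h) => [hq|]; last by rewrite /viol hE -/h eq_sym => /negPf ->.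
  case: (leqP W (bgate q)) => [Wq|qW].
    rewrite -[RHS]xq; apply: viol_upd => //; last by rewrite tE.
      rewrite upd_wvar //; case: (block_order qr r4 _) => [|[-> lt]|[-> E2]].
      + by rewrite hq.
      + by rewrite andbC; case: eqP lt => // ->; rewrite ltnn.
      + by rewrite /s E2; case: (bhalf r).
    move=> k; apply: upd_src; rewrite // ltnNge Wq /=.
    case: (block_order qr r4 _) => [|[-> lt]|[-> E2]]; first by rewrite hq.
      by rewrite eqxx ltnW.
    by rewrite /s E2; case: (bhalf r).
  case: (eqVneq (bside q) (bhalf q)) => sq; first by rewrite /viol sq eqxx leqNgt qW /= andbF.
  rewrite -[RHS]xq; case: (block_order qr r4 _) => [|[sE lt]|[sE _]].
  + by rewrite hq.
  + apply: viol_upd => //; last by rewrite tE.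
      by rewrite upd_wvar // andbC; case: eqP lt => // ->; rewrite ltnn.
    by move=> k; apply: upd_src; rewrite // qW sE -/s; case: (s).
  + by move: sq; rewrite sE hq -hr eqxx.
- rewrite bit_viol // /viol -/s -/i /x' upd_wvar // !eqxx /= -/x'.
  have -> : inputs s i x' = inputs s i x by apply/eq_map.
  by rewrite eqxx !andbF.
Qed.

Lemma valid_gate s i : i < G -> (if s == h then W <= i else i < t) ->
  x (wvar s i) = gf i (inputs s i x).
Proof.
move=> iG act; have [r r4 [hr sr ir]] := @block_index h s i iG.
have := all_valid r4; rewrite bit_viol // hr sr ir /viol eqxx /= act /=.
by move/negbT; rewrite negbK => /eqP.
Qed.

(** Otherwise advance the clock and in the same move give gate t of the other side its correct
    value: no gate becomes violated, the cost that is read is untouched, and the first changed bit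
    is clock bit t, which falls. *)
Lemma time_end : t = G.
Proof.
apply/eqP; rewrite eqn_leq time_le leqNgt /=; apply/negP => tG.
set s := ~~ h; set b := gf t (inputs s t x).
have E0 : upd x (clk h t.+1) (wvar s t) b 0 = clk h t.+1 by [].
set x' := upd _ _ _ _ in E0; have hE : half (x' 0) = half (x 0) by rewrite E0 half_clk.
have tE : time (x' 0) = t.+1 by rewrite E0 time_clk.
apply: (@no_drop (clk h t.+1) s t b (4 * G + c + t)) => //.
- exact: clk_lt.
- exact: gf_lt.
- by rewrite /nblocks; lia.
- move=> q lt; case: (ltnP q (4 * G)) => q4.
    have xq := all_valid q4; rewrite xq; apply/esym; rewrite bit_viol // in xq; rewrite bit_viol //.
    have jG := bgate_lt q.
    case: (eqVneq (bhalf q) h) => [hq|]; last by rewrite /viol hE -/h eq_sym => /negPf ->.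
    case: (eqVneq (bside q) h) => sq.
      rewrite -[RHS]xq; case: (ltnP (bgate q) W) => qW.
        by rewrite /viol sq hq eqxx leqNgt qW /= !andbF.
      apply: viol_upd => //; last by rewrite sq hq eqxx.
        by rewrite upd_wvar // sq /s; case: (h).
      by move=> k; apply: upd_src; rewrite // ltnNge qW /= sq /s; case: (h).
    have sE : bside q = s by rewrite /s; case: (bside q) (h) sq => -[].
    have srcE k : bgate q <= t -> x' (src (bside q) (bgate q) k) = x (src (bside q) (bgate q) k).
      by move=> le; apply: upd_src => //; case: ifP => _; rewrite sE ?eqxx //; case: (s).
    rewrite /viol hE -/h hq eqxx /= (negPf sq) tE ltnS; case: leqP => //= le.
    have -> : inputs (bside q) (bgate q) x' = inputs (bside q) (bgate q) x.
      by apply/eq_map => k; exact: srcE.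
    rewrite /x' upd_wvar // sE eqxx /=; case: (eqVneq (bgate q) t) => [->|ne].
      by rewrite -sE sE eqxx.
    by rewrite -sE valid_gate ?eqxx // (negPf sq) ltn_neqAle ne.
  case: (ltnP q (4 * G + c)) => qc.
    have jc : q - 4 * G < c by lia.
    rewrite -(subnKC q4) !bit_cost // hE upd_wvar //.
    by rewrite /s -/h; case: (h).
  rewrite -(subnKC qc) !bit_time tE -/t.
  have : q - (4 * G + c) < t by lia.
  by move: (q - _) (t) => j k jt; apply/idP/idP; lia.
- by rewrite bit_time.
- by rewrite bit_time tE ltnn.
Qed.

(** At the end of the run the other side is valid throughout, inputs included. Switching the clock
    to that side at time 0 deactivates all gates of the old side, so only cost and clock bits
    change, and the cost is compared first. *)
Lemma cost_le : lex_le [seq cbit (x (wvar h (cout j))) | j <- iota 0 c]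
                       [seq cbit (x (wvar (~~ h) (cout j))) | j <- iota 0 c].
Proof.
(* A move must name a variable; gate 0 receives the value that it already has. *)
set s := ~~ h; set b := gf 0 (inputs s 0 x).
have xs i : i < G -> x (wvar s i) = gf i (inputs s i x).
  by move=> iG; apply: valid_gate => //; rewrite /s time_end; case: (h).
have H := xmin (clk_lt s (leq0n G)) (wvar_range s G0) (gf_lt 0 (inputs s 0 x)).
have E u : 0 < u -> upd x (clk s 0) (wvar s 0) b u = x u.
  by rewrite /upd; case: u => // u _ /=; case: eqP => // ->; rewrite xs.
move: H; rewrite -/b; set x' := upd _ _ _ _ in E *.
have h' : half (x' 0) = s by rewrite half_clk.
have t' : time (x' 0) = 0 by rewrite time_clk.
have split y : bitsx y = [seq bit y r | r <- iota 0 (4 * G)] ++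
    [seq bit y (4 * G + j) | j <- iota 0 c] ++ [seq bit y (4 * G + c + j) | j <- iota 0 G].
  have mapD (f : nat -> bool) m n : map f (iota m n) = [seq f (m + j) | j <- iota 0 n].
    by rewrite -{1}(addn0 m) iotaDl -map_comp.
  by rewrite /bits /nblocks !iotaD !map_cat add0n (mapD _ (4 * G)) (mapD _ (4 * G + c)).
rewrite !split.
have -> : [seq bit x' r | r <- iota 0 (4 * G)] = [seq bit x r | r <- iota 0 (4 * G)].
  apply/eq_in_map => r; rewrite mem_iota add0n => /andP[_ r4].
  rewrite all_valid // bit_viol // /viol h' t' ltn0; have iG := bgate_lt r.
  case: (eqVneq s (bhalf r)) => //= sr; rewrite -sr; case: eqP => //= ->.
  rewrite E // xs //; have -> : inputs s (bgate r) x' = inputs s (bgate r) x.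
    by apply/eq_map => k; rewrite E // /src /wvar; case: ifP.
  by rewrite eqxx andbF.
rewrite lex_le_cat => /(lex_le_take c).
rewrite !take_size_cat ?size_map ?size_iota //.
have -> : [seq bit x (4 * G + j) | j <- iota 0 c] = [seq cbit (x (wvar h (cout j))) | j <- iota 0 c].
  by apply/eq_in_map => j; rewrite mem_iota add0n => /andP[_ jc]; rewrite bit_cost.
have -> // : [seq bit x' (4 * G + j) | j <- iota 0 c] = [seq cbit (x (wvar s (cout j))) | j <- iota 0 c].
apply/eq_in_map => j; rewrite mem_iota add0n => /andP[_ jc]; rewrite bit_cost // h' E //.
Qed.

Lemma local_min_valid s i : i < G -> (if s == h then W <= i else true) ->
  x (wvar s i) = gf i (inputs s i x).
Proof.
move=> iG act; apply: valid_gate => //; case: eqP act => // _ _.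
by rewrite time_end.
Qed.

End Clocked.

(** * The tableau of a stack machine *)

Lemma onth_None T (s : seq T) d : size s <= d -> onth s d = None.
Proof. by elim: s d => [|x s IH] [|d] //= /IH. Qed.

Lemma onth_nth T (x0 : T) (s : seq T) d : d < size s -> onth s d = Some (nth x0 s d).
Proof. by elim: s d => [|x s IH] [|d] //= /IH. Qed.

Section Tableau.
Variable p : program.

Definition reg_of (i : instr) : nat := match i with Push r _ => r | Pop r _ _ _ => r end.
Definition maxreg : nat := (sumn (map reg_of p)).+1.

Lemma reg_le pc i : onth p pc = Some i -> reg_of i < maxreg.+1.
Proof.
rewrite /maxreg ltnS; elim: p pc => [|j q IH] [|pc] //=; first by case=> ->; lia.
by move/IH; lia.
Qed.

(* A cell holds the program counter and the symbols of all stacks at one depth. *)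
Definition cell : Type := ('I_(size p).+1 * {ffun 'I_maxreg.+1 -> option bool})%type.

(** All halting counters are merged into [size p], which leaves the instruction found unchanged and
    makes the set of cells finite. *)
Definition opc (n : nat) : 'I_(size p).+1 := inord (minn n (size p)).

Definition cell_at (cf : config) (d : nat) : cell :=
  (opc cf.1, [ffun r : 'I_maxreg.+1 => onth (cf.2 r) d]).

(** The top cell [q0] gives the instruction and the popped symbol. A push moves symbols down from
    [ql], a pop moves them up from [qr], and [first] marks the top, where a push inserts its bit. *)
Definition next_cell (first : bool) (q0 ql q qr : cell) : cell :=
  match onth p q0.1 with
  | None => (q0.1, q.2)
  | Some (Push r b) => (opc q0.1.+1,
      [ffun r' : 'I_maxreg.+1 =>
        if val r' == r then if first then Some b else ql.2 r' else q.2 r'])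
  | Some (Pop r e f t) =>
      (opc (match q0.2 (inord r) with None => e | Some b => if b then t else f end),
       [ffun r' : 'I_maxreg.+1 => if val r' == r then qr.2 r' else q.2 r'])
  end.

Lemma val_opc n : opc n = minn n (size p) :> nat.
Proof. by rewrite inordK // ltnS geq_minr. Qed.

Lemma onth_opc n : onth p (opc n) = onth p n.
Proof.
rewrite val_opc; case: (leqP n (size p)) => le; first by [].
by rewrite !onth_None // ltnW.
Qed.

Lemma cell_step cf d : cell_at (step p cf) d =
  next_cell (d == 0) (cell_at cf 0) (cell_at cf d.-1) (cell_at cf d) (cell_at cf d.+1).
Proof.
case: cf => pc R; rewrite /next_cell [in RHS]/cell_at /= onth_opc /step.
case E: (onth p pc) => [[r b|r e f t]|] /=.
- have lt : pc < size p by rewrite ltnNge; apply/negP => /onth_None; rewrite E.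
  congr pair; first by apply: val_inj; rewrite /= !val_opc; lia.
  apply/ffunP => r'; rewrite !ffunE /update /=; case: eqP => // rE.
  by case: d => [|d] //=; rewrite rE.
- have rm : r < maxreg.+1 by have := reg_le E.
  rewrite ffunE inordK //.
  case Er: (R r) => [|b w] /=; congr pair; apply/ffunP => r'; rewrite !ffunE /update /=;
    case: eqP => // rE; rewrite rE Er //=; by case: (d).
- by [].
Qed.

Definition ecell (q : cell) : nat := index q (enum {: cell}).
(** The margin makes 0 and 1, the values of an input row, admissible whatever the number of
    cells. *)
Definition ncells : nat := #|{: cell}|.+2.

Lemma ecell_lt q : ecell q < ncells.
Proof. by rewrite /ncells ltnS; apply: leq_trans (index_size _ _) _; rewrite -cardE. Qed.

Lemma nth_ecell T (d : T) (F : cell -> T) q : nth d (map F (enum {: cell})) (ecell q) = F q.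
Proof.
have qe : q \in enum {: cell} by rewrite mem_enum.
by rewrite (nth_map q) ?index_mem // nth_index.
Qed.

Definition out_table : seq nat := [seq nat_of_bool (q.2 ord0 == Some true) | q : cell <- enum {: cell}].

Definition init_cell (a b : option bool) : cell :=
  (opc 0, [ffun r : 'I_maxreg.+1 => if val r == 0 then a else if val r == 1 then b else None]).

Definition syms : seq (option bool) := [:: None; Some false; Some true].

Definition init_table : seq (seq nat) :=
  [seq [seq ecell (init_cell a b) | b <- syms] | a <- syms].

Definition cell_table (first : bool) : seq (seq (seq (seq nat))) :=
  [seq [seq [seq [seq ecell (next_cell first q0 ql q qr) | qr <- enum {: cell}]
    | q <- enum {: cell}] | ql <- enum {: cell}] | q0 <- enum {: cell}].

Definition look4 (T : seq (seq (seq (seq nat)))) (vs : seq nat) : nat :=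
  nth 0 (nth [::] (nth [::] (nth [::] T (nth 0 vs 0)) (nth 0 vs 1)) (nth 0 vs 2)) (nth 0 vs 3).

Definition sym_at (I : seq bool) (d : nat) : nat :=
  if d < size I then (nat_of_bool (nth false I d)).+1 else 0.

(** Row 0 decodes output bits of the other side, row 1 combines the hard-wired [I] with the bits of
    row 0 in the same column into the initial configuration, and later rows apply the transition
    table. Any nonzero input counts as [true], because free inputs may hold any residue. *)
Definition gate (I : seq bool) (n W i : nat) (vs : seq nat) : nat :=
  if i %/ W == 0 then nth 0 out_table (nth 0 vs 0)
  else if i %/ W == 1 then
    nth 0 (nth [::] init_table (sym_at I (i %% W)))
      (if i %% W < n then (nat_of_bool (~~ (nth 0 vs 2 == 0))).+1 else 0)
  else if i %% W == 0 then look4 (cell_table true) vs else look4 (cell_table false) vs.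

Definition gate_in (W i k : nat) : nat :=
  (i %/ W - 1) * W +
  (if k == 0 then 0 else if k == 1 then i %% W - 1 else if k == 2 then i %% W
   else if (i %% W).+1 < W then (i %% W).+1 else i %% W).

(* [T + 2] rows: the input row, then the configurations at times 0, ..., T. *)
Definition gate_out (T W j : nat) : nat := T.+1 * W + (if j < W then j else 0).

Lemma nth_map_ind A C (d : C) (Q : C -> Prop) (F : A -> C) s i :
  Q d -> (forall a, Q (F a)) -> Q (nth d (map F s) i).
Proof. by move=> Qd QF; elim: s i => [|a s IH] [|i] //=. Qed.

Lemma gate_lt I n W i vs : gate I n W i vs < ncells.
Proof.
have nil0 j : nth 0 [::] j < ncells by rewrite nth_nil.
have L b : look4 (cell_table b) vs < ncells.
  rewrite /look4 /cell_table.
  apply: (nth_map_ind (Q := fun l => nth 0 (nth [::] (nth [::] l _) _) _ < _)).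
    by rewrite !nth_nil.
  move=> q0; apply: (nth_map_ind (Q := fun l => nth 0 (nth [::] l _) _ < _)).
    by rewrite !nth_nil.
  move=> ql; apply: (nth_map_ind (Q := fun l => nth 0 l _ < _)) => [|q] //.
  by apply: (nth_map_ind (Q := fun v => v < _)) => // qr; exact: ecell_lt.
rewrite /gate; case: ifP => _.
  by apply: (nth_map_ind (Q := fun v => v < _)) => // q; case: (_ == _).
case: ifP => _; last by case: ifP.
apply: (nth_map_ind (Q := fun l => nth 0 l _ < _)) => [|q] //.
by apply: (nth_map_ind (Q := fun v => v < _)) => // qr; exact: ecell_lt.
Qed.

Variables (I : seq bool) (n W T : nat).
Hypothesis W_big : size I + n + T + 1 < W.

Lemma gate_in_lt i k : W <= i -> gate_in W i k < i.
Proof.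
move=> Wi; have W0 : 0 < W by lia.
have d0 : 0 < i %/ W by rewrite divn_gt0.
have m := ltn_pmod i W0; have E := divn_eq i W.
have off : (if k == 0 then 0 else if k == 1 then i %% W - 1 else if k == 2 then i %% W
   else if (i %% W).+1 < W then (i %% W).+1 else i %% W) < W.
  by do 3 (case: ifP => _; first lia); case: ifP.
rewrite /gate_in; move: off; set o := (if k == 0 then _ else _) => off.
by rewrite {2}E; move: (i %/ W) d0 => [|q] // _; rewrite subn1 /= mulSn; lia.
Qed.

Lemma gate_out_lt j : gate_out T W j < T.+2 * W.
Proof. by rewrite /gate_out; case: ifP => jW; rewrite [X in _ < X]mulSn; lia. Qed.

Section Side.
Variables (G : nat) (s : bool) (x : nat -> nat) (oin : nat -> nat).
Hypothesis GE : G = T.+2 * W.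
Hypothesis valid : forall i, i < G -> W <= i ->
  x (wvar G s i) = gate I n W i (inputs G W (gate_in W) oin s i x).

Definition xword : seq bool := [seq ~~ (x (wvar G s d) == 0) | d <- iota 0 n].

Lemma tableau_cells t d : t <= T -> d < W ->
  x (wvar G s (t.+1 * W + d)) = ecell (cell_at (iter t (step p) (0, nth [::] [:: I; xword])) d).
Proof.
have W0 : 0 < W by lia.
have divE t' d' : d' < W -> (t' * W + d') %/ W = t' by move=> lt; rewrite divnMDl // divn_small ?addn0.
have modE t' d' : d' < W -> (t' * W + d') %% W = d' by move=> lt; rewrite modnMDl modn_small.
elim: t d => [|t IH] d tT dW.
  have nlt : (1 * W + d < W) = false by lia.
  rewrite valid; [|by rewrite GE; nia|by rewrite mul1n leq_addr].
  rewrite /gate divE // modE // /inputs /= /src nlt /gate_in divE // modE // subnn mul0n add0n.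
  have sI : nth None syms (sym_at I d) = onth I d.
    rewrite /sym_at; case: ltnP => lt; first by rewrite (onth_nth false lt); case: (nth false I d).
    by rewrite onth_None.
  set sx := (if d < n then _ else _).
  have sX : nth None syms sx = onth xword d.
    rewrite /sx; case: ltnP => lt; last by rewrite onth_None // size_map size_iota.
    rewrite (onth_nth false) ?size_map ?size_iota // (nth_map 0) ?size_iota // nth_iota // add0n.
    by case: (x _ == 0).
  have lI : sym_at I d < 3 by rewrite /sym_at; case: ifP => //; case: (nth false I d).
  have lX : sx < 3 by rewrite /sx; case: ifP => //; case: (_ == 0).
  rewrite /init_table (nth_map None) // (nth_map None) // sI sX; congr ecell.
  rewrite /cell_at /init_cell; congr pair; apply/ffunP => -[[|[|r]] lr]; rewrite !ffunE //=.
  by rewrite nth_nil onth_None.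
have tT' : t <= T by lia.
have nlt : (t.+2 * W + d < W) = false by rewrite mulSn; lia.
rewrite iterS cell_step valid; [|by rewrite GE; nia|by rewrite mulSn -addnA leq_addr].
rewrite /gate divE // modE // /inputs /= /src nlt /gate_in divE // modE // subn1 /=.
have E0 : x (wvar G s (t.+1 * W + 0)) = ecell (cell_at (iter t (step p) (0, nth [::] [:: I; xword])) 0).
  exact: IH.
have E1 : x (wvar G s (t.+1 * W + (d - 1))) =
    ecell (cell_at (iter t (step p) (0, nth [::] [:: I; xword])) d.-1).
  by rewrite IH // ?subn1 //; lia.
have E2 := IH d tT' dW.
have E3 : x (wvar G s (t.+1 * W + (if d.+1 < W then d.+1 else d))) =
    ecell (cell_at (iter t (step p) (0, nth [::] [:: I; xword])) d.+1).
  (* At the right border a cell serves as its own right neighbor. By [W_big] no stack reaches that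
     depth, so both cells are blank. *)
  case: (ltnP d.+1 W) => dW1; first exact: IH.
  rewrite IH //; congr ecell; rewrite /cell_at; congr pair; apply/ffunP => r; rewrite !ffunE.
  have : size ((iter t (step p) (0, nth [::] [:: I; xword])).2 r) <= d.
    apply: leq_trans (size_iter_step _ _ _ _) _.
    have : size (nth [::] [:: I; xword] r) <= size I + n.
      case: (val r) => [|[|k]] /=; rewrite ?nth_nil ?size_map ?size_iota //=; lia.
    by rewrite /=; lia.
  by move=> le; rewrite !onth_None // ltnW.
by case: (eqVneq d 0) => [d0|d0]; rewrite /look4 /= E0 E1 E2 E3 /cell_table !nth_ecell.
Qed.

Variable out : seq bool.
Hypothesis halts : computes_within p [:: I; xword] out T.

Lemma tableau_out j : j < W -> nth 0 out_table (x (wvar G s (gate_out T W j))) = nth false out j :> nat.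
Proof.
move=> jW; rewrite /gate_out jW tableau_cells // /out_table nth_ecell ffunE /=.
case: halts => _ ->; case: (ltnP j (size out)) => lt; first by rewrite (onth_nth false lt); case: (nth false out j).
by rewrite onth_None // nth_default.
Qed.

End Side.
End Tableau.

(** * Improvement steps of a PLS problem as one polynomial-time function *)

(** A circuit needs solutions of fixed length: the last [true] marks the end of the word. [unpad] is
    total, so every content of the inputs denotes some word. *)
Definition pad (n : nat) (w : seq bool) : seq bool :=
  w ++ true :: nseq (n - size w - 1) false.

Definition first_true (l : seq bool) : nat :=
  head (size l) [seq i <- iota 0 (size l) | nth false l i].

Definition unpad (w : seq bool) : seq bool := rev (drop (first_true (rev w)).+1 (rev w)).

Lemma size_pad n w : size w < n -> size (pad n w) = n.
Proof. by move=> lt; rewrite size_cat /= size_nseq; lia. Qed.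

Lemma first_trueE k l : first_true (nseq k false ++ true :: l) = k.
Proof.
rewrite /first_true size_cat size_nseq /= iotaD filter_cat /= nth_cat size_nseq ltnn subnn /=.
rewrite (_ : filter _ (iota 0 k) = [::]) //=; apply/eqP; rewrite -[_ == _]negbK -has_filter.
apply/negP => /hasP[i]; rewrite mem_iota add0n => /andP[_ ik].
by rewrite nth_cat size_nseq ik nth_nseq ik.
Qed.

Lemma padK n w : unpad (pad n w) = w.
Proof.
have E : rev (pad n w) = nseq (n - size w - 1) false ++ true :: rev w.
  rewrite /pad rev_cat rev_cons cat_rcons; congr (_ ++ _).
  by rewrite -[LHS](@map_id bool) map_rev; elim: (n - _ - _) => //= k IH; rewrite rev_cons IH -cats1 -[RHS]/(nseq k.+1 false) -addn1 nseqD.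
rewrite /unpad E first_trueE -cat_rcons drop_size_cat ?revK //.
by rewrite size_rcons size_nseq.
Qed.

Lemma PF_pad {E} {dE : data E} D (n : E -> nat) (w : E -> seq bool) :
  PF D n -> PF D w -> PF D (fun e => pad (n e) (w e)).
Proof. by apply: PF_app2 => Q; rewrite /pad; pf. Qed.

Lemma PF_unpad {E} {dE : data E} D (w : E -> seq bool) :
  PF D w -> PF D (fun e => unpad (w e)).
Proof. by apply: PF_app => Q; rewrite /unpad /first_true; pf. Qed.

Definition lex_gt (v w : seq bool) : bool :=
  ~~ all (fun i => ~~ (nth false v i && (~~ nth false w i &&
      all (fun j => nat_of_bool (nth false v j) == nat_of_bool (nth false w j)) (iota 0 i))))
    (iota 0 (size v)).

Lemma lex_gtE v w : size v = size w -> lex_gt v w = ~~ lex_le v w.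
Proof.
move=> sE; have mv (u : seq bool) : u = map (nth false u) (iota 0 (size u)) by rewrite map_nth_iota0 // take_size.
have eqn (a b : bool) : (nat_of_bool a == nat_of_bool b) = (a == b) by case: a; case: b.
apply/idP/idP => [/allPn[i]|nle].
  rewrite mem_iota add0n negbK => /andP[_ iv] /and3P[vi wi /allP H].
  rewrite [v]mv [w]mv -sE (lex_le_map_drop iv) // => q qi.
  by have := H q; rewrite mem_iota add0n qi eqn => /(_ isT)/eqP.
have ne : v != w by apply: contraNN nle => /eqP->; exact: lex_le_refl.
have ex : exists i, (i < size v) && (nth false v i != nth false w i).
  case: (altP (@allP _ (fun i => nth false v i == nth false w i) (iota 0 (size v)))) => [H|].
    move: ne; rewrite (@eq_from_nth _ false v w) ?eqxx // => i iv.
    by apply/eqP; apply: H; rewrite mem_iota.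
  by case/allPn=> i; rewrite mem_iota add0n => /andP[_ iv] ne'; exists i; rewrite iv.
case: (ex_minnP ex) => i /andP[iv ni] imin.
have same q : q < i -> nth false v q = nth false w q.
  move=> qi; apply/eqP; apply: contraTT qi => nq; rewrite -leqNgt; apply: imin.
  by rewrite nq andbT; apply: contraTT nq => ge; rewrite -leqNgt in ge; rewrite !nth_default ?eqxx // -sE.
have [vi wi] : nth false v i = true /\ nth false w i = false.
  case vi: (nth false v i); case wi: (nth false w i) => //; try by rewrite vi wi in ni.
  have H := @lex_le_map_drop (nth false w) (nth false v) (size v) i iv.
  exfalso; move: nle; rewrite /lex_le -Order.TotalTheory.ltNge.
  have : lex_le w v = false.
    rewrite [w]mv [v]mv -sE; apply: H; rewrite ?wi ?vi // => q qi; by rewrite same.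
  rewrite /lex_le => /negbT; rewrite -Order.TotalTheory.ltNge => h1 h2.
  by have := Order.POrderTheory.lt_trans h1 h2; rewrite Order.POrderTheory.ltxx.
apply/allPn; exists i; first by rewrite mem_iota.
rewrite negbK vi wi /=; apply/allP => q; rewrite mem_iota add0n => /andP[_ qi].
by rewrite same.
Qed.

Lemma PF_lex_gt {E} {dE : data E} D (v w : E -> seq bool) :
  PF D v -> PF D w -> PF D (fun e => lex_gt (v e) (w e)).
Proof. by apply: PF_app2 => Q; rewrite /lex_gt; pf. Qed.

Section Front.
Variables (L : local_problem) (kl : nat) (chi : word -> word -> bool) (st : word -> word)
  (nb : word -> word -> seq word) (mx : bool) (co : word -> word -> word) (cl : pexp).
Hypotheses
  (Hlen : forall I x, feasible_pair L I x -> size x <= size I ^ kl + kl)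
  (Pchi : polytime2 (fun I _ => is_instance L I) (fun I x => [:: chi I x]))
  (Hchi : forall I x, is_instance L I -> (chi I x <-> feasible L I x))
  (Pst : polytime1 (is_instance L) st)
  (Hst : forall I, is_instance L I -> feasible L I (st I))
  (Pnb : polytime2 (feasible_pair L) (fun I x => words_code (nb I x)))
  (Hnb : forall I x, feasible_pair L I x -> forall y,
    (y \in nb I x <-> neighbor L I x y) /\ (neighbor L I x y -> feasible L I y))
  (Pco : polytime2 (feasible_pair L) co)
  (Hco : forall I x y, is_instance L I -> feasible L I x -> feasible L I y ->
    (no_worse L I x y <-> if mx then binary_value (co I y) <= binary_value (co I x)
                          else binary_value (co I x) <= binary_value (co I y)))
  (Hcl : forall I x, feasible_pair L I x -> size (co I x) <= peval cl (size I)).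

Definition sol_len (I : word) : nat := size I ^ kl + kl + 1.
Definition cost_len (I : word) : nat := (peval cl (size I)).+1.

(** Equal length turns the comparison of binary values into the lexicographic order, and
    complementing all bits turns maximization into minimization. *)
Definition norm_cost (l : nat) (v : seq bool) : seq bool :=
  [seq if mx then ~~ b else b | b <- nseq (l - size v) false ++ v].

(** The leading bit makes every infeasible word more expensive than all solutions; the inputs of the
    circuit may hold such words. *)
Definition cost_bits (I x : word) : seq bool :=
  if chi I x then false :: norm_cost (peval cl (size I)) (co I x)
  else nseq (cost_len I) true.

(** The start solution is needed to leave infeasible words. A feasible word without a better
    neighbor is its own successor, by the default of [head]. *)
Definition next_sol (I x : word) : seq bool :=
  if chi I x then head x [seq y <- nb I x | lex_gt (cost_bits I x) (cost_bits I y)] else st I.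

Definition improve (I X : word) : seq bool :=
  cost_bits I (unpad X) ++ pad (sol_len I) (next_sol I (unpad X)).

Lemma size_norm_cost l v : size v <= l -> size (norm_cost l v) = l.
Proof. by move=> le; rewrite size_map size_cat size_nseq subnK. Qed.

Lemma size_cost_bits I x : is_instance L I -> size (cost_bits I x) = cost_len I.
Proof.
move=> iI; rewrite /cost_bits; case: ifP => [/Hchi-/(_ iI) fx|_]; last by rewrite size_nseq.
by rewrite /= size_norm_cost // Hcl.
Qed.

Lemma norm_cost_le l v w : size v <= l -> size w <= l ->
  lex_le (norm_cost l v) (norm_cost l w) <->
  if mx then binary_value w <= binary_value v else binary_value v <= binary_value w.
Proof.
have bv k u : binary_value (nseq k false ++ u) = binary_value u.
  by elim: k => //= k IH; rewrite binary_value_cons mul0n add0n.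
have bneg (u : seq bool) : binary_value [seq ~~ b | b <- u] + binary_value u + 1 = 2 ^ size u.
  by elim: u => //= b u IH; rewrite !binary_value_cons size_map expnS; case: b => /=; lia.
move=> lv lw; rewrite lex_le_binary ?size_norm_cost // /norm_cost; case: mx.
  have := bneg (nseq (l - size v) false ++ v); have := bneg (nseq (l - size w) false ++ w).
  by rewrite !size_cat !size_nseq !subnK // !bv; split; lia.
by rewrite !map_id !bv.
Qed.

Lemma cost_bits_le I x y : is_instance L I -> feasible L I x -> feasible L I y ->
  lex_le (cost_bits I x) (cost_bits I y) <-> no_worse L I x y.
Proof.
move=> iI fx fy; rewrite /cost_bits.
have -> : chi I x by apply/Hchi.
have -> : chi I y by apply/Hchi.
by rewrite lex_le_cons eqxx norm_cost_le ?Hcl // Hco.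
Qed.

Lemma next_sol_feasible I x : is_instance L I -> feasible L I (next_sol I x).
Proof.
move=> iI; rewrite /next_sol; case: ifP => [/Hchi-/(_ iI) fx|_]; last exact: Hst.
case E: (filter _ _) => [|y l] //=.
have : y \in [seq y <- nb I x | lex_gt (cost_bits I x) (cost_bits I y)] by rewrite E inE eqxx.
by rewrite mem_filter => /andP[_ yn]; have [[h _] h2] := Hnb (conj iI fx) y; apply: h2; exact: h.
Qed.

Lemma size_next_sol I x : is_instance L I -> size (next_sol I x) < sol_len I.
Proof.
move=> iI; rewrite /sol_len addn1 ltnS; apply: Hlen; split=> //.
exact: next_sol_feasible.
Qed.

(** An infeasible word has a feasible successor with a smaller leading bit, so it is not stable. For
    a feasible word a better neighbor would make the filtered list nonempty and its head strictly
    cheaper. *)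
Lemma stable_local_opt I x : is_instance L I ->
  lex_le (cost_bits I x) (cost_bits I (next_sol I x)) -> local_opt L I x.
Proof.
move=> iI; case cx: (chi I x); last first.
  have fn := next_sol_feasible x iI.
  by rewrite /cost_bits cx (_ : chi I _ = true) ?lex_le_cons //; apply/Hchi.
have fx : feasible L I x by apply/Hchi.
move=> le; split=> // y ny; have [hn /(_ ny) fy] := Hnb (conj iI fx) y.
apply/(cost_bits_le iI fx fy); apply/negPn/negP => nle.
have ym : y \in [seq y <- nb I x | lex_gt (cost_bits I x) (cost_bits I y)].
  by rewrite mem_filter lex_gtE ?size_cost_bits // nle; apply/hn.
move: le; rewrite /next_sol cx.
case E: (filter _ _) ym => [|z l] // _ /=.
have : z \in [seq y <- nb I x | lex_gt (cost_bits I x) (cost_bits I y)] by rewrite E inE eqxx.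
by rewrite mem_filter lex_gtE ?size_cost_bits // => /andP[/negPf-> _].
Qed.

Lemma PF_chi : PF (fun p : seq bool * seq bool => is_instance L p.1) (fun p => chi p.1 p.2).
Proof.
have P := PF_of_polytime2 Pchi.
exact: (PF_head (PF_const _ false) P).
Qed.

Lemma PF_sol_len {E} {dE : data E} D (w : E -> seq bool) : PF D w -> PF D (fun e => sol_len (w e)).
Proof. by apply: PF_app => Q; rewrite /sol_len; pf. Qed.

Lemma PF_cost_len {E} {dE : data E} D (w : E -> seq bool) : PF D w -> PF D (fun e => cost_len (w e)).
Proof. by apply: PF_app => Q; rewrite /cost_len; pf. Qed.

Lemma PF_cost_bits : PF (fun p : seq bool * seq bool => is_instance L p.1) (fun p => cost_bits p.1 p.2).
Proof.
rewrite /cost_bits; apply: PF_ifD; first exact: PF_chi.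
  have P : PF (fun p : seq bool * seq bool => is_instance L p.1 /\ chi p.1 p.2) (fun p => co p.1 p.2 : seq bool).
    apply: (PF_sub (D' := fun p : word * word => feasible_pair L p.1 p.2)); last exact: PF_of_polytime2.
    by move=> [I x] /= [iI cx]; split=> //; apply/Hchi.
  by rewrite /norm_cost; pf.
by pf; apply: PF_cost_len; pf.
Qed.

Lemma PF_next_sol : PF (fun p : seq bool * seq bool => is_instance L p.1) (fun p => next_sol p.1 p.2).
Proof.
rewrite /next_sol; apply: PF_ifD; first exact: PF_chi.
  apply: PF_head; first by pf.
  apply: PF_filter.
    have P : PF (fun p : seq bool * seq bool => is_instance L p.1 /\ chi p.1 p.2)
        (fun p => words_code (nb p.1 p.2) : seq bool).
      apply: (PF_sub (D' := fun p : word * word => feasible_pair L p.1 p.2)); last exact: (PF_of_polytime2 Pnb).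
      by move=> [I x] /= [iI cx]; split=> //; apply/Hchi.
    by apply: PF_ext (PF_words_decode P) => p _; rewrite words_codeK.
  apply: PF_lex_gt.
    have Pt : PF (fun q : seq bool * seq bool * seq bool => is_instance L q.1.1 /\ chi q.1.1 q.1.2)
      (fun q => (q.1.1, q.1.2)) by pf.
    by apply: (PF_comp Pt PF_cost_bits) => q [].
  have Pt : PF (fun q : seq bool * seq bool * seq bool => is_instance L q.1.1 /\ chi q.1.1 q.1.2)
    (fun q => (q.1.1, q.2)) by pf.
  by apply: (PF_comp Pt PF_cost_bits) => q [].
have P := PF_of_polytime1 Pst.
by apply: (PF_comp (PF_fst0 _) P) => p [].
Qed.

Lemma improve_polytime : polytime2 (fun I _ => is_instance L I) improve.
Proof.
apply: PF_polytime2.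
have Pt : PF (fun p : seq bool * seq bool => is_instance L p.1) (fun p => (p.1, unpad p.2)).
  by apply: PF_pair; [pf | apply: PF_unpad; pf].
apply: PF_cat; first exact: (PF_comp Pt PF_cost_bits).
apply: PF_pad; first by apply: PF_sol_len; pf.
exact: (PF_comp Pt PF_next_sol).
Qed.

End Front.

(** * The reduction *)

Lemma PF_odd {E} {dE : data E} D (f : E -> nat) : PF D f -> PF D (fun e => odd (f e)).
Proof.
move=> Pf; have P : PF D (fun e => f e %% 2 == 1) by pf.
by apply: PF_ext P => e _; rewrite modn2; case: (odd _).
Qed.

Lemma PF_addb {E} {dE : data E} D (f g : E -> bool) :
  PF D f -> PF D g -> PF D (fun e => f e (+) g e).
Proof.
move=> Pf Pg; have P : PF D (fun e => if f e then ~~ g e else g e) by pf.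
by apply: PF_ext P => e _; case: (f e).
Qed.

Lemma PF_eqb {E} {dE : data E} D (f g : E -> bool) :
  PF D f -> PF D g -> PF D (fun e => f e == g e).
Proof.
move=> Pf Pg; apply: PF_ext (PF_not (PF_addb Pf Pg)) => e _.
by case: (f e); case: (g e).
Qed.

Lemma PF_prime {E} {dE : data E} D (f : E -> nat) : PF D f -> PF D (fun e => prime (f e)).
Proof.
apply: PF_app => Q.
have P : PF Q (fun q => (1 < q) && all (fun d => ~~ (q %% d == 0)) (iota 2 (q - 2))) by pf.
apply: PF_ext P => q _; apply/andP/primeP => [[q1 /allP H]|[q1 H]]; split=> //.
  move=> d dq; have q0 : 0 < q by lia.
  have dle := dvdn_leq q0 dq; have d0 := dvdn_gt0 q0 dq.
  rewrite /=; case: (eqVneq d 1) => //= d1; case: (eqVneq d q) => //= dnq.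
  have : d \in iota 2 (q - 2) by rewrite mem_iota; lia.
  by move/H; rewrite -/(dvdn _ _) dq.
apply/allP => d; rewrite mem_iota => dr; rewrite -/(dvdn _ _); apply/negP => /H /=; lia.
Qed.

Lemma PF_undig {E} {dE : data E} D (M : E -> nat) a (g : nat -> E -> nat) :
  PF D M -> (forall k, PF D (g k)) -> PF D (fun e => undig (M e) a (fun k => g k e)).
Proof.
move=> PM; elim: a g => [|a IH] g Pg /=; first exact: PF_const.
by apply: PF_addn; [exact: Pg | apply: PF_muln => //; apply: (IH (fun k => g k.+1))].
Qed.

Create HintDb pfdb.

Ltac pf_user ::=
  lazymatch goal with
  | |- @PF _ _ _ _ _ (fun e => odd (@?f e)) => apply: (PF_odd (f := f))
  | |- @PF _ _ _ _ _ (fun e => prime (@?f e)) => apply: (PF_prime (f := f))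
  | |- @PF _ _ _ _ _ (fun e => addb (@?f e) (@?g e)) => apply: (PF_addb (f := f) (g := g))
  | |- @PF _ _ _ _ _ (fun e => @eq_op Datatypes_bool__canonical__eqtype_Equality (@?f e) (@?g e)) =>
      apply: (PF_eqb (f := f) (g := g))
  | |- @PF _ _ _ _ _ (fun e => unary_code (@?f e)) => apply: (PF_unary_code (l := f))
  | |- @PF _ _ _ _ _ (fun e => words_code (@?f e)) => apply: (PF_words_code (l := f))
  | |- @PF _ _ _ _ _ (fun e => unary_decode (@?f e)) => apply: (PF_unary_decode (w := f))
  | |- @PF _ _ _ _ _ (fun e => unpad (@?f e)) => apply: (PF_unpad (w := f))
  | |- @PF _ _ _ _ _ (fun e => ?h (@?f e)) =>
      apply: (PF_app (h := h) (f := f)); [solve [auto with pfdb] | ]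
  end.

Section Reduction.
Variables (p : program) (kt : nat) (sl clen : seq bool -> nat).
Hypotheses (Psl : forall Q, PF Q sl) (Pclen : forall Q, PF Q clen).
#[local] Hint Resolve Psl Pclen : pfdb.

Definition rT (I : seq bool) : nat := (size I + sl I) ^ kt + kt.
(** Wide enough for all stacks throughout the run, and for the whole output, cost bits and padded
    successor, to be read from one row. *)
Definition rW (I : seq bool) : nat := size I + sl I + rT I + clen I + 2.
Definition rG (I : seq bool) : nat := (rT I).+2 * rW I.
(** A prime above this bound can represent every clock value and every gate value. *)
Definition rY (I : seq bool) : nat := 2 * (rG I).+1 + ncells p.
(** Primes to be found: one for the clock and each of the 2G gate variables, plus at most [rY I + 1]
    that are discarded as too small. [rX] then comes from [size_primes_upto]. *)
Definition rq (I : seq bool) : nat := (2 * rG I).+1 + (rY I).+1.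
Definition rX (I : seq bool) : nat := 8 * (rq I * rq I).
Definition rM (I : seq bool) : nat := (rX I).+1.
Definition rB (I : seq bool) : nat := 4 * rG I + (clen I + rG I).
Definition rN (I : seq bool) : nat := rM I ^ 6 * rB I.
Definition rprs (I : seq bool) : seq nat := [seq q <- primes_upto (rX I) | rY I < q].
(** The default modulus 1 makes indices without a prime trivial, so that congruences can be stated
    for all indices. *)
Definition rpr (I : seq bool) (v : nat) : nat := nth 1 (rprs I) v.

(** The offset skips the cost bits, which precede the successor in the output of [improve]. *)
Definition roin (I : seq bool) (i : nat) : nat := gate_out (rT I) (rW I) (clen I + i).
Definition rcout (I : seq bool) (j : nat) : nat := gate_out (rT I) (rW I) j.
Definition rcbit (v : nat) : bool := ~~ (nth 0 (out_table p) v == 0).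
Definition rvars (I : seq bool) : nat -> nat -> nat :=
  cvars (rG I) (rW I) (clen I) (gate_in (rW I)) (roin I) (rcout I).
Definition rfn (I : seq bool) : nat -> seq nat -> bool :=
  cfn (rG I) (rW I) (clen I) (gate p I (sl I) (rW I)) rcbit.

Definition rsh (u : nat * (nat * nat)) (v : nat) : nat :=
  if v == 0 then u.1 else if v == u.2.1 then u.2.2 else 0.
(** With a generator for every pair of increments of the clock and of one gate variable, any
    assignment to both is a single move from any state. *)
Definition rus (I : seq bool) : seq (nat * (nat * nat)) :=
  flatten [seq flatten [seq [seq (a, (v, b)) | b <- iota 0 (rM I)] | v <- iota 1 (2 * rG I)]
          | a <- iota 0 (rM I)].

Definition rshift (I : seq bool) (u : nat * (nat * nat)) (i : nat) : nat :=
  shift (rM I) (rB I) 6 (rpr I) (rvars I) (rsh u) i.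

Definition red_f (I : seq bool) : seq bool :=
  words_code ([seq pos_bit (rM I) (rB I) 6 (rfn I) i | i <- iota 0 (rN I)] ::
    [seq unary_code [seq rshift I u i | i <- iota 0 (rN I)] | u <- rus I]).

Definition red_half (I : seq bool) (z : seq nat) : bool :=
  half (rG I) (dig (rM I) (nth 0 z 0 %/ rB I) 0).

(** Images of the first positions reveal the residues: block 0 has the clock in slot 0, and among
    the blocks of half 0 the one with index [h * G + d] has gate d of side h in slot 1. *)
Definition red_g (I y : seq bool) : seq bool :=
  unpad [seq ~~ (dig (rM I) (nth 0 (unary_decode y)
      (red_half I (unary_decode y) * rG I + d) %/ rB I) 1 == 0) | d <- iota 0 (sl I)].

Lemma PF_rT Q : PF Q rT. Proof. by rewrite /rT; pf. Qed.
#[local] Hint Resolve PF_rT : pfdb.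
Lemma PF_rW Q : PF Q rW. Proof. by rewrite /rW; pf. Qed.
#[local] Hint Resolve PF_rW : pfdb.
Lemma PF_rG Q : PF Q rG. Proof. by rewrite /rG; pf. Qed.
#[local] Hint Resolve PF_rG : pfdb.
Lemma PF_rY Q : PF Q rY. Proof. by rewrite /rY; pf. Qed.
#[local] Hint Resolve PF_rY : pfdb.
Lemma PF_rX Q : PF Q rX. Proof. by rewrite /rX /rq; pf. Qed.
#[local] Hint Resolve PF_rX : pfdb.
Lemma PF_rM Q : PF Q rM. Proof. by rewrite /rM; pf. Qed.
#[local] Hint Resolve PF_rM : pfdb.
Lemma PF_rB Q : PF Q rB. Proof. by rewrite /rB; pf. Qed.
#[local] Hint Resolve PF_rB : pfdb.
Lemma PF_rN Q : PF Q rN. Proof. by rewrite /rN; pf. Qed.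
#[local] Hint Resolve PF_rN : pfdb.
Lemma PF_rprs Q : PF Q rprs. Proof. by rewrite /rprs /primes_upto; pf. Qed.
#[local] Hint Resolve PF_rprs : pfdb.
Lemma PF_rus Q : PF Q rus. Proof. by rewrite /rus; pf. Qed.
#[local] Hint Resolve PF_rus : pfdb.

Lemma PF_rvars {E} {dE : data E} D (I : E -> seq bool) (r : E -> nat) k :
  PF D I -> PF D r -> PF D (fun e => rvars (I e) (r e) k).
Proof.
apply: (PF_app2 (h := fun I r => rvars I r k)) => Q.
rewrite /rvars /cvars /src /wvar /bside /bgate /bhalf /roin /rcout /gate_in /gate_out.
by pf.
Qed.

Lemma PF_rfn {E} {dE : data E} D (I : E -> seq bool) (r : E -> nat) (vs : E -> seq nat) :
  PF D I -> PF D r -> PF D vs -> PF D (fun e => rfn (I e) (r e) (vs e)).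
Proof.
apply: (PF_app3 (h := fun I r vs => rfn I r vs)) => Q.
rewrite /rfn /cfn /gate /look4 /sym_at /rcbit /bside /bgate /bhalf /half /time.
by pf.
Qed.

Lemma PF_rshift {E} {dE : data E} D (I : E -> seq bool) (u : E -> nat * (nat * nat)) (i : E -> nat) :
  PF D I -> PF D u -> PF D i -> PF D (fun e => rshift (I e) (u e) (i e)).
Proof.
apply: (PF_app3 (h := fun I u i => rshift I u i)) => Q.
rewrite /rshift /shift; apply: PF_addn; last by pf.
apply: PF_muln; last by pf.
apply: (@PF_undig _ _ _ (fun q : seq bool * (nat * (nat * nat)) * nat => rM q.1.1) 6 (fun k q =>
  shd (rpr q.1.1) (rsh q.1.2) (rvars q.1.1 (q.2 %% rB q.1.1) k) (dig (rM q.1.1) (q.2 %/ rB q.1.1) k))).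
  by pf.
move=> k.
have PV : PF Q (fun q => rvars q.1.1 (q.2 %% rB q.1.1) k) by apply: PF_rvars; pf.
by rewrite /shd /rpr /rsh /dig; pf.
Qed.

Lemma PF_red_f Q : PF Q red_f.
Proof.
rewrite /red_f; pf; last by apply: PF_rshift; pf.
by rewrite /pos_bit /=; apply: PF_rfn; rewrite /dig; pf.
Qed.

Lemma PF_red_g Q : PF Q (fun q : seq bool * seq bool => red_g q.1 q.2).
Proof. by rewrite /red_g /red_half /half /dig; pf. Qed.

(** * Correctness of the reduction on one instance *)

Section Correct.
Variable I : seq bool.

Lemma rG_gt0 : 0 < rG I.
Proof. by rewrite /rG /rW; nia. Qed.

Lemma rW_le_rG : rW I <= rG I.
Proof. by rewrite /rG; nia. Qed.

Lemma W_bigI : size I + sl I + rT I + 1 < rW I.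
Proof. by rewrite /rW; lia. Qed.

Lemma size_rprs : 2 * rG I < size (rprs I).
Proof.
have q0 : 0 < rq I by rewrite /rq.
have := size_primes_upto q0; rewrite -/(rX I) => H.
have E := count_predC (fun q => rY I < q) (primes_upto (rX I)).
have le : count (predC (fun q => rY I < q)) (primes_upto (rX I)) <= (rY I).+1.
  rewrite -size_filter -[X in _ <= X](size_iota 0); apply: uniq_leq_size.
    by rewrite !filter_uniq // iota_uniq.
  move=> q; rewrite mem_filter mem_iota add0n ltnS => /andP[+ _].
  by rewrite /= -leqNgt.
move: H; rewrite -E /rq /rprs size_filter; lia.
Qed.

Lemma rprs_prop q : q \in rprs I -> [/\ prime q, rY I < q & q <= rX I].
Proof.
rewrite mem_filter mem_filter mem_iota add0n ltnS => /andP[lt /andP[pq /andP[_ le]]].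
by split.
Qed.

Lemma rpr_gt v : v <= 2 * rG I -> rY I < rpr I v.
Proof.
move=> lt; have /rprs_prop[] // : rpr I v \in rprs I.
by apply: mem_nth; apply: leq_ltn_trans size_rprs.
Qed.

Lemma rM_gt0 : 0 < rM I. Proof. by []. Qed.

Lemma rpr_range v : 0 < rpr I v <= rM I.
Proof.
case: (ltnP v (size (rprs I))) => lt; last by rewrite /rpr nth_default.
have /rprs_prop[pq _ le] : rpr I v \in rprs I by exact: mem_nth.
by rewrite prime_gt0 //= /rM ltnW.
Qed.

Lemma rpr_CRT (u : nat -> nat) : exists e, forall v, e = u v %[mod rpr I v].
Proof.
have uq : uniq (rprs I) by rewrite !filter_uniq // iota_uniq.
have pq : all prime (rprs I) by apply/allP => q /rprs_prop[].
have [e He] := chinese_seq (fun q => u (index q (rprs I))) uq pq.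
exists e => v; case: (ltnP v (size (rprs I))) => lt; last by rewrite /rpr nth_default // !modn1.
by rewrite (He (rpr I v)) ?mem_nth // /rpr index_uniq.
Qed.

Definition red_plom : plom :=
  residue_plom (rB I) 6 (rvars I) (rfn I) rM_gt0 rpr_range rsh (rus I).

Lemma red_fE : red_f I = plom_code red_plom.
Proof.
rewrite /red_f /plom_code; congr words_code; congr cons.
  have H (i : 'I_(rN I)) : pos_bit (rM I) (rB I) 6 (rfn I) i = str red_plom i by rewrite /= ffunE.
  by rewrite -(val_enum_ord (rN I)) -[LHS]map_comp; exact: (eq_map H).
by rewrite -[RHS]map_comp; apply: eq_map => u /=; rewrite perm_codeE plist_pshift.
Qed.

Lemma red_powers : powers_of_one red_plom.
Proof. by apply: residue_powers; exact: rpr_CRT. Qed.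

Variables (cb nx : seq bool -> seq bool).
Hypotheses
  (size_cb : forall x, size (cb x) = clen I)
  (size_nx : forall x, size (nx x) < sl I)
  (runs_p : forall X : seq bool, size X = sl I ->
    computes_within p [:: I; X] (cb (unpad X) ++ pad (sl I) (nx (unpad X))) (rT I)).

Lemma red_correct y : local_opt PLOM (red_f I) y ->
  lex_le (cb (red_g I y)) (cb (nx (red_g I y))).
Proof.
rewrite red_fE => /(residue_local_opt rpr_CRT (isT : 0 < 6)) [e [yE H]].
pose x v := e %% rpr I v.
have G0 := rG_gt0; have Wb := W_bigI.
have ginP i k : rW I <= i -> i < rG I -> gate_in (rW I) i k < i by move=> Wi _; exact: (gate_in_lt Wb).
have oinP i : roin I i < rG I by exact: (gate_out_lt Wb).
have coutP j : rcout I j < rG I by exact: (gate_out_lt Wb).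
have gfP i vs : gate p I (sl I) (rW I) i vs < ncells p by exact: gate_lt.
have xmin a v b : a < 2 * (rG I).+1 -> 0 < v <= 2 * rG I -> b < ncells p ->
  lex_le (bits (nblocks (rG I) (clen I)) 6 (rvars I) (rfn I) x)
         (bits (nblocks (rG I) (clen I)) 6 (rvars I) (rfn I) (upd x a v b)).
  move=> aG /andP[v0 vG] bK.
  have p0 := @rpr_gt 0 isT; have pv := rpr_gt vG.
  (* The increments that carry the current residues to a and b. *)
  pose al := (a + (rpr I 0 - x 0)) %% rpr I 0.
  pose be := (b + (rpr I v - x v)) %% rpr I v.
  have hit w c : c < rpr I w -> ((c + (rpr I w - x w)) %% rpr I w + e) %% rpr I w = c.
    move=> lt; have /andP[pw _] := rpr_range w.
    rewrite modnDml -modnDmr -/(x w) -addnA subnK; last by rewrite ltnW // ltn_pmod.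
    by rewrite modnDr modn_small.
  have um : (al, (v, be)) \in rus I.
    apply/flattenP; exists (flatten [seq [seq (al, (v, b)) | b <- iota 0 (rM I)] | v <- iota 1 (2 * rG I)]).
      apply/mapP; exists al => //; rewrite mem_iota add0n /=.
      by have /andP[q0 qM] := rpr_range 0; apply: leq_trans qM; exact: ltn_pmod.
    apply/flattenP; exists [seq (al, (v, b)) | b <- iota 0 (rM I)].
      by apply/mapP; exists v => //; rewrite mem_iota; lia.
    apply/mapP; exists be => //; rewrite mem_iota add0n /=.
    by have /andP[q0 qM] := rpr_range v; apply: leq_trans qM; exact: ltn_pmod.
  have E : rus I = take (index (al, (v, be)) (rus I)) (rus I) ++
      (al, (v, be)) :: drop (index (al, (v, be)) (rus I)).+1 (rus I).
    by rewrite -{1}(cat_take_drop (index (al, (v, be)) (rus I)) (rus I)) (drop_nth (0, (0, 0))) ?index_mem // nth_index.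
  have := H _ _ _ E; congr (is_true (lex_le _ (bits _ _ _ _ _))).
  apply: functional_extensionality => w; rewrite /rsh /upd /=.
  case: (eqVneq w 0) => [->|_]; first by rewrite hit //; move: p0; rewrite /rY; lia.
  case: (eqVneq w v) => [->|_]; last by rewrite add0n.
  by rewrite hit //; move: pv; rewrite /rY; lia.
have CL := cost_le G0 ginP oinP coutP gfP xmin.
have VAL := local_min_valid G0 ginP oinP coutP gfP xmin.
set h := half (rG I) (x 0) in CL VAL.
pose X s := xword (sl I) (rG I) s x.
have sX s : size (X s) = sl I by rewrite size_map size_iota.
have valid s i : i < rG I -> rW I <= i ->
    x (wvar (rG I) s i) = gate p I (sl I) (rW I) i (inputs (rG I) (rW I) (gate_in (rW I)) (roin I) s i x).
  by move=> iG Wi; apply: VAL => //; case: ifP.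
have out s j (jW : j < rW I) := tableau_out Wb (erefl (rG I)) (valid s) (runs_p (sX s)) jW.
have cost s : [seq rcbit (x (wvar (rG I) s (rcout I j))) | j <- iota 0 (clen I)] = cb (unpad (X s)).
  apply: (@eq_from_nth _ false); rewrite size_map size_iota ?size_cb // => j jc.
  rewrite (nth_map 0) ?size_iota // nth_iota // add0n /rcbit /rcout out; last by rewrite /rW; lia.
  by rewrite nth_cat size_cb jc; case: (nth false _ j).
(* The run has ended, so the input row of the other side is valid too: it copies the successor
   computed by the side that is read. *)
have XN : X (~~ h) = pad (sl I) (nx (unpad (X h))).
  apply: (@eq_from_nth _ false); first by rewrite sX size_pad.
  rewrite sX => d dn; rewrite (nth_map 0) ?size_iota // nth_iota // add0n.
  have dW : d < rW I by rewrite /rW; lia.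
  have dG : d < rG I by apply: leq_trans rW_le_rG.
  rewrite VAL //; last by case: (h).
  rewrite /gate divn_small //= /src dW negbK /roin out; last by rewrite /rW; lia.
  by rewrite nth_cat size_cb ltnNge leq_addr /= addKn; case: (nth false _ d).
have gE : red_g I y = unpad (X h).
  have zE : unary_decode y = [seq shift (rM I) (rB I) 6 (rpr I) (rvars I) (fun=> e) i | i <- iota 0 (rN I)].
    by rewrite yE perm_codeE unary_codeK plist_pshift.
  have BN : rB I <= rN I by rewrite /rN leq_pmull // expn_gt0.
  have digz r k : r < rB I -> k < 6 -> dig (rM I) (nth 0 (unary_decode y) r %/ rB I) k = x (rvars I r k).
    move=> rB6 k6; rewrite zE (nth_map 0) ?size_iota; last exact: leq_trans BN.
    rewrite nth_iota; last exact: leq_trans BN.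
    by rewrite add0n (dig_shift _ rM_gt0 rpr_range).
  have hE : red_half I (unary_decode y) = h.
    rewrite /red_half digz //; last by rewrite /rB; lia.
    by rewrite /rvars /cvars; case: ltnP => //; lia.
  rewrite /red_g hE; congr unpad; apply/eq_in_map => d; rewrite mem_iota add0n => /andP[_ dn].
  have dW : d < rW I by rewrite /rW; lia.
  have dG : d < rG I by apply: leq_trans rW_le_rG.
  have r2 : h * rG I + d < 2 * rG I by case: (h) => /=; lia.
  have r4 : h * rG I + d < 4 * rG I by lia.
  rewrite digz //; last by rewrite /rB; lia.
  rewrite /rvars /cvars r4 /= /bside /bgate /bhalf divn_small // (modn_small r2) /=.
  rewrite modnMDl modn_small // (_ : (rG I <= h * rG I + d) = h) //.
  by case: (h) => /=; lia.
rewrite gE -(padK (sl I) (nx (unpad (X h)))) -XN -!cost; exact: CL.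
Qed.

End Correct.
End Reduction.

Theorem PLS_reducible_PLOM_powers L : in_PLS L -> PLS_reducible L PLOM_powers.
Proof.
case=> [[kl Hlen]] [chi [Pchi Hchi]] [st [Pst Hst]] [nb [Pnb Hnb]] [mx [co [Pco Hco]]].
(* PLS bounds the length of solutions but not that of costs; the running time of the cost function
   does. *)
have [cl Hcl] : exists cl, forall I x, feasible_pair L I x -> size (co I x) <= peval cl (size I).
  have [e He] := PF_size (PF_of_polytime2 Pco).
  exists (psubst e (PA (PM (PC 4) PX) (PA (PM (PC 4) (PA (pexpn kl) (PC kl))) (PC 3)))) => I x F.
  have h1 : size (co I x) <= sz (co I x) by exact: size_le_sz.
  have h2 : sz (co I x) <= peval e (sz (I, x)) by exact: (He (I, x) F).
  rewrite peval_subst; apply: leq_trans h1 (leq_trans h2 _); apply: peval_mono.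
  have s1 : sz I <= 4 * size I + 1 by exact: sz_word.
  have s2 : sz x <= 4 * size x + 1 by exact: sz_word.
  by rewrite sz_pair /= peval_expn; have := Hlen I x F; lia.
have [p [kt Hp]] := improve_polytime kl mx cl Pchi Hchi Pst Pnb Pco.
pose sl : seq bool -> nat := sol_len kl; pose clen : seq bool -> nat := cost_len cl.
have Psl Q : PF Q sl by rewrite /sl /sol_len; pf.
have Pclen Q : PF Q clen by rewrite /clen /cost_len; pf.
exists (red_f p kt sl clen), (red_g p kt sl clen); split.
- by apply: PF_polytime1; exact: PF_red_f.
- by apply: PF_polytime2; exact: PF_red_g.
- move=> I _; split; first by exists (red_plom p kt sl clen I); rewrite red_fE.
  by exists (red_plom p kt sl clen I); [rewrite red_fE | exact: red_powers].
move=> I y iI H.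
apply: (stable_local_opt (st := st) Hchi Hst Hnb Hco Hcl iI).
apply: (@red_correct p kt sl clen I (cost_bits chi mx co cl I) (next_sol chi st nb mx co cl I)) => //.
- by move=> x; exact: (size_cost_bits mx Hchi Hcl x iI).
- by move=> x; exact: (size_next_sol mx co cl Hlen Hchi Hst Hnb x iI).
- move=> X sX; have := Hp [:: I; X] (ex_intro _ I (ex_intro _ X (conj iI erefl))).
  by rewrite /= size_cat cats0 /rT sX.
Qed.

Theorem theorem5 : PLS_complete PLOM /\ PLS_complete PLOM_powers.
Proof.
split; split; first exact: PLOM_in_PLS; last exact: PLS_reducible_PLOM_powers.
  (* Restriction changes only which words are instances, so feasibility and local optima, and with
     them both maps, carry over. *)
  move=> L /PLS_reducible_PLOM_powers [f [g [Pf Pg Hf Hg]]].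
  by exists f, g; split=> // I /Hf [].
by apply: in_PLS_restrict; exact: PLOM_in_PLS.
Qed.
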